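(* Let $G=([n],E)$ be a connected graph with treewidth $\mathrm{tw}(G)\le k$ and maximum degree $\Delta(G)\le d$. Let $\Sigma\in\mathcal M(G)$ be generic, and let the sample size $m$ used in the subroutine $\mathtt{Separator}$ satisfy $$m\;\ge\;\max\left(\frac{10r}{\delta^2}\log\left(\frac{8r}{\delta^2}\right),\ \frac{2}{\delta^2}\log\left(\frac2\tau\right)\right)$$ with $r\ge 11k$, $0<\delta\le\frac1{24}$ and $0<\tau\le\frac13$. Then, with probability at least $1-\frac1{n^8}$, the query complexity of $\mathtt{Reconstruct}([n],\emptyset)$ is of the order $$\mathcal O\left(\left(2^{\mathcal O(k\log k)}+dk\log n\right)k^2\,n\log^3 n\right),$$ and the time complexity is of the order $$\mathcal O\left(\left(2^{\mathcal O(k\log k)}+dk\log n\right)k^3\,n\log^4 n\right).$$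
   Context: Notation: $[n]=\{1,\dots,n\}$; $\Sigma$ is a symmetric positive definite $n\times n$ matrix, $K=\Sigma^{-1}$; $\mathcal M(G)$ is the set of symmetric positive definite $\Sigma$ with $K_{ij}=0$ for all $i\ne j$, $ij\notin E(G)$. $\Sigma_{A,B}$ is the submatrix with rows in $A$, columns in $B$; $\Sigma_A=\Sigma_{A,A}$ (and likewise for other matrices); inside subscripts $AB$ means $A\cup B$ and $v$ means $\{v\}$. Define $\Sigma_{A,B|S}=\Sigma_{A,B}-\Sigma_{A,S}\Sigma_{S,S}^{-1}\Sigma_{S,B}$ and $\Sigma_{A|S}=\Sigma_{A,A|S}$ (with $\Sigma_{A,B|\emptyset}=\Sigma_{A,B}$). A set $S$ separates $A,B\subseteq [n]$ (possibly intersecting) if every path from $A$ to $B$, including single-vertex paths, contains a vertex of $S$. $\Sigma\in\mathcal M(G)$ is generic if $\operatorname{rank}(\Sigma_{A,B})=\min\{|S|:S\text{ separates }A\text{ and }B\text{ in }G\}$ for all $A,B\subseteq[n]$. The treewidth $\mathrm{tw}(G)$ is the minimum, over all tree decompositions of $G$, of the size of the largest bag minus one. Entries of $\Sigma$ are accessed only through a covariance oracle returning $\sigma_{ij}$ on input $(i,j)$; query complexity is the number of entries of $\Sigma$ queried; time complexity is the number of elementary operations (oracle calls, real arithmetic, comparisons, uniform sampling of a vertex, at unit cost; ranks, inverses and products of $p\times p$ matrices computed in $\mathcal O(p^3)$ time; products with $\widehat K$ use its sparsity). $\mathtt{ABSeparator}(V,A,B,S)$ (for $A,B\subseteq V$,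 $S\cap V=\emptyset$): let $r=\operatorname{rank}(\Sigma_{AS,BS})$ and $U=\{v\in V:\operatorname{rank}(\Sigma_{ASv,BSv})=r\}$. Set $C=\{v_0\}$ for some $v_0\in U$; for each $u\in U\setminus\{v_0\}$ in turn, if $\operatorname{rank}(\Sigma_{ASCu,BSCu})=r$ replace $C$ by $C\cup\{u\}$. Return $C$. $\mathtt{Separator}(V,S)$: pick $W\subseteq V$ by sampling $m$ vertices of $V$ uniformly at random with replacement; search exhaustively over all partitions of $W$ into $A,B$ with $|A|,|B|\le\frac23|W|$ for one minimizing $\operatorname{rank}(\Sigma_{AS,BS})$ (if no such balanced partition exists take any partition $A,B$ of $W$); return $\mathtt{ABSeparator}(V,A,B,S)$. $\mathtt{Components}(V,S)$: let $S'=\mathtt{Separator}(V,S)$, $r=|S|+|S'|$, $R=\emptyset$. For each $v\in V\setminus S'$: for each $u\in R$, if $\operatorname{rank}(\Sigma_{uSS',vSS'})=r+1$ add $v$ to $C_u$; if this holds for no $u\in R$, create $C_v=\{v\}$ and add $v$ to $R$. Return $S'$ and all sets $C_v$, $v\in R$. $\mathtt{Reconstruct}(V,S)$: if $|V|>m$, let $C_1,\dots,C_\ell,S'$ be the output of $\mathtt{Components}(V,S)$; for each $i$ set $\widehat K_{C_i}\leftarrow\mathtt{Reconstruct}(C_i,S\cup S')$ and $\widehat K_{C_i,S'}\leftarrow-\widehat K_{C_i}\Sigma_{C_i,S'|S}\Sigma_{S'|S}^{-1}$, $\widehat K_{S',C_i}\leftarrow\widehat K_{C_i,S'}^T$; then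 set $\widehat K_{S'}\leftarrow\left(\mathbb I_{|S'|}-\sum_{i}\widehat K_{S',C_i}\Sigma_{C_i,S'|S}\right)\Sigma_{S'|S}^{-1}$ (with $\mathbb I_p$ the $p\times p$ identity matrix) and return $\widehat K_V$. If $|V|\le m$, set $\widehat K_V\leftarrow(\Sigma_{V|S})^{-1}$ and return it. The matrix $\widehat K\in\mathbb R^{n\times n}$ is initialized to $0$, and the main algorithm calls $\mathtt{Reconstruct}([n],\emptyset)$.
   Formalization: As printed m is only bounded below, and m ≥ n already costs n² queries; the formal theorem adds r ≤ ρk and m ≤ μ·max(…) for arbitrary constants ρ, μ, takes n ≥ 2, and lets the implied constants depend on δ, τ, ρ, μ and the cost-model constant. *)

(* Defs.v *)
From HB Require Import structures.
From mathcomp Require Import boolp classical_sets reals exp.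
From mathcomp Require Import all_boot all_order all_algebra.

Set Implicit Arguments.
Unset Strict Implicit.
Unset Printing Implicit Defensive.

Import Order.TTheory GRing.Theory Num.Theory.

Local Open Scope ring_scope.

(* The vertex set {1, ..., n} is 'I_n; a simple graph is a symmetric
   irreflexive relation e. *)

Definition connected_graph (T : finType) (e : rel T) : Prop :=
  forall x y, connect e x y.

Definition max_degree (T : finType) (e : rel T) : nat :=
  \max_(x : T) #|[set y | e x y]|.

(* The case p = [::] is the single-vertex path, so that S contains A :&: B. *)
Definition separates (T : finType) (e : rel T) (A B S : {set T}) : Prop :=
  forall (x : T) (p : seq T),
    x \in A -> path e x p -> last x p \in B -> has (mem S) (x :: p).

Definition is_min_separator_size (T : finType) (e : rel T) (A B : {set T})
    (s : nat) : Prop :=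
  (exists2 S : {set T}, separates e A B S & #|S| = s) /\
  (forall S : {set T}, separates e A B S -> (s <= #|S|)%N).

Definition is_tree (T : finType) (t : rel T) : Prop :=
  [/\ (0 < #|T|)%N, symmetric t, irreflexive t, connected_graph t &
      forall c : seq T, (2 < size c)%N -> ~ ucycle t c].

Record tree_decomposition (V : finType) (e : rel V) := TreeDecomposition {
  td_node : finType;
  td_edge : rel td_node;
  td_bag : td_node -> {set V};
  td_tree : is_tree td_edge;
  td_vertex : forall v, exists x, v \in td_bag x;
  td_cover : forall u v, e u v -> exists x, (u \in td_bag x) && (v \in td_bag x);
  td_subtree : forall v x y, v \in td_bag x -> v \in td_bag y ->
    connect [rel a b | [&& td_edge a b, v \in td_bag a & v \in td_bag b]] x y
}.

Definition td_width (V : finType) (e : rel V) (D : tree_decomposition e) : nat :=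
  (\max_(x : td_node D) #|td_bag x|).-1.

Lemma tree_decomposition_exists (V : finType) (e : rel V) :
  exists w : nat, `[< exists D : tree_decomposition e, td_width D = w >].
Proof.
have tP : is_tree (fun _ _ : unit => false).
  split=> //; first by rewrite card_unit.
    by move=> [] []; exact: connect0.
  by move=> [|a [|b c]] //= _ /andP[].
have vP (v : V) : exists x : unit, v \in [set: V].
  by exists tt; rewrite inE.
have cP (u v : V) : e u v -> exists x : unit, (u \in [set: V]) && (v \in [set: V]).
  by move=> _; exists tt; rewrite !inE.
pose D := @TreeDecomposition V e unit (fun _ _ => false) (fun=> [set: V]) tP vP cP.
have sP (v : V) (x y : unit) : v \in [set: V] -> v \in [set: V] ->
    connect [rel a b : unit | [&& false, v \in [set: V] & v \in [set: V]]] x y.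
  by move: x y => [] [] _ _; exact: connect0.
by exists (td_width (D sP)); apply/asboolP; exists (D sP).
Qed.

Definition treewidth (V : finType) (e : rel V) : nat :=
  ex_minn (tree_decomposition_exists e).

(* Rows in A, columns in B. *)
Definition submx_of (R : Type) (n : nat) (A B : {set 'I_n}) (M : 'M[R]_n) :
    'M[R]_(#|A|, #|B|) :=
  mxsub (fun a : 'I_#|A| => enum_val a) (fun b : 'I_#|B| => enum_val b) M.

Definition posdef (R : realType) (n : nat) (M : 'M[R]_n) : Prop :=
  M^T = M /\ forall x : 'rV[R]_n, x != 0 -> 0 < (x *m M *m x^T) 0 0.

Definition in_model (R : realType) (n : nat) (e : rel 'I_n) (Sigma : 'M[R]_n) :
    Prop :=
  posdef Sigma /\ forall i j, i != j -> ~~ e i j -> invmx Sigma i j = 0.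

Definition generic (R : realType) (n : nat) (e : rel 'I_n) (Sigma : 'M[R]_n) :
    Prop :=
  forall A B : {set 'I_n},
    is_min_separator_size e A B (\rank (submx_of A B Sigma)).

(* Randomised programs whose only access to Sigma is through the oracle calls
   [Query].
   - [Sample V f] draws a uniform element of V;
   - [Choose s f] continues with an arbitrary element of s: it stands for a
     choice or an order of enumeration that the algorithm leaves open;
   - [Tick c p] spends c further elementary operations;
   - [Timeout] is the result of running out of fuel (see [Reconstruct]). *)
Inductive prog (R : Type) (n : nat) (X : Type) : Type :=
| Ret (x : X)
| Query (i j : 'I_n) (f : R -> prog R n X)
| Sample (V : {set 'I_n}) (f : 'I_n -> prog R n X)
| Choose (T : Type) (s : seq T) (f : T -> prog R n X)
| Tick (c : nat) (p : prog R n X)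
| Timeout.

Arguments Ret {R n X} x.
Arguments Query {R n X} i j f.
Arguments Sample {R n X} V f.
Arguments Choose {R n X T} s f.
Arguments Tick {R n X} c p.
Arguments Timeout {R n X}.

Fixpoint bind (R : Type) (n : nat) (X Y : Type) (p : prog R n X)
    (g : X -> prog R n Y) : prog R n Y :=
  match p with
  | Ret x => g x
  | Query i j f => Query i j (fun a => bind (f a) g)
  | Sample V f => Sample V (fun v => bind (f v) g)
  | Choose T s f => Choose s (fun a => bind (f a) g)
  | Tick c p' => Tick c (bind p' g)
  | Timeout => Timeout
  end.

Notation "'let*' x := p 'in' q" := (bind p (fun x => q))
  (at level 200, x pattern, p at level 200, q at level 200).

Fixpoint foldM (R : Type) (n : nat) (X Y : Type)
    (f : X -> Y -> prog R n X) (x : X) (s : seq Y) : prog R n X :=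
  if s is y :: s' then let* x' := f x y in foldM f x' s' else Ret x.

Fixpoint mapM (R : Type) (n : nat) (X Y : Type)
    (f : Y -> prog R n X) (s : seq Y) : prog R n (seq X) :=
  if s is y :: s' then
    let* x := f y in let* xs := mapM f s' in Ret (x :: xs)
  else Ret [::].

(* Probability that a run of p against the oracle Sigma halts with a number q'
   of oracle calls (counted with repetitions) and a number t' of elementary
   operations such that E q' t', when q calls and t operations have already been
   made.  Oracle calls and samplings are elementary operations.  The minimum over
   the alternatives of a [Choose] makes a lower bound on this probability valid
   whatever the open choices are; they may depend on the past of the run only. *)
Fixpoint pr (R : realType) (n : nat) (X : Type) (Sigma : 'M[R]_n)
    (E : nat -> nat -> bool) (p : prog R n X) (q t : nat) : R :=
  match p with
  | Ret _ => (E q t)%:R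
  | Query i j f => pr Sigma E (f (Sigma i j)) q.+1 t.+1
  | Sample V f => (\sum_(v in V) pr Sigma E (f v) q t.+1) / #|V|%:R
  | Choose T s f =>
      if s is [::] then 0 else \big[Num.min/1]_(a <- s) pr Sigma E (f a) q t
  | Tick c p' => pr Sigma E p' q (t + c)%N
  | Timeout => 0
  end.

(* For programs indexed by the fuel: halting within some amount of fuel. *)
Definition halting_pr (R : realType) (n : nat) (X : Type) (Sigma : 'M[R]_n)
    (E : nat -> nat -> bool) (p : nat -> prog R n X) : R :=
  sup (range (fun fuel : nat => pr Sigma E (p fuel) 0 0)).

(* Cost model: ranks and inverses of p x p matrices take kappa * p ^ 3
   operations, a rectangular matrix of either shape being charged as a square one
   of the larger dimension; products and entrywise operations are charged
   kappa times the number of scalar operations, where in a product with a sparse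
   left factor only the nonzero entries of that factor count. *)
Section Algorithm.
Context (R : realType) (n : nat).
Local Notation vset := {set 'I_n}.
Local Notation prog := (prog R n).

Definition set_entry (M : 'M[R]_n) (i j : 'I_n) (x : R) : 'M[R]_n :=
  \matrix_(a, b) if (a == i) && (b == j) then x else M a b.

Definition set_block (A B : vset) (N : 'M[R]_(#|A|, #|B|)) (M : 'M[R]_n) :
    'M[R]_n :=
  \matrix_(i, j)
    match [pick a : 'I_#|A| | enum_val a == i],
          [pick b : 'I_#|B| | enum_val b == j] with
    | Some a, Some b => N a b
    | _, _ => M i j
    end.

Definition nnz (p q : nat) (M : 'M[R]_(p, q)) : nat :=
  #|[set ij : 'I_p * 'I_q | M ij.1 ij.2 != 0]|.

Definition query_block (A B : vset) : prog 'M[R]_(#|A|, #|B|) :=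
  let* M := foldM (fun M ij =>
      Query ij.1 ij.2 (fun x => Ret (set_entry M ij.1 ij.2 x)))
    0 [seq (i, j) | i <- enum A, j <- enum B] in
  Ret (submx_of A B M).

Definition rank_block (kappa : nat) (A B : vset) : prog nat :=
  let* M := query_block A B in
  Tick (kappa * maxn #|A| #|B| ^ 3)%N (Ret (\rank M)).

Definition inv_op (kappa p : nat) (M : 'M[R]_p) : prog 'M[R]_p :=
  Tick (kappa * p ^ 3)%N (Ret (invmx M)).

Definition mul_op (kappa p q r : nat) (M : 'M[R]_(p, q)) (N : 'M[R]_(q, r)) :
    prog 'M[R]_(p, r) :=
  Tick (kappa * (p * q * r))%N (Ret (M *m N)).

Definition sparse_mul_op (kappa p q r : nat) (M : 'M[R]_(p, q))
    (N : 'M[R]_(q, r)) : prog 'M[R]_(p, r) :=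
  Tick (kappa * (nnz M * r))%N (Ret (M *m N)).

Definition sub_op (kappa p q : nat) (M N : 'M[R]_(p, q)) : prog 'M[R]_(p, q) :=
  Tick (kappa * (p * q))%N (Ret (M - N)).

Definition write_op (kappa : nat) (A B : vset) (N : 'M[R]_(#|A|, #|B|))
    (M : 'M[R]_n) : prog 'M[R]_n :=
  Tick (kappa * (#|A| * #|B|))%N (Ret (set_block N M)).

(* Sigma_{A,B|S}; for S = set0 the correction is a product over an empty
   index set, hence 0. *)
Definition cond_block (kappa : nat) (A B S : vset) : prog 'M[R]_(#|A|, #|B|) :=
  let* MAB := query_block A B in
  let* MAS := query_block A S in
  let* MSS := query_block S S in
  let* MSB := query_block S B in
  let* MSSinv := inv_op kappa MSS in
  let* P := mul_op kappa MSSinv MSB in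
  let* Q := mul_op kappa MAS P in
  sub_op kappa MAB Q.

(* When U is empty there is no v0 and the returned set is empty. *)
Definition ABSeparator (kappa : nat) (V A B S : vset) : prog vset :=
  let* r := rank_block kappa (A :|: S) (B :|: S) in
  let* U := foldM (fun (U : vset) v =>
      let* r' := rank_block kappa (v |: (A :|: S)) (v |: (B :|: S)) in
      Tick 1 (Ret (if r' == r then v |: U else U)))
    set0 (enum V) in
  if U == set0 then Ret set0 else
  Choose (enum U) (fun v0 =>
  Choose (permutations (enum (U :\ v0))) (fun us =>
    foldM (fun (C : vset) u =>
        let* r' := rank_block kappa (u |: (A :|: S :|: C))
                                    (u |: (B :|: S :|: C)) in
        Tick 1 (Ret (if r' == r then u |: C else C)))
      [set v0] us)).

Fixpoint sample_set (V : vset) (m : nat) (W : vset) : prog vset :=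
  if m is m'.+1 then Sample V (fun v => sample_set V m' (v |: W)) else Ret W.

Definition bipartitions (W : vset) : seq (vset * vset) :=
  [seq (A, W :\: A) | A <- enum (powerset W)].

Definition balanced_bipartitions (W : vset) : seq (vset * vset) :=
  [seq AB : vset * vset <- bipartitions W |
    (3 * #|AB.1| <= 2 * #|W|)%N && (3 * #|AB.2| <= 2 * #|W|)%N].

Definition Separator (m kappa : nat) (V S : vset) : prog vset :=
  let* W := sample_set V m set0 in
  let cand := balanced_bipartitions W in
  Tick (2 * size (bipartitions W))%N
  (let* rs := mapM (fun AB : vset * vset =>
      let* r := rank_block kappa (AB.1 :|: S) (AB.2 :|: S) in
      Tick 1 (Ret (r, AB))) cand in
  let best := [seq x.2 | x <- rs & all (fun y => (x.1 <= y.1)%N) rs] in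
  Choose (if cand is [::] then bipartitions W else best)
    (fun AB => ABSeparator kappa V AB.1 AB.2 S)).

(* A list of pairs (u, C_u) with u ranging over the representatives R. *)
Definition classify (kappa : nat) (Z : vset) (cs : seq ('I_n * vset))
    (v : 'I_n) : prog (seq ('I_n * vset)) :=
  let* tested := mapM (fun uC : 'I_n * vset =>
      let* r := rank_block kappa (uC.1 |: Z) (v |: Z) in
      Tick 1 (Ret (r == #|Z|.+1, uC))) cs in
  Ret (if has fst tested
       then [seq if x.1 then (x.2.1, v |: x.2.2) else x.2 | x <- tested]
       else rcons cs (v, [set v])).

Definition Components (m kappa : nat) (V S : vset) : prog (seq vset * vset) :=
  let* S' := Separator m kappa V S in
  Choose (permutations (enum (V :\: S'))) (fun vs =>
    let* cs := foldM (classify kappa (S :|: S')) [::] vs in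
    Ret ([seq uC.2 | uC <- cs], S')).

(* The fuel bounds the depth of the recursion, which is not bounded a priori:
   a call whose separator is empty recurses on the same V.  The matrix Khat
   (K-hat) is threaded as a state and updated in place. *)
Fixpoint Reconstruct (m kappa fuel : nat) (V S : vset) (Khat : 'M[R]_n) :
    prog 'M[R]_n :=
  if fuel is fuel'.+1 then
    Tick 1
    (if (m < #|V|)%N then
      let* (Cs, S') := Components m kappa V S in
      let* T := cond_block kappa S' S' S in
      let* Tinv := inv_op kappa T in
      let* (Khat1, acc) := foldM (fun (st : 'M[R]_n * 'M[R]_#|S'|) (C : vset) =>
          let* K0 := Reconstruct m kappa fuel' C (S :|: S') st.1 in
          let* F := cond_block kappa C S' S in
          let* P := sparse_mul_op kappa (submx_of C C K0) F in
          let* Q := mul_op kappa P Tinv in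
          let* K1 := write_op kappa (- Q) K0 in
          let* K2 := write_op kappa ((- Q)^T) K1 in
          let* H := sparse_mul_op kappa (submx_of S' C K2) F in
          Tick (kappa * (#|S'| * #|S'|))%N (Ret (K2, st.2 + H)))
        (Khat, 0) Cs in
      let* D := sub_op kappa 1%:M acc in
      let* KS := mul_op kappa D Tinv in
      write_op kappa KS Khat1
    else
      let* T := cond_block kappa V V S in
      let* Tinv := inv_op kappa T in
      write_op kappa Tinv Khat)
  else Timeout.

End Algorithm.

Definition sample_bound (R : realType) (r delta tau : R) : R :=
  Num.max (10 * r / delta ^+ 2 * ln (8 * r / delta ^+ 2))
          (2 / delta ^+ 2 * ln (2 / tau)).

(* C * (2^(c k log k) + d k log n), the implied constants being c and C. *)
Definition call_bound (R : realType) (c C : R) (n k d : nat) : R :=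
  C * (2 `^ (c * (k%:R * ln k%:R)) + d%:R * k%:R * ln n%:R).

Definition query_bound (R : realType) (c C : R) (n k d : nat) : R :=
  call_bound c C n k d * k%:R ^+ 2 * n%:R * ln n%:R ^+ 3.

Definition time_bound (R : realType) (c C : R) (n k d : nat) : R :=
  call_bound c C n k d * k%:R ^+ 3 * n%:R * ln n%:R ^+ 4.

(* Main.v *)
(* Genericity turns ranks of blocks of Sigma into sizes of minimum separators.  A
   bag of a tree decomposition separates the sample W in a balanced way, so the
   separators S' have at most k + 1 vertices.  Connected sets with a boundary of
   at most k + 1 vertices form a family of VC dimension O(k): pairs of points of a
   shattered set are linked by connected sets that are disjoint outside the apex
   of each, and the boundary of a trace that splits many pairs has to contain the
   apexes of many of them.  By double sampling, with probability at least 1/6 a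
   separator that is balanced on W leaves no component with more than 999/1000 of
   the vertices.  Hence the expected sum of the squared sizes of the components
   shrinks by a constant factor per level of the recursion, which therefore ends
   after O(log n) levels with probability at least 1 - n^-8.

   The cost of a level is bounded on every run: the sets V of a level are disjoint
   and |S| = O(k log n).  The Schur complement formulas of Reconstruct return the
   block of Sigma^-1 exactly, so that the sparse products have at most d + 1
   nonzero entries per row. *)

Require Import Defs.
From mathcomp Require Import boolp classical_sets reals sequences exp.
From mathcomp Require Import all_boot all_order all_algebra.
From mathcomp Require Import zify ring lra.

Set Implicit Arguments.
Unset Strict Implicit.
Unset Printing Implicit Defensive.

(** * Shattered sets of connected sets with small boundary *)

(** The separator is computed from the sample, so concentration for a fixed set does not help: the
    sample has to be good for all connected sets of small boundary at once. The boundary is counted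
    inside V, since its part in S may be of order k log n. Draws are with replacement and |V| may
    barely exceed m, so a sample can repeat itself often, while balance concerns distinct points.
    Fewer than m/4 distinct points occur with probability at most 2/3; double sampling adds a
    failure of at most 1/6, which leaves 1/6. A component that misses at most |V|/1000 vertices, yet
    at least a third of the distinct sample points, forces m/12 draws into its small complement; the
    gap between 1/1000 and 1/12 pays for the union bound. Chance influences the depth only: costs
    are bounded along each halting run, for all draws and all open choices. The sum of squares is
    used as potential because it never increases, even in a bad call. Its initial value n^2 and a
    decay to n^-10 give the failure probability n^-8. *)

Section Graph.
Context (T : finType) (e : rel T) (e_sym : symmetric e).
Implicit Types (A B C N P X Z : {set T}).

Definition within A : rel T := [rel x y | [&& e x y, x \in A & y \in A]].

Definition conn A := [forall x in A, [forall y in A, connect (within A) x y]].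

Lemma connP A :
  reflect {in A &, forall x y, connect (within A) x y} (conn A).
Proof.
apply: (iffP forall_inP) => [cA x y xA yA|cA x xA].
  by have /forall_inP/(_ y yA) := cA x xA.
by apply/forall_inP => y yA; apply: cA.
Qed.

Definition nbhd A : {set T} := [set y | (y \notin A) && [exists x in A, e x y]].

Lemma within_sym A : symmetric (within A).
Proof. by move=> x y; rewrite /within /= e_sym [(x \in A) && _]andbC. Qed.

Lemma connect_within_sym A : connect_sym (within A).
Proof. exact/sym_connect_sym/within_sym. Qed.

Lemma sub_connect_within A B x y :
  A \subset B -> connect (within A) x y -> connect (within B) x y.
Proof.
move=> sAB; apply: connect_sub => u v /and3P[uv uA vA].
by apply: connect1; rewrite /within /= uv !(subsetP sAB).
Qed.

Lemma conn1 x : conn [set x].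
Proof. by apply/connP => y z /set1P-> /set1P->; apply: connect0. Qed.

Lemma connU A B x y : conn A -> conn B -> x \in A -> y \in B ->
  (x == y) || e x y -> conn (A :|: B).
Proof.
move=> /connP cA /connP cB xA yB xy.
have xyc : connect (within (A :|: B)) x y.
  case/orP: xy => [/eqP->|xy]; first exact: connect0.
  by apply: connect1; rewrite /within /= xy !inE xA yB orbT.
have hA z : z \in A -> connect (within (A :|: B)) z x.
  by move=> zA; apply: sub_connect_within (cA _ _ zA xA); apply: subsetUl.
have hB z : z \in B -> connect (within (A :|: B)) z y.
  by move=> zB; apply: sub_connect_within (cB _ _ zB yB); apply: subsetUr.
have h z : z \in A :|: B -> connect (within (A :|: B)) z x.
  case/setUP => [/hA //|/hB zy]; apply: connect_trans zy _.
  by rewrite connect_within_sym.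
apply/connP => u v /h ux /h vx; apply: connect_trans ux _.
by rewrite connect_within_sym.
Qed.

Lemma connect_exit (r : rel T) A x y : connect r x y -> x \in A -> y \notin A ->
  exists u v, [/\ u \in A, v \notin A, r u v & connect r x u].
Proof.
case/connectP => p; elim: p x => [|z p IH] x /=; first by move=> _ -> ->.
case/andP=> xz zp yl xA yA.
have [zA|zA] := boolP (z \in A); last by exists x, z; split.
have [u [v [uA vA uv zu]]] := IH z zp yl zA yA.
by exists u, v; split=> //; apply: connect_trans zu; apply: connect1.
Qed.

Lemma nbhd_hit C N a b : conn N -> a \in N -> b \in N -> a \in C -> b \notin C ->
  exists2 x, x \in N & x \in nbhd C.
Proof.
move=> /connP cN aN bN aC bC.
have [u [v [uC vC /and3P[uv uN vN] _]]] := connect_exit (cN _ _ aN bN) aC bC.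
by exists v => //; rewrite inE vC; apply/exists_inP; exists u.
Qed.

(** A largest proper connected subset through a fixed vertex lacks a single vertex [v], since an
    edge leaving it inside [C] could otherwise be used to enlarge it. This replaces a leaf of a
    spanning tree. *)
Lemma conn_remove_leaf C : conn C -> 1 < #|C| ->
  exists v u, [/\ v \in C, u \in C :\ v, e u v & conn (C :\ v)].
Proof.
move=> cC C1.
have /card_gt0P[r rC] : 0 < #|C| by apply: ltnW.
pose P := fun A : {set T} => [&& r \in A, A \proper C & conn A].
have P0 : P [set r].
  by rewrite /P set11 conn1 andbT properEcard sub1set rC cards1.
case: (@arg_maxnP _ [set r] P (fun A => #|A|)) => // A /and3P[rA AC cA] Amax.
have [_ [y yC yA]] := properP AC; move/connP: (cC) => cC'.
have [u [v [uA vA /and3P[uv uC vC] _]]] := connect_exit (cC' _ _ rC yC) rA yA.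
have cvA : conn (v |: A).
  by apply: (connU (conn1 v) cA (set11 v) uA); rewrite e_sym uv orbT.
have sAC : v |: A \subset C by rewrite subUset sub1set vC proper_sub.
have CE : C = v |: A.
  apply/eqP; rewrite eq_sym eqEproper sAC /=; apply/negP => pAC.
  by have := Amax (v |: A); rewrite /P !inE rA orbT pAC cvA cardsU1 vA /geq /= add1n ltnn => /(_ isT).
have AE : C :\ v = A by rewrite CE setU1K.
by exists v, u; rewrite AE vC; split=> //; rewrite e_sym.
Qed.

(** * Linking terminals by connected sets of small overlap *)

Implicit Types (t : T * T * {set T}) (p : T * T * T * {set T}).

(* A token [(a, x, N)] travels from the terminal [a] to the vertex [x] and has
   swept out the set [N] before it reached [x]. *)
Definition token C t := [&& t.1.2 \in C, conn (t.1.2 |: t.2) & t.1.1 \in t.1.2 |: t.2].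

(* A linked pair [(a, b, v, N)]: the connected set [N] contains [a], [b], and the
   apex [v]. *)
Definition linked p := [&& conn p.2, p.1.1.1 \in p.2 & p.1.1.2 \in p.2].

Definition ends p := [:: p.1.1.1; p.1.1.2].

(** Tokens waiting at the same vertex are joined two by two, so at most one is left. Two swept sets
    become connected through [v], and no vertex other than the apex [v] gains load. *)
Lemma pair_at v (ts : seq (T * T * {set T})) :
  all (fun t => [&& t.1.2 == v, conn (v |: t.2) & t.1.1 \in v |: t.2]) ts ->
  exists (L : seq (T * T * T * {set T})) rest,
    [/\ all linked L, all (fun p => p.1.2 == v) L,
        perm_eq (flatten (map ends L) ++ map (fun t => t.1.1) rest)
                (map (fun t => t.1.1) ts), size rest <= 1 /\ {subset rest <= ts} &
        forall z, \sum_(p <- L) (z \in p.2 :\ p.1.2) + \sum_(t <- rest) (z \in t.2)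
                  <= \sum_(t <- ts) (z \in t.2)].
Proof.
have [n] := ubnP (size ts); elim: n ts => // n IH [|t1 [|t2 ts]] szn.
- by exists [::], [::]; split=> //; last by move=> z; rewrite !big_nil.
- by exists [::], [:: t1]; split=> //; [split | move=> z; rewrite big_nil].
case/and3P=> /and3P[/eqP x1 c1 a1] /and3P[/eqP x2 c2 a2] /IH[].
  by move: szn => /=; lia.
move=> L [rest [lL aL pL [sr subr] cL]].
exists ((t1.1.1, t2.1.1, v, (v |: t1.2) :|: (v |: t2.2)) :: L), rest; split=> //=.
- rewrite lL andbT /linked /= !inE.
  rewrite (@connU _ _ v v) ?setU11 ?eqxx //=.
  by move: a1 a2; rewrite !inE => -> ->; rewrite orbT.
- by rewrite eqxx.
- by rewrite !perm_cons.
- by split=> // t /subr; rewrite !inE => ->; rewrite !orbT.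
move=> z; rewrite !big_cons -addnA [X in _ <= X]addnA; apply: leq_add (cL z).
by rewrite !inE /=; case: (z == v); case: (z \in t1.2); case: (z \in t2.2).
Qed.

(** Tokens at a leaf [v] are paired there, and the possible survivor moves on to the neighbour [u].
    A vertex is thus swept by at most one token, when it is removed; this is the load [z \in C] of
    the last clause. Apexes are places where tokens meet and obey no such bound. *)
Lemma pairing C (ts : seq (T * T * {set T})) : conn C -> all (token C) ts ->
  exists (L : seq (T * T * T * {set T})) rest,
    [/\ all linked L, all (fun p => p.1.2 \in C) L,
        perm_eq (flatten (map ends L) ++ rest) (map (fun t => t.1.1) ts),
        size rest <= 1 &
        forall z, \sum_(p <- L) (z \in p.2 :\ p.1.2)
                  <= (z \in C) + \sum_(t <- ts) (z \in t.2)].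
Proof.
have [n] := ubnP #|C|; elim: n C ts => // n IH C ts Cn cC tokC.
have [C1|C1] := leqP #|C| 1.
  case: ts tokC => [|t0 ts] tokC.
    by exists [::], [::]; split=> // z; rewrite big_nil.
  have [v Cv] : exists v, C = [set v].
    apply/cards1P; rewrite eqn_leq C1; apply/card_gt0P; exists t0.1.2.
    by case/andP: tokC => /and3P[].
  have [|L [rest [lL aL pL [sr _] cL]]] := @pair_at v (t0 :: ts).
    apply/allP => t /(allP tokC)/and3P[].
    by rewrite Cv => /set1P-> -> ->; rewrite eqxx.
  exists L, (map (fun t => t.1.1) rest); split=> //; last by move=> z; have := cL z; lia.
    by apply/allP => p /(allP aL)/eqP->; rewrite Cv set11.
  by rewrite size_map.
have [v [u [vC uC vu cCv]]] := conn_remove_leaf cC C1.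
pose tv := [seq t <- ts | t.1.2 == v]; pose to := [seq t <- ts | t.1.2 != v].
have ptv : perm_eq (tv ++ to) ts by rewrite perm_filterC.
have [|L1 [r1 [lL1 aL1 pL1 [sr1 sub1] cL1]]] := @pair_at v tv.
  apply/allP => t; rewrite mem_filter => /andP[/eqP tv_ /(allP tokC)/and3P[_]].
  by rewrite tv_ eqxx => -> ->.
(* The survivor crosses the edge from [v] to [u] and has thereby swept [v]. *)
pose moved := [seq (t.1.1, u, v |: t.2) | t <- r1].
have tok2 : all (token (C :\ v)) (moved ++ to).
  rewrite all_cat; apply/andP; split; apply/allP => t.
    case/mapP=> t' /sub1; rewrite mem_filter => /andP[/eqP tv_ /(allP tokC)/and3P[_]].
    rewrite tv_ => ct at' ->; rewrite /token /= uC.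
    rewrite (connU (conn1 u) ct (set11 u) (setU11 _ _)) /=; last by rewrite vu orbT.
    by rewrite inE at' orbT.
  rewrite mem_filter /token => /andP[tv_ /(allP tokC)/and3P[xC -> ->]].
  by rewrite !inE tv_ xC.
have [|L2 [r2 [lL2 aL2 pL2 sr2 cL2]]] := IH (C :\ v) (moved ++ to) _ cCv tok2.
  by move: Cn; rewrite (cardsD1 v) vC.
exists (L1 ++ L2), r2; split=> //.
- by rewrite all_cat lL1.
- rewrite all_cat; apply/andP; split; apply/allP => p.
    by move/(allP aL1)/eqP->.
  by move/(allP aL2); rewrite !inE => /andP[].
- rewrite map_cat flatten_cat -catA.
  have h : perm_eq (flatten (map ends L1) ++ flatten (map ends L2) ++ r2)
     (flatten (map ends L1) ++ map (fun t => t.1.1) (moved ++ to)).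
    by rewrite perm_cat2l.
  apply: (perm_trans h); rewrite map_cat catA.
  have -> : map (fun t => t.1.1) moved = map (fun t => t.1.1) r1.
    by rewrite -map_comp.
  have h2 : perm_eq ((flatten (map ends L1) ++ map (fun t => t.1.1) r1) ++
      map (fun t => t.1.1) to) (map (fun t => t.1.1) tv ++ map (fun t => t.1.1) to).
    by rewrite perm_cat2r.
  by apply: (perm_trans h2); rewrite -map_cat; apply: perm_map.
move=> z; rewrite big_cat /=; have := cL1 z; have := cL2 z.
rewrite -(perm_big _ ptv) !big_cat /= big_map /= !inE => h2 h1.
(* Since [size r1 <= 1], the vertex [v] is swept at most once; [h4] shows that removing [v] from [C]
   releases exactly this charge. *)
have h3 : \sum_(t <- r1) (z \in v |: t.2) <= (z == v) + \sum_(t <- r1) (z \in t.2).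
  case: r1 sr1 {pL1 sub1 cL1 moved tok2 pL2 cL2 h1 h2} => [|t [|]] //= _.
    by rewrite !big_nil addn0.
  by rewrite !big_seq1 !inE; case: (z == v) => //=; rewrite addSn.
have h4 : (z == v) + ((z != v) && (z \in C)) = (z \in C).
  by have [->|] := eqVneq z v; rewrite ?vC.
have arith l1 l2 r tv' to' m vc zc zv : l2 <= vc + (m + to') -> l1 + r <= tv' ->
  m <= zv + r -> zv + vc = zc -> l1 + l2 <= zc + (tv' + to') by clear; lia.
exact: arith h2 h1 h3 h4.
Qed.

(* Each vertex of [X] meets at most one of the sets [N] outside the apexes. *)
Lemma spanning_pairs C (P : {set T}) : conn C -> P \subset C ->
  exists L : seq (T * T * T * {set T}),
    [/\ all linked L, all (fun p => p.1.2 \in C) L,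
        uniq (flatten (map ends L)) /\ {subset flatten (map ends L) <= P},
        #|P| <= (size L).*2.+1 &
        forall X : {set T},
          count (fun p => (p.1.2 \notin X) && [exists x in X, x \in p.2]) L <= #|X|].
Proof.
move=> cC sPC; pose ts := [seq (a, a, set0) | a <- enum P] : seq (T * T * {set T}).
have tokC : all (token C) ts.
  apply/allP => t /mapP[a]; rewrite mem_enum => aP ->.
  by rewrite /token /= setU0 conn1 set11 (subsetP sPC).
have [L [rest [lL aL pL sr cL]]] := pairing cC tokC.
have labE : map (fun t => t.1.1) ts = enum P.
  by rewrite -map_comp (eq_map (g := id)) ?map_id.
exists L; split=> //.
- split; last first.
    by move=> a aL'; rewrite -mem_enum -labE -(perm_mem pL) mem_cat aL'.
  have := perm_uniq pL; rewrite labE enum_uniq cat_uniq => /andP[] //.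
- have := perm_size pL; rewrite labE -cardE => <-.
  rewrite size_cat; have -> : size (flatten (map ends L)) = (size L).*2.
    by elim: (L) => //= p L' ->.
  by rewrite -addn1 leq_add2l.
move=> X; apply: (@leq_trans (\sum_(x in X) \sum_(p <- L) (x \in p.2 :\ p.1.2))).
  rewrite exchange_big /= -sum1_count big_mkcond /=; apply: leq_sum => p _.
  case: ifP => // /andP[vX /exists_inP[x xX xN]].
  rewrite (bigD1 x) //= !inE xN andbT.
  by case: eqP => [xv|_] //; rewrite -xv xX in vX.
rewrite -sum1_card; apply: leq_sum => x _; apply: leq_trans (cL x) _.
rewrite big_map big1 ?addn0 ?leq_b1 // => a _; by rewrite inE.
Qed.

(** * Traces that split few pairs *)

Definition split_by (P : {set T}) : pred (T * T * T * {set T}) :=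
  fun p => (p.1.1.1 \in P) (+) (p.1.1.2 \in P).

Definition toggle (a : T) (P : {set T}) : {set T} := [set x | (x \in P) (+) (x == a)].

Lemma toggleK a : involutive (toggle a).
Proof. by move=> P; apply/setP => x; rewrite !inE addbK. Qed.

Lemma toggle_sub a P Z : a \in Z -> (toggle a P \subset Z) = (P \subset Z).
Proof.
move=> aZ; apply/subsetP/subsetP => sPZ x.
  by move=> xP; have [->//|xa] := eqVneq x a; apply: sPZ; rewrite inE xP (negPf xa).
by have [->//|xa] := eqVneq x a; rewrite inE (negPf xa) addbF; apply: sPZ.
Qed.

(** An exponential moment: a uniform [P] splits each pair with probability 1/2, independently as all
    ends are distinct, so each pair contributes (9 + 1) / 2 = 5. Toggling the first end of a pair
    exchanges split and unsplit for this pair and affects no other. *)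
Lemma sum_unsplit (Z : {set T}) (L : seq (T * T * T * {set T})) :
  uniq (flatten (map ends L)) -> {subset flatten (map ends L) <= Z} ->
  \sum_(P : {set T} | P \subset Z) 9 ^ count (predC (split_by P)) L =
  2 ^ #|Z| * 5 ^ size L.
Proof.
elim: L => [|p L IH].
  move=> _ _; rewrite muln1 -card_powerset -sum1_card.
  by apply: eq_big => P; rewrite ?powersetE.
set a := p.1.1.1; set b := p.1.1.2 => /= /and3P[]; rewrite -/a -/b inE negb_or.
move=> /andP[ab aL] bL uL sZ.
have aZ : a \in Z by apply: sZ; rewrite inE eqxx.
have IH' : \sum_(P : {set T} | P \subset Z) 9 ^ count (predC (split_by P)) L =
    2 ^ #|Z| * 5 ^ size L.
  by apply: IH => // x xL; apply: sZ; rewrite !inE xL !orbT.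
pose W P := 9 ^ count (predC (split_by P)) L; pose ns P := ~~ split_by P p.
have nsT P : ns (toggle a P) = ~~ ns P.
  rewrite /ns /split_by -/a -/b !inE eqxx eq_sym (negPf ab).
  by case: (a \in P); case: (b \in P).
have WT P : W (toggle a P) = W P.
  congr (9 ^ _); apply: eq_in_count => q qL /=; congr (~~ _).
  have notin x : x \in ends q -> (x == a) = false.
    move=> xq; apply/negP => /eqP xa; case/negP: aL; apply/flattenP.
    by exists (ends q); [apply: map_f | rewrite -xa].
  by rewrite /split_by !inE !notin ?addbF // !inE eqxx ?orbT.
have SE : \sum_(P : {set T} | P \subset Z) 9 ^ ns P * W P =
          \sum_(P : {set T} | P \subset Z) 9 ^ (~~ ns P) * W P.
  rewrite (reindex_inj (inv_inj (toggleK a))); apply: eq_big => P.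
    by rewrite toggle_sub.
  by rewrite WT nsT.
have -> : \sum_(P : {set T} | P \subset Z)
      9 ^ (predC (split_by P) p + count (predC (split_by P)) L) =
    \sum_(P : {set T} | P \subset Z) 9 ^ ns P * W P.
  by apply: eq_bigr => P _; rewrite expnD.
(* The sum added to its toggled copy has 9 + 1 times the weight of the other pairs in every term. *)
apply/eqP; rewrite -(eqn_pmul2l (m := 2)) // mul2n -addnn {2}SE -big_split /=.
rewrite (eq_bigr (fun P => 10 * W P)) => [|P _].
  by rewrite -big_distrr /= IH' expnS !mulnA (mulnC _ 5) !mulnA.
by rewrite -mulnDl; case: (ns P).
Qed.

(** Markov's inequality with weight 9 per unsplit pair: fewer than [2 * s] split pairs out of
    [20 * s] leave more than [18 * s] unsplit. The factor [4 * 40 ^ s] is dictated by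
    [forced_neighbours], where half of a family of density 1 in [2 * 40 ^ s] has to survive. *)
Lemma few_unsplitting (Z : {set T}) (L : seq (T * T * T * {set T})) s : 0 < s ->
  uniq (flatten (map ends L)) -> {subset flatten (map ends L) <= Z} ->
  size L = 20 * s ->
  #|[set P : {set T} | (P \subset Z) && (count (split_by P) L < 2 * s)]| * (4 * 40 ^ s)
    <= 2 ^ #|Z|.
Proof.
move=> s0 uL sL szL; set B := [set _ | _].
have h : #|B| * 9 ^ (18 * s) <= 2 ^ #|Z| * 5 ^ (20 * s).
  rewrite -szL -sum_unsplit // -sum_nat_const.
  rewrite [X in _ <= X](bigID (fun P => P \in B)) /=.
  apply: leq_trans (leq_addr _ _).
  rewrite [X in _ <= X](eq_bigl (fun P => P \in B)); last first.
    by move=> P; rewrite !inE andbA andbb.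
  apply: leq_sum => P; rewrite inE => /andP[_ lt].
  rewrite leq_exp2l //; have := count_predC (split_by P) L; rewrite szL.
  by move: lt; lia.
have h2 : 4 * 40 ^ s * 5 ^ (20 * s) <= 9 ^ (18 * s).
  (* The powers [5 ^ 20] and [9 ^ 18] are too large to evaluate in unary: [2 * 5 ^ 5 <= 9 ^ 4] is
     raised to the fourth power instead, the remaining factor of [9 ^ 18] being 81. *)
  have scale a b : 2 * a <= b -> 160 * a ^ 4 <= b ^ 4 * 81.
    move=> ab; apply: (@leq_trans ((2 * a) ^ 4 * 10)).
      by rewrite expnMn mulnAC (_ : 2 ^ 4 * 10 = 160).
    by rewrite leq_mul // leq_exp2r.
  have base : 160 * 5 ^ 20 <= 9 ^ 18.
    rewrite (expnD 9 (4 * 4) 2) (expnM 5 5 4) (expnM 9 4 4).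
    exact: scale.
  rewrite (expnM 5) (expnM 9); move: (5 ^ 20) (9 ^ 18) base => u w base.
  apply: (@leq_trans ((160 * u) ^ s)); last by rewrite leq_exp2r.
  rewrite expnMn leq_mul2r; apply/orP; right.
  rewrite -[160]/(4 * 40) expnMn leq_mul2r; apply/orP; right.
  by rewrite -{1}(expn1 4) leq_exp2l.
rewrite -(@leq_pmul2r (5 ^ (20 * s))) ?expn_gt0 //.
by apply: leq_trans h; rewrite -mulnA leq_mul.
Qed.

(** * Size of a shattered set *)

Section Shattered.
Context (s : nat) (s_gt0 : 0 < s) (Z : {set T}) (F : {set T} -> {set T}).
Hypothesis F_conn : forall P, P \subset Z -> conn (F P).
Hypothesis F_nbhd : forall P, P \subset Z -> #|nbhd (F P)| <= s.
Hypothesis F_trace : forall P, P \subset Z -> F P :&: Z = P.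

Let mem_F P x : P \subset Z -> x \in Z -> (x \in F P) = (x \in P).
Proof. by move=> PZ xZ; rewrite -[in RHS](F_trace PZ) inE xZ andbT. Qed.

(** The connected set of a split pair joins a point of [F P] to a point outside, so it meets the
    boundary of [F P]. By the load bound at most [s] pairs are met there off their apex only; all
    other split pairs have the apex itself in the boundary. *)
Lemma apexes_hit P L : P \subset Z -> all linked L ->
  {subset flatten (map ends L) <= Z} ->
  (forall X : {set T},
     count (fun p => (p.1.2 \notin X) && [exists x in X, x \in p.2]) L <= #|X|) ->
  count (split_by P) L <= s + count (fun p => p.1.2 \in nbhd (F P)) L.
Proof.
move=> PZ lL sL cL; set X := nbhd (F P).
apply: (@leq_trans (count (fun p => (p.1.2 \notin X) && [exists x in X, x \in p.2]) L +
                    count (fun p => p.1.2 \in X) L)); last first.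
  by rewrite leq_add2r; apply: leq_trans (cL X) (F_nbhd PZ).
rewrite -count_predUI; apply: leq_trans (leq_addr _ _).
have -> : count (split_by P) L = count (predI (split_by P) (mem L)) L.
  by apply: eq_in_count => p /= ->; rewrite andbT.
apply: sub_count => p /= /andP[sp pL].
have [//|/= vX] := boolP (p.1.2 \in X).
rewrite orbF; have /and3P[cN aN bN] := allP lL _ pL.
have inZ x : x \in ends p -> x \in Z.
  by move=> xp; apply: sL; apply/flattenP; exists (ends p) => //; apply: map_f.
have aZ : p.1.1.1 \in Z by rewrite inZ ?inE ?eqxx.
have bZ : p.1.1.2 \in Z by rewrite inZ ?inE ?eqxx ?orbT.
apply/exists_inP; move: sp; rewrite /split_by -(mem_F PZ aZ) -(mem_F PZ bZ).
case: (boolP (_ \in _)) => aF; case: (boolP (p.1.1.2 \in _)) => bF //= _.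
  by have [x xN xX] := nbhd_hit cN aN bN aF bF; exists x.
by have [x xN xX] := nbhd_hit cN bN aN bF aF; exists x.
Qed.

(** Vertices that lie in the boundary of [F P] for all [P] of a dense family are collected one at a
    time. Points of some [P0] in the family are linked in pairs inside [F P0]. At least half of the
    family splits [2 * s] of [20 * s] pairs, so for each such trace at least [s] pairs have their
    apex in the boundary, and by averaging one apex serves a twentieth of these traces; the loss is
    a factor 40. Traces are kept large so that [P0] has [41 * s] points, enough for [20 * s] pairs;
    hence the constant 82. *)
Lemma forced_neighbours i : i <= s.+1 -> 82 * s <= #|Z| ->
  exists (H : {set T}) (D : {set {set T}}),
    [/\ #|H| = i, 2 ^ #|Z| <= #|D| * (2 * 40 ^ i) &
       forall P, P \in D -> [/\ P \subset Z, #|Z| <= #|P|.*2 & H \subset nbhd (F P)]].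
Proof.
move=> + Zbig; elim: i => [_|i IH lei].
  exists set0, [set P : {set T} | (P \subset Z) && (#|Z| <= #|P|.*2)].
  split=> [||P]; rewrite ?cards0 //; last by rewrite inE => /andP[-> ->]; rewrite sub0set.
  set D := [set _ | _].
  have -> : 2 ^ #|Z| = #|powerset Z| by rewrite card_powerset.
  (* Either [P] or its complement in [Z] has at least half of the points, so at least half of all
     traces qualify. *)
  apply: (@leq_trans #|D :|: [set Z :\: P | P in D]|).
    apply/subset_leq_card/subsetP => P; rewrite powersetE => PZ.
    have [big|small] := leqP #|Z| #|P|.*2; first by rewrite !inE PZ big.
    apply/setUP; right; apply/imsetP; exists (Z :\: P).
      rewrite inE subsetDl cardsD (setIidPr PZ).
      by have := subset_leq_card PZ; move: small; lia.
    by rewrite setDDr setDv set0U (setIidPr PZ).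
  apply: leq_trans (leq_card_setU _ _) _.
  by rewrite muln1 muln2 -addnn leq_add2l leq_imset_card.
have [H [D [Hi Dbig DP]]] := IH (ltnW lei).
have /card_gt0P[P0 P0D] : 0 < #|D|.
  by case: posnP Dbig => // ->; rewrite mul0n leqNgt expn_gt0.
have [P0Z P0big HP0] := DP _ P0D.
have sPF : P0 \subset F P0 by rewrite -{1}(F_trace P0Z) subsetIl.
have [L [lL aL [uL subL] szL cL]] := spanning_pairs (F_conn P0Z) sPF.
set L1 := take (20 * s) L.
have szL1 : size L1 = 20 * s.
  rewrite size_takel //.
  have ar z q l : 0 < s -> 82 * s <= z -> z <= q.*2 -> q <= l.*2.+1 -> 20 * s <= l.
    by clear; lia.
  exact: ar s_gt0 Zbig P0big szL.
have catL : L1 ++ drop (20 * s) L = L by rewrite cat_take_drop.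
have uL1 : uniq (flatten (map ends L1)).
  by move: uL; rewrite -catL map_cat flatten_cat cat_uniq => /andP[].
have subL1 : {subset flatten (map ends L1) <= Z}.
  move=> x xL; apply: (subsetP P0Z); apply: subL.
  by rewrite -catL map_cat flatten_cat mem_cat xL.
have lL1 : all linked L1 by move: lL; rewrite -catL all_cat => /andP[].
have aL1 : all (fun p => p.1.2 \in F P0) L1 by move: aL; rewrite -catL all_cat => /andP[].
have cL1 X : count (fun p => (p.1.2 \notin X) && [exists x in X, x \in p.2]) L1 <= #|X|.
  by apply: leq_trans (cL X); rewrite -catL count_cat leq_addr.
have := few_unsplitting s_gt0 uL1 subL1 szL1; set B := [set _ | _] => Bsmall.
pose D' := D :\: B.
have D'big : #|D| <= #|D'| * 2.
  (* As [i <= s], the density of [D] is at least twice the bound on the fraction of traces that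
     split too few pairs. *)
  have : #|B| * 2 <= #|D|.
    rewrite -(@leq_pmul2r (2 * 40 ^ i)) ?muln_gt0 ?expn_gt0 //.
    apply: leq_trans Dbig; apply: leq_trans Bsmall.
    rewrite -mulnA leq_mul // mulnA leq_mul // leq_exp2l //.
  have ar d b c d' : c + d' = d -> c <= b -> b * 2 <= d -> d <= d' * 2 by clear; lia.
  exact: ar (cardsID B D) (subset_leq_card (subsetIr D B)).
have hitD' P : P \in D' -> s <= count (fun p => p.1.2 \in nbhd (F P)) L1.
  rewrite inE => /andP[PB /DP[PZ _ _]]; move: PB; rewrite inE PZ /= -leqNgt => spl.
  rewrite -(leq_add2l s) addnn -mul2n; apply: leq_trans spl _.
  exact: apexes_hit PZ lL1 subL1 cL1.
pose Dp (p : T * T * T * {set T}) := [set P in D' | p.1.2 \in nbhd (F P)].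
have [p pL1 Dpbig] : exists2 p, p \in L1 & #|D'| <= #|Dp p| * 20.
  apply/hasP; apply/negPn/negP; rewrite -all_predC => /allP none.
  have : #|D'| * s <= \sum_(p <- L1) #|Dp p|.
    rewrite -sum_nat_const.
    have -> : \sum_(p <- L1) #|Dp p| =
        \sum_(P in D') \sum_(p <- L1) (p.1.2 \in nbhd (F P)).
      rewrite exchange_big /=; apply: eq_bigr => p _.
      rewrite -sum1_card [RHS]big_mkcond /= big_mkcond /=.
      by apply: eq_bigr => P _; rewrite inE; case: (P \in D'); case: (_ \in nbhd _).
    apply: leq_sum => P PD'; apply: leq_trans (hitD' _ PD') _.
    by rewrite -sum1_count big_mkcond leq_sum // => p _; case: ifP.
  apply/negP; rewrite -ltnNge -(@ltn_pmul2r 20) // big_distrl /=.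
  apply: (@leq_trans (\sum_(p <- L1) #|D'|)); last first.
    by rewrite big_const_seq count_predT iter_addn_0 szL1 (mulnC 20) mulnA.
  case EL: L1 szL1 => [|p0 L2] szL2; first by case: (s) szL2 s_gt0.
  have none' q : q \in L1 -> #|Dp q| * 20 < #|D'|.
    by move/none; rewrite /= -ltnNge.
  rewrite big_cons [X in _ < X]big_cons -addSn; apply: leq_add.
    by apply: none'; rewrite EL inE eqxx.
  rewrite big_seq [X in _ <= X]big_seq; apply: leq_sum => q qL.
  by apply/ltnW/none'; rewrite EL inE qL orbT.
exists (p.1.2 |: H), (Dp p); split.
(* The new apex lies in [F P0], whereas [H] is in the boundary of [F P0] and hence outside it. *)
- rewrite cardsU1 Hi; case: (boolP (_ \in H)) => // /(subsetP HP0).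
  by rewrite inE (allP aL1 _ pL1).
- have dp : #|D| <= #|Dp p| * 40.
    by apply: leq_trans D'big _; rewrite -[40]/(20 * 2) mulnA leq_mul2r Dpbig orbT.
  by apply: leq_trans Dbig _; rewrite expnS [2 * (40 * _)]mulnCA (mulnA #|Dp p|) leq_mul2r dp orbT.
- move=> P; rewrite !inE => /andP[/andP[_ PD] vP]; have [PZ Pbig HP] := DP P PD.
  by split=> //; rewrite subUset HP sub1set inE vP.
Qed.

(** Collecting [s.+1] forced vertices makes the boundary of some [F P] too large. *)
Lemma shattered_card : #|Z| < 82 * s.
Proof.
rewrite ltnNge; apply/negP => Zbig.
have [H [D [Hs Dbig DP]]] := forced_neighbours (leqnn _) Zbig.
have /card_gt0P[P PD] : 0 < #|D|.
  by case: posnP Dbig => // ->; rewrite mul0n leqNgt expn_gt0.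
have [PZ _ HP] := DP P PD.
by have := leq_trans (subset_leq_card HP) (F_nbhd PZ); rewrite Hs ltnn.
Qed.

End Shattered.
End Graph.

(** * Sampling and VC dimension *)

(** Bernoulli's inequality for (1 - 1/(a+1))^n, which is at least 1/2 here, cleared of denominators
    in [bern]. *)
Lemma leq_expnS_double a n q : 2 * n <= a.+1 -> a.+1 ^ (n * q) <= 2 ^ q * a ^ (n * q).
Proof.
move=> na; rewrite !expnM -expnMn; case: q => // q; rewrite leq_exp2r //.
have bern l : a.+1 ^ l * a.+1 <= a ^ l * a.+1 + l * a.+1 ^ l.
  elim: l => [|l IH]; first by rewrite !expn0 mul0n addn0.
  rewrite !expnS; have := IH; have : a ^ l <= a.+1 ^ l by case: (l) => // l'; rewrite leq_exp2r.
  move: (a ^ l) (a.+1 ^ l) => x y; clear; nia.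
have := bern n; move: (a ^ n) (a.+1 ^ n) => x y; move: na; clear; nia.
Qed.

Lemma leq_expnS_mul a n q m : 2 * n <= a.+1 -> m <= n * q -> a.+1 ^ m <= 2 ^ q * a ^ m.
Proof.
move=> na mq.
have := leq_expnS_double q na; rewrite -(subnK mq); set l := _ - m => h.
rewrite -(@leq_pmul2l (a.+1 ^ l)) ?expn_gt0 // mulnCA -expnD.
apply: (leq_trans h); rewrite expnD leq_mul2l leq_mul2r.
by case: (l) => [|l']; rewrite ?leqnn ?leq_exp2r ?leqnSn ?orbT.
Qed.

Section Sampling.
Context (T : finType).
Implicit Types (F : {set {set T}}) (A D P V Y Z : {set T}).

Definition shatters F Y :=
  [forall P : {set T}, (P \subset Y) ==> [exists A in F, A :&: Y == P]].

Lemma shattersP F Y :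
  reflect (forall P, P \subset Y -> exists2 A, A \in F & A :&: Y = P) (shatters F Y).
Proof.
apply: (iffP forallP) => [sh P PY|sh P].
  by have /implyP/(_ PY)/exists_inP[A AF /eqP AY] := sh P; exists A.
apply/implyP => /sh[A AF AY]; apply/exists_inP; exists A => //; exact/eqP.
Qed.

Lemma shatters_sub F F' Y : F \subset F' -> shatters F Y -> shatters F' Y.
Proof.
move=> sFF' /shattersP sh; apply/shattersP => P /sh[A AF AY].
by exists A => //; apply: (subsetP sFF').
Qed.

(** Pajor's form of the Sauer-Shelah lemma. After splitting [F] by membership of [x], a set
    shattered by both halves counts twice, which is legitimate because [F] also shatters it with [x]
    added. *)
Lemma leq_card_shatters F : #|F| <= #|[set Y | shatters F Y]|.
Proof.
have [n] := ubnP #|F|; elim: n F => // n IH F Fn.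
have [->|/set0Pn[A0 A0F]] := eqVneq F set0; first by rewrite cards0.
have [F1|/card_gt1P[A1 [A2 [A1F A2F A12]]]] := leqP #|F| 1.
  apply: leq_trans F1 _; apply/card_gt0P; exists set0; rewrite inE.
  by apply/shattersP => P; rewrite subset0 => /eqP->; exists A0; rewrite ?setI0.
(* An [x] that distinguishes two members makes both halves nonempty, so that each is smaller than
   [F]. *)
have [x xA] : exists x, (x \in A1) != (x \in A2).
  by apply/existsP; apply: contraR A12 => /existsPn h; apply/eqP/setP => x; apply/eqP/negPn.
pose Fo := [set A in F | x \notin A]; pose Fi := [set A in F | x \in A].
have FE : #|Fo| + #|Fi| = #|F|.
  rewrite addnC -(cardsID [set A : {set T} | x \in A] F); congr (_ + _).
    by congr #|pred_of_set _|; apply/setP => A; rewrite !inE.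
  by congr #|pred_of_set _|; apply/setP => A; rewrite !inE andbC.
have [Fo0 Fi0] : 0 < #|Fo| /\ 0 < #|Fi|.
  case: (boolP (x \in A1)) (boolP (x \in A2)) xA => xA1 [] xA2 // _.
    by split; apply/card_gt0P; [exists A2 | exists A1]; rewrite inE ?A1F ?A2F.
  by split; apply/card_gt0P; [exists A1 | exists A2]; rewrite inE ?A1F ?A2F.
have IHo : #|Fo| <= #|[set Y | shatters Fo Y]|.
  by apply: IH; rewrite -ltnS; apply: leq_trans Fn; rewrite ltnS -FE -[X in X < _]addn0 ltn_add2l.
have IHi : #|Fi| <= #|[set Y | shatters Fi Y]|.
  by apply: IH; rewrite -ltnS; apply: leq_trans Fn; rewrite ltnS -FE -[X in X < _]add0n ltn_add2r.
set So := [set Y | shatters Fo Y] in IHo; set Si := [set Y | shatters Fi Y] in IHi.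
have xSo Y : Y \in So -> x \notin Y.
  rewrite inE => /shattersP/(_ Y (subxx _))[A]; rewrite inE => /andP[_ xA'] <-.
  by rewrite inE (negPf xA').
have xSi Y : Y \in Si -> x \notin Y.
  rewrite inE => /shattersP/(_ (Y :\ x) (subD1set _ _))[A]; rewrite inE => /andP[_ xA'].
  by move/setP/(_ x); rewrite !inE xA' eqxx /= => ->.
have disj : [disjoint So :|: Si & [set x |: Y | Y in So :&: Si]].
  rewrite disjoints_subset; apply/subsetP => Y YS; rewrite inE; apply/imsetP => -[Y' _ YE].
  have : x \notin Y by case/setUP: YS => [/xSo|/xSi].
  by rewrite YE setU11.
have sub : (So :|: Si) :|: [set x |: Y | Y in So :&: Si] \subset [set Y | shatters F Y].
  apply/subsetP => Y; rewrite !inE => /orP[/orP[]|/imsetP[Y']].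
  - by apply: shatters_sub; apply/subsetP => A; rewrite inE => /andP[].
  - by apply: shatters_sub; apply/subsetP => A; rewrite inE => /andP[].
  move=> Y'S ->; have xY' : x \notin Y' by case/setIP: Y'S => /xSo.
  move: Y'S; rewrite !inE => /andP[/shattersP sho /shattersP shi].
  apply/shattersP => P PY.
  have PY' : P :\ x \subset Y' by rewrite subDset.
  have [xP|xP] := boolP (x \in P).
    have [A] := shi _ PY'; rewrite inE => /andP[AF xA'] AE; exists A => //.
    rewrite setIUr AE (setIidPr _) ?sub1set //; exact: setD1K.
  have [A] := sho _ PY'; rewrite inE => /andP[AF xA'] AE; exists A => //.
  rewrite setIUr AE; move: xA'; rewrite -disjoints1 => /disjoint_setI0.
  rewrite setIC => ->; rewrite set0U; apply/setP => y; rewrite !inE.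
  by case: eqP => // ->; rewrite (negPf xP).
apply: leq_trans (subset_leq_card sub).
rewrite cardsU (disjoint_setI0 disj) cards0 subn0 card_in_imset.
  by rewrite -FE cardsUI leq_add.
move=> Y1 Y2 /setIP[/xSo x1 _] /setIP[/xSo x2 _] /(congr1 (fun Y => Y :\ x)).
by rewrite !setU1K.
Qed.

(** The binomial theorem, read off the expansion of a product over all of [T] whose factors outside
    [Z] are 0 + 1. *)
Lemma sum_expn_powerset (a b M : nat) Z : #|Z| <= M ->
  \sum_(Y : {set T} | Y \subset Z) a ^ #|Y| * b ^ (#|Z| - #|Y|) = (a + b) ^ #|Z|.
Proof.
move=> _.
have := @bigA_distr nat 0 1 muln addn T
  (fun i => if i \in Z then a else 0) (fun i => if i \in Z then b else 1).
rewrite (eq_bigr (fun i => if i \in Z then a + b else 1)) => [|i _]; last by case: ifP.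
rewrite -big_mkcond prod_nat_const => ->; rewrite big_mkcond /=; apply: eq_big => // Y _; apply: esym.
have [YZ|/subsetPn[i iY iZ]] := boolP (Y \subset Z).
  rewrite (bigID (mem Z)) /= [X in _ * X]big1 ?muln1; last first.
    move=> i iZ; rewrite (negPf iZ); case: ifP => // iY.
    by rewrite (subsetP YZ _ iY) in iZ.
  rewrite (eq_bigr (fun i => if i \in Y then a else b)) => [|i ->]; last by case: ifP.
  rewrite (bigID (mem Y)) /=; congr (_ * _).
    rewrite (eq_bigr (fun=> a)) => [|i /andP[_ ->]] //.
    rewrite (eq_bigl (mem Y)) ?prod_nat_const // => i /=.
    by case: (boolP (i \in Y)) => [/(subsetP YZ)->|]; rewrite ?andbF.
  rewrite (eq_bigr (fun=> b)) => [|i /andP[_ /negPf->]] //.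
  rewrite (eq_bigl (mem (Z :\: Y))) => [|i]; last by rewrite /= inE andbC.
  by rewrite prod_nat_const cardsD (setIidPr YZ).
by rewrite (bigD1 i) //= iY (negPf iZ).
Qed.

(* [(1 + 1/a) ^ M * a ^ v], cleared of denominators. *)
Lemma card_traces a F v M Z : 0 < a ->
  (forall Y, shatters F Y -> #|Y| <= v) -> #|Z| <= M ->
  #|[set A :&: Z | A in F]| * a ^ M <= a ^ v * a.+1 ^ M.
Proof.
move=> a0 Fv ZM; set F' := imset _ _.
have sh Y : shatters F' Y -> (Y \subset Z) && (#|Y| <= v).
  move/shattersP => sh; have [A AF AY] := sh Y (subxx _).
  have YZ : Y \subset Z.
    by case/imsetP: AF AY => A' _ -> <-; apply: subset_trans (subsetIl _ _) (subsetIr _ _).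
  rewrite YZ Fv //; apply/shattersP => P /sh[A' /imsetP[A2 A2F ->] <-].
  by exists A2 => //; rewrite -setIA (setIidPr YZ).
have h : #|F'| * a ^ #|Z| <= a ^ v * a.+1 ^ #|Z|.
  apply: (@leq_trans (#|[set Y | shatters F' Y]| * a ^ #|Z|)).
    by rewrite leq_mul2r leq_card_shatters orbT.
  (* A shattered [Y] has at most [v] elements, so [a ^ #|Z|] is at most [a ^ v] times the weight of
     [Y] in the expansion of (1 + a)^|Z|. *)
  rewrite -add1n -(sum_expn_powerset 1 a ZM) big_distrr /= -sum_nat_const.
  rewrite [X in _ <= X](bigID (fun Y => Y \in [set Y | shatters F' Y])) /=.
  apply: leq_trans (leq_addr _ _); rewrite [X in _ <= X](eq_bigl (fun Y => Y \in [set Y | shatters F' Y])).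
    apply: leq_sum => Y; rewrite inE => /sh/andP[YZ Yv].
    rewrite exp1n mul1n -expnD leq_pexp2l //.
    by have := subset_leq_card YZ; move: Yv; clear; lia.
  by move=> Y; rewrite !inE; case: (boolP (shatters _ _)) => [/sh/andP[->]|]; rewrite ?andbF.
rewrite -(subnK ZM) !expnD ![_ ^ (M - _) * _]mulnC !mulnA.
apply: leq_mul h _; case: (M - _) => // d; by rewrite leq_exp2r.
Qed.

(** * Double sampling and repetitions in a sample *)

Section Ghost.
Context (m : nat) (V : {set T}).
Local Notation sample := {ffun 'I_m -> T}.
Implicit Types (w : sample).

(** Draws are counted with multiplicity, in contrast to the distinct points collected in
    [sample_im]. *)
Definition hits D w := #|[set i | w i \in D]|.

Definition swap (sigma : {set 'I_m}) w w' : sample :=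
  [ffun i => if i \in sigma then w' i else w i].

Lemma swapK sigma w w' : swap sigma (swap sigma w w') (swap sigma w' w) = w.
Proof. by apply/ffunP => i; rewrite !ffunE; case: (i \in sigma). Qed.

Lemma swap_on sigma w w' :
  (swap sigma w w' \in ffun_on V) && (swap sigma w' w \in ffun_on V) =
  (w \in ffun_on V) && (w' \in ffun_on V).
Proof.
have impl w1 w2 : (w1 \in ffun_on V) && (w2 \in ffun_on V) ->
    (swap sigma w1 w2 \in ffun_on V) && (swap sigma w2 w1 \in ffun_on V).
  case/andP=> /ffun_onP h1 /ffun_onP h2.
  by apply/andP; split; apply/ffun_onP => i; rewrite ffunE; case: ifP.
apply/idP/idP => [/impl|]; last exact: impl.
by rewrite !swapK.
Qed.

Lemma sum_swap (B : sample -> sample -> nat) sigma :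
  \sum_(w in ffun_on V) \sum_(w' in ffun_on V) B w w' =
  \sum_(w in ffun_on V) \sum_(w' in ffun_on V) B (swap sigma w w') (swap sigma w' w).
Proof.
rewrite !pair_big /=.
rewrite (reindex_inj (h := fun p => (swap sigma p.1 p.2, swap sigma p.2 p.1))) /=.
  by apply: eq_bigl => -[w w'] /=; rewrite swap_on.
apply: (can_inj (g := fun p => (swap sigma p.1 p.2, swap sigma p.2 p.1))) => -[w w'].
by rewrite /= !swapK.
Qed.

Definition one_sided g D w w' := (g <= hits D w) && [forall i, w' i \notin D].

(** The exchange is forced at every position where [D] occurs, and there are at least [g] of them.
    The weight [f] is 2 at a forced position and 0 for the wrong choice, so both choices together
    weigh at most 2, and expanding the product over positions sums over all [sigma]. *)
Lemma count_one_sided g D w w' :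
  \sum_(sigma : {set 'I_m}) one_sided g D (swap sigma w w') (swap sigma w' w) * 2 ^ g
    <= 2 ^ m.
Proof.
pose f a b := if b \in D then 0 else if a \in D then 2 else 1.
have fle i : f (w' i) (w i) + f (w i) (w' i) <= 2.
  by rewrite /f; case: (w i \in D); case: (w' i \in D).
apply: (@leq_trans (\prod_(i < m) (f (w' i) (w i) + f (w i) (w' i)))); last first.
  rewrite -[X in _ <= 2 ^ X]card_ord -prod_nat_const.
  by apply: leq_prod => i _.
rewrite bigA_distr; apply: leq_sum => sigma _.
rewrite /one_sided; case: andP => [[gh /forallP miss]|_]; last by rewrite mul0n.
rewrite mul1n (eq_bigr (fun i => if swap sigma w w' i \in D then 2 else 1)); last first.
  move=> i _; have := miss i; rewrite !ffunE /f; case: ifP => _ /negPf-> //.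
rewrite -big_mkcond prod_nat_const leq_exp2l //.
by apply: leq_trans gh _; rewrite /hits cardsE.
Qed.

Definition sample_im w : {set T} := [set w i | i : 'I_m].

Lemma hits_trace Z D w : sample_im w \subset Z -> hits (D :&: Z) w = hits D w.
Proof.
move=> /subsetP wZ; congr #|pred_of_set _|; apply/setP => i; rewrite !inE wZ ?andbT //.
exact: imset_f.
Qed.

Lemma one_sided_trace g Z D w w' : sample_im w \subset Z -> sample_im w' \subset Z ->
  one_sided g (D :&: Z) w w' = one_sided g D w w'.
Proof.
move=> wZ /subsetP wZ'; rewrite /one_sided hits_trace //; congr (_ && _).
by apply: eq_forallb => i; rewrite inE wZ' ?andbT // imset_f.
Qed.

(** A ghost sample avoids a set of density at most 1/1000 with probability at least (999/1000)^m, so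
    unlucky samples are charged to pairs in which some [D] is one-sided. Exchanging coordinates
    preserves the distribution of pairs. For a fixed pair only the traces of [F] on its at most 2m
    points matter, and each is one-sided for at most a fraction [2 ^ -g] of the exchanges. *)
Lemma card_unlucky F v g :
  (forall Y, shatters F Y -> #|Y| <= v) -> (forall D, D \in F -> D \subset V) ->
  #|[set w in ffun_on V | [exists D in F, (1000 * #|D| <= #|V|) && (g <= hits D w)]]| *
    (999 ^ m * 2 ^ g * 1000 ^ m.*2) <= #|V| ^ m * (1000 ^ m * 1000 ^ v * 1001 ^ m.*2).
Proof.
move=> Fv FV; set Bad := [set w in _ | _].
pose B w w' : nat := [exists D in F, one_sided g D w w'].
have step1 : #|Bad| * (999 ^ m * #|V| ^ m) <=
    1000 ^ m * \sum_(w in ffun_on V) \sum_(w' in ffun_on V) B w w'.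
  rewrite -sum_nat_const big_distrr /= [X in _ <= X](bigID (mem Bad)) /=.
  apply: leq_trans (leq_addr _ _).
  rewrite [X in _ <= X](eq_bigl (mem Bad)) => [|w]; last first.
    by apply/andb_idl; rewrite inE => /andP[].
  apply: leq_sum => w; rewrite inE => /andP[_ /exists_inP[D DF /andP[Dsmall gD]]].
  apply: (@leq_trans (1000 ^ m * #|ffun_on (mem (V :\: D)) : pred sample|)).
    rewrite card_ffun_on card_ord -!expnMn; case: (m) => // m'; rewrite leq_exp2r //.
    by rewrite cardsD (setIidPr (FV _ DF)); move: Dsmall; clear; lia.
  rewrite leq_mul2l; apply/orP; right; rewrite -sum1_card.
  rewrite [X in _ <= X](bigID (mem (ffun_on (mem (V :\: D))))) /=.
  apply: leq_trans (leq_addr _ _).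
  rewrite [X in _ <= X](eq_bigl (mem (ffun_on (mem (V :\: D))))) => [|w']; last first.
    apply/andb_idl => /ffun_onP h.
    by apply/ffun_onP => i; have := h i; rewrite inE => /andP[].
  apply: leq_sum => w' /ffun_onP h; rewrite lt0b; apply/exists_inP; exists D => //.
  rewrite /one_sided gD; apply/forallP => i.
  by have := h i; rewrite inE => /andP[].
have step2 : (\sum_(w in ffun_on V) \sum_(w' in ffun_on V) B w w') *
    (2 ^ g * 1000 ^ m.*2) <= #|V| ^ m * #|V| ^ m * (1000 ^ v * 1001 ^ m.*2).
  rewrite -(@leq_pmul2l (2 ^ m)) ?expn_gt0 // mulnA.
  have -> : 2 ^ m * (\sum_(w in ffun_on V) \sum_(w' in ffun_on V) B w w') =
     \sum_(w in ffun_on V) \sum_(w' in ffun_on V)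
       \sum_(sigma : {set 'I_m}) B (swap sigma w w') (swap sigma w' w).
    rewrite -{1}(card_ord m) -cardsT -card_powerset powersetT cardsT -sum_nat_const.
    rewrite (eq_bigr (fun sigma => \sum_(w in ffun_on V) \sum_(w' in ffun_on V)
      B (swap sigma w w') (swap sigma w' w))) => [|sigma _]; last exact: sum_swap.
    rewrite exchange_big /=; apply: eq_bigr => w _; by rewrite exchange_big.
  have cardO : #|V| ^ m = #|ffun_on V : pred sample| by rewrite card_ffun_on card_ord.
  have ar a x c : a * (x * x * c) = x * (x * (a * c)) by clear; lia.
  rewrite ar !cardO -sum_nat_const big_distrl /=.
  apply: leq_sum => w _; rewrite -sum_nat_const big_distrl /=; apply: leq_sum => w' _.
  set Z := sample_im w :|: sample_im w'.
  have Zm : #|Z| <= m.*2.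
    apply: leq_trans (leq_card_setU _ _) _; rewrite -addnn.
    by apply: leq_add; apply: leq_trans (leq_imset_card _ _) _; rewrite card_ord.
  have swZ sigma w1 w2 : sample_im w1 \subset Z -> sample_im w2 \subset Z ->
      sample_im (swap sigma w1 w2) \subset Z.
    move=> /subsetP w1Z /subsetP w2Z; apply/subsetP => x /imsetP[i _ ->].
    by rewrite ffunE; case: ifP => _; [apply: w2Z | apply: w1Z]; apply: imset_f.
  have wZ : sample_im w \subset Z by apply: subsetUl.
  have wZ' : sample_im w' \subset Z by apply: subsetUr.
  apply: (@leq_trans (2 ^ m * #|[set A :&: Z | A in F]| * 1000 ^ m.*2)); last first.
    by rewrite -mulnA leq_mul2l card_traces ?orbT.
  rewrite mulnA leq_mul2r; apply/orP; right.
  rewrite [X in _ <= X]mulnC -sum_nat_const big_distrl /=.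
  apply: (@leq_trans (\sum_(sigma : {set 'I_m}) \sum_(D in [set A :&: Z | A in F])
     one_sided g D (swap sigma w w') (swap sigma w' w) * 2 ^ g)).
    apply: leq_sum => sigma _; rewrite /B.
    case: existsP => [[D /andP[DF oD]]|_]; last by rewrite mul0n.
    rewrite (bigD1 (D :&: Z)) /=; last exact: imset_f.
    by rewrite one_sided_trace ?swZ // oD leq_addr.
  rewrite exchange_big /=; apply: leq_sum => D _; exact: count_one_sided.
have [V0|V0] := posnP (#|V| ^ m).
  have -> : Bad = set0.
    apply/setP => w; rewrite !inE; apply/negP => /andP[wV _].
    have : 0 < #|ffun_on V : pred sample| by apply/card_gt0P; exists w.
    by rewrite card_ffun_on card_ord V0.
  by rewrite cards0 mul0n.
rewrite -(@leq_pmul2r (#|V| ^ m)) //.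
have ar b n9 vm g2 t2 n1 S c : b * (n9 * vm) <= n1 * S -> S * (g2 * t2) <= vm * vm * c ->
    b * (n9 * g2 * t2) * vm <= vm * (n1 * c) * vm.
  move=> h1 h2; apply: (@leq_trans (n1 * S * (g2 * t2))).
    rewrite [X in X <= _](_ : _ = b * (n9 * vm) * (g2 * t2)) ?leq_mul2r ?h1 ?orbT //.
    by clear; lia.
  rewrite -mulnA [X in _ <= X](_ : _ = n1 * (vm * vm * c)) ?leq_mul2l ?h2 ?orbT //.
  by clear; lia.
rewrite -(mulnA (1000 ^ m)); exact: ar step1 step2.
Qed.

Definition update w (j : 'I_m) x : sample := [ffun l => if l == j then x else w l].

(** Exchanging an extra value [x] with the coordinate [j] turns [w i == w j] into [w i == x], which
    a single [x] satisfies. *)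
Lemma card_collision (i j : 'I_m) : i != j ->
  #|V| * (\sum_(w in ffun_on V) (w i == w j)) = #|V| ^ m.
Proof.
move=> ij; rewrite -sum_nat_const.
transitivity (\sum_(x in V) \sum_(w in ffun_on V) (w i == x)); last first.
  rewrite exchange_big /= -[X in _ ^ X](card_ord m) -card_ffun_on -sum1_card.
  apply: eq_bigr => w /ffun_onP wV; rewrite (bigD1 (w i)) //= eqxx big1 // => x /andP[_].
  by rewrite eq_sym => /negPf->.
rewrite !pair_big /=.
rewrite (reindex_inj (h := fun p : T * sample => (p.2 j, update p.2 j p.1))) /=.
  apply: eq_big => -[x w] /=; last by rewrite !ffunE eqxx (negPf ij).
  apply/andP/andP => -[xV /ffun_onP wV]; split.
  - by have := wV j; rewrite ffunE eqxx.
  - apply/ffun_onP => l; have := wV l; rewrite ffunE; case: eqP => // -> _; exact: xV.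
  - exact: wV.
  - by apply/ffun_onP => l; rewrite ffunE; case: ifP.
apply: (can_inj (g := fun p : T * sample => (p.2 j, update p.2 j p.1))) => -[x w] /=.
rewrite ffunE eqxx; congr pair; apply/ffunP => l; rewrite !ffunE.
by case: eqP => // ->.
Qed.

(** First occurrences give distinct points; any other position coincides with an earlier one. *)
Lemma leq_card_repeats w :
  m <= #|sample_im w| + \sum_(i < m) \sum_(j < m | j < i) (w i == w j).
Proof.
pose first := [set i : 'I_m | [forall j : 'I_m, (j < i) ==> (w i != w j)]].
apply: (@leq_trans (#|first| + #|~: first|)); first by rewrite cardsC card_ord.
apply: leq_add.
  rewrite -(card_in_imset (f := w) (D := first)).
    by apply/subset_leq_card/imsetS/subsetP.
  move=> i j; rewrite !inE => /forallP fi /forallP fj wij.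
  apply: val_inj; case: (ltngtP i j) => // lt.
    by have := fj i; rewrite lt wij eqxx.
  by have := fi j; rewrite lt wij eqxx.
rewrite -sum1_card big_mkcond /=; apply: leq_sum => i _; case: ifP => //.
rewrite !inE => /forallPn[j]; rewrite negb_imply negbK => /andP[lt wij].
by rewrite (bigD1 j) //= wij.
Qed.

(** Markov's inequality for the number of coinciding pairs: the mean is m(m-1)/(2|V|) <= m/2,
    whereas fewer than m/4 distinct points force more than 3m/4 coincidences. *)
Lemma card_few_distinct : 0 < m <= #|V| ->
  3 * #|[set w in ffun_on V | 4 * #|sample_im w| < m]| <= 2 * #|V| ^ m.
Proof.
case/andP=> m0 mV; set Bad := [set w in _ | _].
pose col w := \sum_(i < m) \sum_(j < m | j < i) (w i == w j).
have total : #|V| * (\sum_(w in ffun_on V) col w) * 2 = m * m.-1 * #|V| ^ m.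
  rewrite /col exchange_big /=.
  under eq_bigr => i _ do rewrite exchange_big /=.
  rewrite big_distrr /= (eq_bigr (fun i : 'I_m => i * #|V| ^ m)).
    rewrite -big_distrl /= -mulnA (mulnC _ 2) mulnA; congr (_ * _).
    have := bin2_sum m; rewrite big_mkord => ->.
    rewrite ?[_ * 2]mulnC -mul_bin_diag bin1 //.
  move=> i _; rewrite big_distrr /= (eq_bigr (fun=> #|V| ^ m)).
    by rewrite (big_ord_narrow (ltnW (ltn_ord i))) sum_nat_const card_ord.
  move=> j ji; apply: card_collision.
  by apply: contraTneq ji => ->; rewrite ltnn.
have markov : #|Bad| * (3 * m) <= 4 * \sum_(w in ffun_on V) col w.
  rewrite -sum_nat_const big_distrr /= [X in _ <= X](bigID (mem Bad)) /=.
  apply: leq_trans (leq_addr _ _).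
  rewrite [X in _ <= X](eq_bigl (mem Bad)) => [|w]; last first.
    by apply/andb_idl; rewrite inE => /andP[].
  apply: leq_sum => w; rewrite inE => /andP[_ few].
  have := leq_card_repeats w; rewrite -/(col w); move: few; move: #|_| (col w) => a b.
  by clear; lia.
have [N0|N0] := posnP #|V|; first by rewrite N0 leqn0 in mV; rewrite (eqP mV) in m0.
rewrite -(@leq_pmul2l (m * #|V|)) ?muln_gt0 ?m0 //.
move: #|Bad| (\sum_(w in ffun_on V) col w) (#|V| ^ m) markov total => b S X.
move: (#|V|) mV N0 => N mV N0 mk tot.
have : b * (3 * m) * N <= 2 * (m * m.-1 * X).
  by rewrite -tot; apply: leq_trans (leq_mul mk (leqnn N)) _; clear; lia.
have : m * m.-1 * X <= m * N * X.
  by rewrite leq_mul // leq_mul // (leq_trans (leq_pred m)).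
move: (m * m.-1 * X); clear; nia.
Qed.

(** Union bound with 2/3 + 1/6. If there are at least m/4 distinct points and a third of them lie in
    [D], then [D] is hit at least [m %/ 12] times. *)
Lemma card_bad_sample F v :
  (forall Y, shatters F Y -> #|Y| <= v) -> (forall D, D \in F -> D \subset V) ->
  1000 <= m <= #|V| -> 2800 * v <= m ->
  6 * #|[set w in ffun_on V | (4 * #|sample_im w| < m) ||
                              [exists D in F, (1000 * #|D| <= #|V|) &&
                                 (#|sample_im w| <= 3 * #|D :&: sample_im w|)]]|
    <= 5 * #|V| ^ m.
Proof.
move=> Fv FV /andP[m1000 mV] vm; set Bad := [set w in _ | _].
have m0 : 0 < m by apply: leq_trans m1000.
set few := [set w in ffun_on V | 4 * #|sample_im w| < m].
pose g := m %/ 12; have := card_unlucky g Fv FV; set unl := [set w in _ | _] => unlP.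
have sub : Bad \subset few :|: unl.
  apply/subsetP => w; rewrite !inE => /andP[-> /=]; case: ltnP => //= big /exists_inP[D DF /andP[Ds D3]].
  apply/exists_inP; exists D => //.
  rewrite Ds /=; have : #|D :&: sample_im w| <= hits D w.
    apply: leq_trans (leq_imset_card w [set i | w i \in D]); apply: subset_leq_card.
    apply/subsetP => x /setIP[xD /imsetP[i _ xi]]; apply/imsetP; exists i => //.
    by rewrite inE -xi.
  rewrite /g; move: big D3; move: #|_| #|_| (hits _ _) => a b c; clear; lia.
have fewP : 3 * #|few| <= 2 * #|V| ^ m by apply: card_few_distinct; rewrite m0.
have {}unlP : 6 * #|unl| <= #|V| ^ m.
  (* Powers of 1000/999 and 1001/1000 cost one factor 2 per 500 exponents, each factor 1000 costs 10
     bits and the factor 6 costs 3; by [2800 * v <= m] the total is at most [m %/ 12]. *)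
  pose q1 := (m %/ 500).+1; pose q2 := (m %/ 250).+1.
  have h1 : 1000 ^ m <= 2 ^ q1 * 999 ^ m.
    by apply: (@leq_expnS_mul 999 500) => //; rewrite /q1; clear; lia.
  have h2 : 1001 ^ m.*2 <= 2 ^ q2 * 1000 ^ m.*2.
    by apply: (@leq_expnS_mul 1000 500) => //; rewrite /q2; clear; lia.
  have h3 : 1000 ^ v <= 2 ^ (10 * v).
    by rewrite expnM; case: (v) => // v'; rewrite leq_exp2r.
  have h4 : 6 * 2 ^ (q1 + q2 + 10 * v) <= 2 ^ g.
    apply: (@leq_trans (2 ^ 3 * 2 ^ (q1 + q2 + 10 * v))); first by rewrite leq_mul2r orbT.
    rewrite -expnD leq_exp2l // /g /q1 /q2; move: m1000 vm; clear; lia.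
  have n0 : 0 < 999 ^ m * 1000 ^ m.*2 by rewrite muln_gt0 !expn_gt0.
  have g0 : 0 < 2 ^ g by rewrite expn_gt0.
  rewrite -(@leq_pmul2r (2 ^ g * (999 ^ m * 1000 ^ m.*2))); last by rewrite muln_gt0 g0.
  move: (10 * v) h3 h4 => w h3 h4; move: unlP h1 h2 h3 h4; rewrite !expnD.
  move: (2 ^ g) (2 ^ q1) (2 ^ q2) (2 ^ w).
  move: (999 ^ m) (1000 ^ m.*2) (1001 ^ m.*2) (1000 ^ v) (1000 ^ m) #|unl| (#|V| ^ m).
  clear=> n9 n2 n1 nv n0 u N G a b c h h1 h2 h3 h4.
  have e1 : 6 * u * (G * (n9 * n2)) <= 6 * (N * (n0 * nv * n1)).
    by rewrite -mulnA leq_mul2l /=; apply: leq_trans h; clear; nia.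
  apply: leq_trans e1 _.
  have e2 : n0 * nv * n1 <= (a * n9) * c * (b * n2) by apply: leq_mul h2; apply: leq_mul.
  apply: (@leq_trans (6 * (N * (a * n9 * c * (b * n2))))); first by rewrite !leq_mul2l e2 !orbT.
  have -> : 6 * (N * (a * n9 * c * (b * n2))) = N * ((6 * (a * b * c)) * (n9 * n2)).
    by clear; lia.
  by rewrite leq_mul2l leq_mul2r h4 !orbT.
have := leq_trans (subset_leq_card sub) (leq_card_setU _ _).
move: #|Bad| #|few| #|unl| (_ ^ m) fewP unlP => a b c N; clear; lia.
Qed.

End Ghost.
End Sampling.

(** * Separators and tree decompositions *)

(** Only edges at vertices already reachable from [x] have to be preserved, because a path could
    leave the [r']-reachable set only along such an edge. *)
Lemma sub_connect_from (T : finType) (r r' : rel T) x y :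
  (forall u v, connect r x u -> r u v -> r' u v) -> connect r x y -> connect r' x y.
Proof.
move=> rr' xy; have [//|nxy] := boolP (connect r' x y).
have x0 : x \in [set z | connect r' x z] by rewrite inE connect0.
have y0 : y \notin [set z | connect r' x z] by rewrite inE.
have [u [v []]] := connect_exit xy x0 y0.
rewrite !inE => xu xv uv xru; case/negP: xv; apply: connect_trans xu _.
exact/connect1/rr'.
Qed.

Lemma small_bags (T : finType) (e : rel T) k : (treewidth e <= k) ->
  exists D : tree_decomposition e, forall x : td_node D, (#|td_bag (t:=D) x| <= k.+1).
Proof.
rewrite /treewidth; case: ex_minnP => w /asboolP[D wD] _ wk; exists D => x.
apply: leq_trans (leq_bigmax (F := fun x : td_node D => #|td_bag (t:=D) x|) x) _.
have : (td_width D <= k) by rewrite wD.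
by rewrite /td_width; case: (\max_(_ : _) _).
Qed.

(** * Edge deletion and centroids in trees *)

Section Tree.
Context (N : finType) (t : rel N).
Hypothesis t_tree : is_tree t.

Let t_sym : symmetric t. Proof. by case: t_tree. Qed.
Let t_irr : irreflexive t. Proof. by case: t_tree. Qed.
Let t_conn : connected_graph t. Proof. by case: t_tree. Qed.

Definition del_edge a b : rel N :=
  [rel x y | t x y && ~~ ((x == a) && (y == b) || (x == b) && (y == a))].

Lemma del_edgeC a b : del_edge a b =2 del_edge b a.
Proof. by move=> x y; rewrite /del_edge /= orbC. Qed.

Lemma connect_del_sym a b : connect_sym (del_edge a b).
Proof.
apply: sym_connect_sym => x y; rewrite /del_edge /= t_sym; congr (_ && ~~ _).
by rewrite orbC [(y == b) && _]andbC [(y == a) && _]andbC.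
Qed.

Lemma edge_bridge a b : t a b -> ~~ connect (del_edge a b) b a.
Proof.
move=> ab; apply/negP => /connectP[p bp ea].
case: (shortenP bp) ea => p' bp' uniqp' _ ea.
have [_ _ _ _ acyclic] := t_tree; apply: (acyclic (b :: p')).
  case: p' ea bp' {uniqp'} => [|x [|y p']] //=.
    by move=> ab'; rewrite ab' t_irr in ab.
  by move=> <-; rewrite /del_edge /= !eqxx !orbT !andbF.
apply/andP; split=> //=; rewrite rcons_path -ea ab andbT.
by apply: sub_path bp' => x y /andP[].
Qed.

(** The edge is oriented: this is the part of the tree that keeps the head [b] once the edge is
    deleted. *)
Definition side a b : {set N} := [set y | connect (del_edge a b) b y].

Lemma side_head a b : b \in side a b.
Proof. by rewrite inE connect0. Qed.

Lemma sideN a b : t a b -> a \notin side a b.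
Proof. by move=> ab; rewrite inE edge_bridge. Qed.

Lemma side_disjoint a b y : t a b -> y \in side a b -> y \in side b a -> False.
Proof.
move=> ab; rewrite !inE => yb ya; case/negP: (edge_bridge ab).
apply: connect_trans yb _; rewrite connect_del_sym.
by rewrite (eq_connect (del_edgeC a b)).
Qed.

(** A walk from [c] that avoids the bridge between [b] and [c] never visits [b], so it cannot use
    the edge between [a] and [b]. *)
Lemma side_sub a b c : t a b -> t b c -> c != a -> side b c \subset side a b.
Proof.
move=> ab bc ca; apply/subsetP => y; rewrite !inE => cy.
have ba : b != a by apply: contraTneq ab => ->; rewrite t_irr.
apply: (@connect_trans _ _ c).
  by apply: connect1; rewrite /del_edge /= bc (negPf ba) (negPf ca) andbF.
apply: sub_connect_from cy => u v cu uv; rewrite /del_edge /=.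
case/andP: (uv) => -> _ /=.
have nb z : connect (del_edge b c) c z -> z != b.
  by move=> cz; apply: contraNneq (edge_bridge bc) => zb; rewrite zb in cz.
have vb : v != b by apply: nb; apply: connect_trans cu (connect1 uv).
by rewrite (negPf (nb _ cu)) (negPf vb) andbF.
Qed.

Lemma side_inj b c c' y : t b c -> t b c' -> y \in side b c -> y \in side b c' -> c = c'.
Proof.
move=> bc bc' yc yc'; apply/eqP; apply/negPn/negP => cc'.
have cb' : t c' b by rewrite t_sym.
apply: (side_disjoint cb' _ yc'); exact: (subsetP (side_sub cb' bc cc')).
Qed.

Lemma side_cover b y : y != b -> exists2 c, t b c & y \in side b c.
Proof.
move=> yb; have /connectP[p] := t_conn b y; case/shortenP=> -[|c p'] /=.
  by move=> _ _ _ yb'; rewrite yb' eqxx in yb.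
move=> /andP[bc cp] /andP[bp up] _ ey; exists c => //; rewrite inE.
apply/connectP; exists p' => //.
have avoid x q : path t x q -> b \notin x :: q -> path (del_edge b c) x q.
  elim: q x => //= z q IH x /andP[xz zq].
  rewrite !inE !negb_or => /and3P[bx bz bq]; rewrite IH ?inE ?negb_or ?bz //.
  by rewrite /del_edge /= xz ![_ == b]eq_sym (negPf bx) (negPf bz) andbF.
exact: avoid.
Qed.

(* Take for [b] the head of an edge whose heavy side is as small as possible. *)
Lemma centroid (V : finType) (occ : V -> {set N}) (W : {set V}) :
  (forall v, occ v != set0) ->
  exists b, forall c, t b c -> 2 * #|[set v in W | occ v \subset side b c]| <= #|W|.
Proof.
move=> occ0; pose wgt a b := #|[set v in W | occ v \subset side a b]|.
pose heavy (p : N * N) := t p.1 p.2 && (#|W| < 2 * wgt p.1 p.2).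
have [p0 hp0|none] := pickP heavy; last first.
  have [/card_gt0P[b _] _ _ _ _] := t_tree; exists b => c bc.
  by have := none (b, c); rewrite /heavy /= bc /= ltnNge => /negPn.
case: (@arg_minnP _ p0 heavy (fun p => #|side p.1 p.2|)) => // -[a b] /andP[/= ab hab] minab.
exists b => c bc; rewrite leqNgt; apply/negP => hbc.
(* For [c = a] the two sides of one edge would both be heavy although they contain disjoint
   families; otherwise the side of [c] is a strictly smaller heavy side. *)
have [ca|ca] := eqVneq c a.
  subst c.
  have : wgt a b + wgt b a <= #|W|.
    rewrite -cardsUI [X in _ + X](_ : _ = 0) ?addn0.
      by apply/subset_leq_card/subsetP => v; rewrite !inE => /orP[] /andP[].
    apply/eqP; rewrite cards_eq0; apply/eqP/setP => v; rewrite !inE; apply/negP.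
    case/andP=> /andP[_ /subsetP s1] /andP[_ /subsetP s2].
    have /set0Pn[y yv] := occ0 v.
    exact: (side_disjoint ab (s1 _ yv) (s2 _ yv)).
  move: hab hbc; rewrite -/(wgt b a); move: (wgt a b) (wgt b a) #|W|; clear; lia.
have := minab (b, c); rewrite /heavy /= bc hbc => /(_ isT).
rewrite leqNgt proper_card //; apply/properP; split; first exact: side_sub.
by exists b; rewrite ?side_head // sideN.
Qed.

End Tree.

Section Separators.
Context (T : finType) (e : rel T) (e_sym : symmetric e).
Implicit Types (A B C D P Q S V W X Y Z : {set T}) (u v x y : T).

(** A vertex of [S] reaches just itself, as no edge of the restricted relation starts there; so [x]
    always belongs to [reach S x]. *)
Definition reach S x : {set T} := [set y | connect (within e (~: S)) x y].

Lemma reachC S x y : (y \in reach S x) = (x \in reach S y).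
Proof. by rewrite !inE connect_within_sym. Qed.

Lemma reach_refl S x : x \in reach S x.
Proof. by rewrite inE connect0. Qed.

Lemma reach_trans S y x z : y \in reach S x -> z \in reach S y -> z \in reach S x.
Proof. by rewrite !inE; apply: connect_trans. Qed.

Lemma reach_eq S x y : y \in reach S x -> reach S y = reach S x.
Proof.
move=> xy; apply/setP => z; apply/idP/idP; apply: reach_trans => //.
by rewrite reachC.
Qed.

Lemma reachS S S' x : S \subset S' -> reach S' x \subset reach S x.
Proof.
move=> SS'; apply/subsetP => y; rewrite !inE; apply: sub_connect_within.
by rewrite setCS.
Qed.

Lemma reach_notin S x y : x \notin S -> y \in reach S x -> y \notin S.
Proof.
move=> xS; rewrite inE => xy; apply/negP => yS.
have xS' : x \in ~: S by rewrite inE.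
have yS' : y \notin ~: S by rewrite inE yS.
by have [u [v [_ vS /and3P[_ _]]]] := connect_exit xy xS' yS'; rewrite (negPf vS).
Qed.

Lemma reach_edge S x u v : u \in reach S x -> u \notin S -> e u v -> v \notin S ->
  v \in reach S x.
Proof.
move=> xu uS uv vS; apply: reach_trans xu _; rewrite inE; apply: connect1.
by rewrite /within /= uv !inE uS.
Qed.

Lemma separatesP A B S :
  separates e A B S <->
  (forall x y, x \in A -> y \in B -> x \notin S -> y \notin reach S x).
Proof.
split=> [sep x y xA yB xS|sep x p xA xp lB].
  rewrite inE; apply/negP => /connectP[p xp ey].
  have := sep x p xA; rewrite -ey yB => /(_ _ isT)/hasP[].
    by apply: sub_path xp => u v /and3P[].
  move=> z; rewrite inE => /predU1P[->|zp]; first by rewrite /= (negPf xS).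
  elim: p x {xA xS ey} xp zp => //= z' p IH x /andP[/and3P[_ _ z'S] z'p].
  rewrite inE => /predU1P[->|zp]; last exact: IH z'p zp.
  by move: z'S; rewrite inE => /negPf->.
apply/negPn/negP => noS; have xS : x \notin S by move: noS; rewrite /= negb_or => /andP[].
case/negP: (sep x _ xA lB xS); rewrite inE; apply/connectP; exists p => //.
elim: p x {xA lB xS} xp noS => //= z p IH x /andP[xz zp].
rewrite !negb_or => /and3P[xS zS pS]; rewrite IH ?negb_or ?zS //.
by rewrite /within /= xz !inE xS zS.
Qed.

Lemma separatesS A B A' B' S : A' \subset A -> B' \subset B ->
  separates e A B S -> separates e A' B' S.
Proof.
move=> /subsetP sA /subsetP sB /separatesP sep; apply/separatesP => x y xA yB.
by apply: sep; [apply: sA | apply: sB].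
Qed.

Lemma separatesU A B S Z : separates e A B S -> Z \subset S ->
  separates e (A :|: Z) (B :|: Z) S.
Proof.
move=> /separatesP sep ZS; apply/separatesP => x y xA yB xS.
have xA' : x \in A by case/setUP: xA => // /(subsetP ZS); rewrite (negPf xS).
case/setUP: yB => [yB|yZ]; first exact: sep.
by apply/negP => /(reach_notin xS); rewrite (subsetP ZS _ yZ).
Qed.

Lemma separates_sub_inter A B S : separates e A B S -> A :&: B \subset S.
Proof.
move=> /separatesP sep; apply/subsetP => x /setIP[xA xB].
by apply: contraT => xS; have := sep x x xA xB xS; rewrite reach_refl.
Qed.

(** * Balanced separation of the sample *)

Section Balanced.
Context (k : nat) (W : {set T}).
Hypothesis tw : treewidth e <= k.

(** The bag of a centroid: the tree nodes of a vertex outside this bag form a subtree avoiding [b],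
    hence lie on one side, and adjacent vertices share a bag, so a whole component stays on that
    side. *)
Lemma balanced_bag : exists2 X : {set T}, #|X| <= k.+1 &
  forall v, v \notin X -> 2 * #|W :&: reach X v| <= #|W|.
Proof.
have [D bagk] := small_bags tw.
pose occ v := [set x : td_node D | v \in td_bag x].
have [|b bP] := @centroid _ _ (td_tree D) _ occ W.
  by move=> v; have [x vx] := td_vertex D v; apply/set0Pn; exists x; rewrite inE.
exists (td_bag (t:=D) b) => // v vb.
have tree := td_tree D; have [_ t_sym _ _ _] := tree.
have one_side u : u \notin td_bag (t:=D) b ->
    exists2 c, td_edge (t:=D) b c & occ u \subset side (td_edge (t:=D)) b c.
  move=> ub; have [x ux] := td_vertex D u.
  have [|c bc xc] := side_cover tree (b := b) (y := x).
    by apply: contraNneq ub => <-.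
  exists c => //; apply/subsetP => y; rewrite inE => uy.
  have := td_subtree ux uy; rewrite !inE in xc * => xy; apply: connect_trans xc _.
  apply: connect_sub xy => p q /and3P[pq up uq]; apply: connect1.
  rewrite /del_edge /= pq; apply/negP => /orP[]/andP[/eqP p1 /eqP q1]; subst p q.
    by rewrite up in ub.
  by rewrite uq in ub.
have [c bc vc] := one_side _ vb.
suff sub : W :&: reach (td_bag (t:=D) b) v \subset [set u in W | occ u \subset side (td_edge (t:=D)) b c].
  by apply: leq_trans (bP c bc); rewrite leq_mul2l subset_leq_card.
apply/subsetP => u /setIP[uW]; rewrite !inE uW /= => vu.
apply: contraT => uc.
have vA : v \in [set u | occ u \subset side (td_edge (t:=D)) b c] by rewrite inE.
have uA : u \notin [set u | occ u \subset side (td_edge (t:=D)) b c] by rewrite inE.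
have [p [q [pA qA /and3P[pq pb qb] _]]] := connect_exit vu vA uA.
rewrite !inE in pA qA pb qb; have [c' bc' qc'] := one_side _ qb.
have [x /andP[px qx]] := td_cover D pq.
have cc' : c' = c.
  apply: (side_inj tree bc' bc (y := x)).
    by apply: (subsetP qc'); rewrite inE.
  by apply: (subsetP pA); rewrite inE.
by rewrite -cc' qc' in qA.
Qed.

(** [A] is a largest union of classes with at most two thirds of [W]. If the rest exceeded two
    thirds, [A] would have less than a third; another class [Q] has at most half of [W], hence by
    maximality at most [#|A|] points, and could be added. *)
Lemma balanced_partition : 1 < #|W| -> exists X A : {set T},
  [/\ #|X| <= k.+1, A \subset W, 3 * #|A| <= 2 * #|W|, 3 * #|W :\: A| <= 2 * #|W| &
      separates e A (W :\: A) X].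
Proof.
move=> W1; have [X Xk XP] := balanced_bag; exists X.
pose sat A := (A \subset W) &&
  [forall x in A, (x \notin X) ==> (W :&: reach X x \subset A)].
have sat_sep A : sat A -> separates e A (W :\: A) X.
  case/andP=> _ /forall_inP satA; apply/separatesP => x y xA /setDP[yW yA] xX.
  apply: contra yA => xy; have /implyP/(_ xX)/subsetP := satA _ xA; apply.
  by rewrite inE yW.
pose small A := sat A && (3 * #|A| <= 2 * #|W|).
have small0 : small set0.
  rewrite /small /sat sub0set cards0 muln0 andbT.
  by apply/forall_inP => x; rewrite inE.
case: (@arg_maxnP _ set0 small (fun A => #|A|)) => // A /andP[satA A3] maxA.
have AW : A \subset W by case/andP: satA.
exists A; split=> //; last exact: sat_sep.
rewrite leqNgt; apply/negP => big.
have WA : #|W :\: A| = #|W| - #|A| by rewrite cardsD (setIidPr AW).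
have /card_gt0P[y /setDP[yW yA]] : 0 < #|W :\: A|.
  by case: posnP big => // ->.
(* A point of [W] in [X] is a class by itself; [1 < #|W|] makes it at most half of [W]. *)
pose Q := if y \in X then [set y] else W :&: reach X y.
have yQ : y \in Q.
  by rewrite /Q; case: ifP => _; rewrite !inE ?eqxx ?yW ?connect0.
have satQ : sat Q.
  rewrite /Q; case: ifP => yX; apply/andP; split.
  - by rewrite sub1set.
  - by apply/forall_inP => x /set1P->; rewrite yX.
  - exact: subsetIl.
  - apply/forall_inP => x /setIP[_ yx]; apply/implyP => xX.
    by rewrite (reach_eq yx).
have Q2 : 2 * #|Q| <= #|W|.
  by rewrite /Q; case: ifPn => [_|yX]; [rewrite cards1 | apply: XP].
have satAQ : sat (A :|: Q).
  case/andP: satA => _ /forall_inP satA'; case/andP: satQ => QW /forall_inP satQ'.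
  apply/andP; split; first by rewrite subUset AW.
  apply/forall_inP => x /setUP[/satA'|/satQ'] /implyP xP; apply/implyP => /xP sub.
    by apply: subset_trans sub (subsetUl _ _).
  by apply: subset_trans sub (subsetUr _ _).
have AQ3 : 2 * #|W| < 3 * #|A :|: Q|.
  rewrite ltnNge; apply/negP => AQ3.
  have /= := maxA (A :|: Q); rewrite /small satAQ AQ3 => /(_ isT).
  apply/negP; rewrite -ltnNge proper_card //; apply/properP; split; first exact: subsetUl.
  by exists y; rewrite ?inE ?yQ ?orbT.
have [AQ _] := leq_card_setU A Q.
have QA : #|Q| <= #|A|.
  have Q3 : 3 * #|Q| <= 2 * #|W| by move: Q2; move: #|Q| #|W|; clear; lia.
  by have /= := maxA Q; rewrite /small satQ Q3 => /(_ isT).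
move: QA AQ AQ3 big Q2 (subset_leq_card AW); rewrite WA.
by move: #|Q| #|A| #|A :|: Q| #|W|; clear; lia.
Qed.

End Balanced.
End Separators.

(** * Components and ranks *)

Section Components.
Context (T : finType) (e : rel T) (e_sym : symmetric e).
Implicit Types (A B C D P Q S V W X Y Z R : {set T}) (u v x y : T).

Definition is_component S V := exists2 v, v \notin S & V = reach e S v.

Lemma component_notin S V x : is_component S V -> x \in V -> x \notin S.
Proof. by case=> v vS ->; apply: reach_notin. Qed.

Lemma component_disjoint S V : is_component S V -> [disjoint S & V].
Proof.
move=> cV; rewrite disjoint_sym disjoints_subset; apply/subsetP => x xV.
by rewrite inE (component_notin cV).
Qed.

Lemma component_reach S V x : is_component S V -> x \in V -> reach e S x = V.
Proof. by case=> v vS -> vx; apply: reach_eq. Qed.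

Lemma component_reach_sub S V Z x : is_component S V -> S \subset Z -> x \in V ->
  reach e Z x \subset V.
Proof. by move=> cV SZ xV; rewrite -(component_reach cV xV) reachS. Qed.

Lemma component_edge S V x y : is_component S V -> x \in V -> e x y -> y \notin S ->
  y \in V.
Proof.
move=> cV xV xy yS; rewrite -(component_reach cV xV).
exact: reach_edge (reach_refl _ _ _) (component_notin cV xV) xy yS.
Qed.

Lemma component_neq0 S V : is_component S V -> 0 < #|V|.
Proof. by case=> v _ ->; apply/card_gt0P; exists v; apply: reach_refl. Qed.

Lemma conn_reach Z v : v \notin Z -> conn e (reach e Z v).
Proof.
move=> vZ; apply/connP => x y vx; rewrite -(reach_eq e_sym vx) => xy.
move: (xy); rewrite [y \in _]inE; apply: sub_connect_from => p q xp pq.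
have xp' : p \in reach e Z x by rewrite inE.
have xq : q \in reach e Z x by rewrite inE; apply: connect_trans xp (connect1 pq).
by case/and3P: pq => pq _ _; apply/and3P.
Qed.

Lemma conn_within V C : C \subset V -> conn e C -> conn (within e V) C.
Proof.
move=> /subsetP CV /connP cC; apply/connP => x y xC yC.
apply: connect_sub (cC _ _ xC yC) => p q /and3P[pq pC qC]; apply: connect1.
by rewrite /within /= pq pC qC !CV.
Qed.

Lemma nbhd_reach S V S' v : is_component S V -> v \in V :\: S' ->
  nbhd (within e V) (reach e (S :|: S') v) \subset S'.
Proof.
move=> cV /setDP[vV vS']; apply/subsetP => y; rewrite inE => /andP[yR /exists_inP[x xR]].
case/and3P=> xy xV yV; apply: contraR yR => yS'.
have vZ : v \notin S :|: S' by rewrite !inE negb_or vS' (component_notin cV).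
apply: (reach_edge xR _ xy); first exact: reach_notin vZ xR.
by rewrite !inE negb_or yS' (component_notin cV).
Qed.

Lemma sub_component S V S' v : is_component S V -> v \in V :\: S' ->
  is_component (S :|: S') (reach e (S :|: S') v).
Proof.
move=> cV /setDP[vV vS']; exists v => //.
by rewrite !inE negb_or vS' (component_notin cV).
Qed.

(** [V] is connected outside [S], so each component of [V :\: S'] contains a neighbour of [S']
    unless [S'] is empty, and [S'] has at most [d * #|S'|] neighbours. Distinct components yield
    distinct neighbours [f u]. The value 1 is for empty [S']. *)
Lemma card_representatives d S V S' R : max_degree e <= d -> is_component S V ->
  S' \subset V -> R \subset V :\: S' ->
  (forall u v, u \in R -> v \in R -> v \in reach e (S :|: S') u -> u = v) ->
  #|R| <= maxn 1 (d * #|S'|).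
Proof.
move=> deg cV S'V RV Rinj; rewrite leq_max.
have [S'0|/set0Pn[s0 s0S']] := eqVneq S' set0.
  rewrite S'0 setU0 setD0 in Rinj RV *; rewrite leqNgt; apply/orP; left.
  apply/negP => /card_gt1P[u [v [uR vR /eqP]]]; apply; apply: Rinj => //.
  by rewrite (component_reach cV) (subsetP RV).
apply/orP; right; set Z := S :|: S' in Rinj *.
have notZ u : u \in R -> u \notin Z.
  move=> /(subsetP RV)/setDP[uV uS'].
  by rewrite !inE negb_or uS' (component_notin cV).
have exf u : u \in R -> exists y, (y \in reach e Z u) && [exists s in S', e s y].
  move=> uR; have uV : u \in V by have /setDP[] := subsetP RV _ uR.
  have us0 : s0 \in reach e S u by rewrite (component_reach cV uV) (subsetP S'V).
  rewrite inE in us0; have s0R : s0 \notin reach e Z u.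
    by apply/negP => /(reach_notin (notZ _ uR)); rewrite inE s0S' orbT.
  have [p [q [pR qR /and3P[pq _ qS] _]]] := connect_exit us0 (reach_refl _ _ _) s0R.
  exists p; rewrite pR; apply/exists_inP; exists q; last by rewrite e_sym.
  apply: contraR qR => qS'; apply: (reach_edge pR _ pq); first exact: reach_notin (notZ _ uR) pR.
  by move: qS; rewrite !inE negb_or qS' andbT.
pose f u := odflt u [pick y | (y \in reach e Z u) && [exists s in S', e s y]].
have fP u : u \in R -> (f u \in reach e Z u) && [exists s in S', e s (f u)].
  by move=> /exf[y yP]; rewrite /f; case: pickP => [//|/(_ y)]; rewrite yP.
rewrite -(card_in_imset (f := f)); last first.
  move=> u v uR vR fuv; have /andP[fu _] := fP _ uR; have /andP[fv _] := fP _ vR.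
  apply: Rinj => //; apply: reach_trans fu _.
  by rewrite fuv reachC.
apply: (@leq_trans #|\bigcup_(s in S') [set y | e s y]|).
  apply/subset_leq_card/subsetP => y /imsetP[u uR ->].
  have /andP[_ /exists_inP[s sS' sy]] := fP _ uR.
  by apply/bigcupP; exists s => //; rewrite inE.
rewrite mulnC -sum_nat_const.
have : #|\bigcup_(s in S') [set y | e s y]| <= \sum_(s in S') #|[set y | e s y]|.
  elim/big_rec2: _ => [|s a B _ IH]; first by rewrite cards0.
  by apply: leq_trans (leq_card_setU _ _).1 _; rewrite leq_add2l.
move/leq_trans; apply; apply: leq_sum => s _; apply: leq_trans deg.
exact: (leq_bigmax (F := fun x => #|[set y | e x y]|)).
Qed.

(* [2800] comes from [card_bad_sample], [82] from [shattered_card]. *)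
Lemma card_unbalanced V s m : 0 < s -> 1000 <= m <= #|V| -> 2800 * (82 * s) <= m ->
  6 * #|[set w : {ffun 'I_m -> T} in ffun_on V |
     (4 * #|sample_im w| < m) || [exists C : {set T}, [&& C \subset V, conn (within e V) C,
        #|nbhd (within e V) C| <= s, 1000 * #|V :\: C| <= #|V| &
        3 * #|C :&: sample_im w| <= 2 * #|sample_im w|]]]| <= 5 * #|V| ^ m.
Proof.
move=> s0 mV sm.
pose G C := [&& C \subset V, conn (within e V) C & #|nbhd (within e V) C| <= s].
(* Sampling is applied to the complements, which are the small sets; whatever they shatter is
   shattered by the connected sets themselves. *)
pose F := [set V :\: C | C in [set C | G C]].
have := @card_bad_sample T m V F (82 * s) _ _ mV sm.
have esym' : symmetric (within e V) by apply: within_sym.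
move/(_ _ _)/leq_trans => h; apply: leq_trans (h _ _ _ (leqnn _)).
- rewrite leq_mul2l /=; apply/subset_leq_card/subsetP => w; rewrite !inE.
  case/andP=> wV /orP[few|/existsP[C /and5P[CV cC nC Cbig C3]]]; rewrite wV ?few //=.
  apply/orP; right; apply/exists_inP; exists (V :\: C).
    by apply: imset_f; rewrite inE /G CV cC nC.
  rewrite Cbig /=.
  have -> : (V :\: C) :&: sample_im w = sample_im w :\: C.
    apply/setP => x; rewrite !inE; case: (boolP (x \in sample_im w)); rewrite ?andbF ?andbT //.
    by case/imsetP=> i _ ->; rewrite (ffun_onP wV) andbT.
  have := cardsID C (sample_im w); rewrite setIC; move: C3.
  by move: #|_| #|_| #|_| => a b c; clear; lia.
- move=> Y /shattersP sh; apply: ltnW.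
  have YV : Y \subset V.
    have [_ /imsetP[C _ ->] <-] := sh Y (subxx _).
    by apply: subset_trans (subsetIl _ _) (subsetDl _ _).
  have ex P : P \subset Y -> exists C, G C && (C :&: Y == P).
    move=> PY; have [_ /imsetP[C + ->] CP] := sh (Y :\: P) (subsetDl _ _).
    rewrite inE => GC; exists C; rewrite GC /=; apply/eqP/setP => x.
    have /setP/(_ x) := CP; rewrite !inE.
    case: (boolP (x \in Y)) => [xY|xY].
      by rewrite (subsetP YV _ xY) !andbT => /negb_inj.
    by rewrite !andbF => _; apply/esym/negP => /(subsetP PY); rewrite (negPf xY).
  pose cov P := odflt set0 [pick C | G C && (C :&: Y == P)].
  have covP P : P \subset Y -> G (cov P) && (cov P :&: Y == P).
    by move=> /ex[C CP]; rewrite /cov; case: pickP => [//|/(_ C)]; rewrite CP.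
  apply: (@shattered_card _ _ esym' s s0 Y cov) => P /covP /andP[/and3P[_ //]] _ _ /eqP //.
- by move=> D /imsetP[C _ ->]; apply: subsetDl.
Qed.

End Components.

(** * Ranks as sizes of minimum separators *)

Section RankFunction.
Context (T : finType) (e : rel T) (e_sym : symmetric e).
Context (rk : {set T} -> {set T} -> nat).
Hypothesis rkP : forall A B, is_min_separator_size e A B (rk A B).
Implicit Types (A B C S V X Z : {set T}) (u v x y : T).

Lemma rk_leq A B X : separates e A B X -> rk A B <= #|X|.
Proof. by case: (rkP A B) => _; apply. Qed.

Lemma rk_ex A B : exists2 X, separates e A B X & #|X| = rk A B.
Proof. by case: (rkP A B). Qed.

Lemma rk_mono A B A' B' : A' \subset A -> B' \subset B -> rk A' B' <= rk A B.
Proof.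
by move=> sA sB; have [X sepX <-] := rk_ex A B; apply/rk_leq/(separatesS sA sB).
Qed.

(** Every separator contains the common part [Z], so size [#|Z|] is attained just when [Z] itself
    separates; [u |: Z] always does. *)
Lemma rk_connected Z u v : u \notin Z -> v \notin Z ->
  (rk (u |: Z) (v |: Z) == #|Z|.+1) = (v \in reach e Z u).
Proof.
move=> uZ vZ; have sepZ : v \notin reach e Z u -> separates e (u |: Z) (v |: Z) Z.
  move=> uv; apply: separatesU (subxx Z); apply/separatesP => x y /set1P-> /set1P-> //.
have [uv|/sepZ/rk_leq le] := boolP (v \in reach e Z u); last first.
  by apply/eqP => h; rewrite h ltnn in le.
have sepu : separates e (u |: Z) (v |: Z) (u |: Z).
  by apply/separatesP => x y ->.
have := rk_leq sepu; rewrite cardsU1 uZ add1n eqn_leq => -> /=.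
rewrite ltnNge; apply/negP; have [X sepX <-] := rk_ex (u |: Z) (v |: Z) => le.
have ZX : Z \subset X.
  apply: subset_trans (separates_sub_inter sepX).
  by rewrite subsetI !subsetUr.
have ZE : Z = X by apply/eqP; rewrite eqEcard ZX.
move: sepX; rewrite -ZE => /separatesP/(_ u v); rewrite !inE !eqxx => /(_ isT isT uZ).
by rewrite inE in uv; rewrite uv.
Qed.

Section ABSeparator.
Context (S V A B : {set T}).
Hypotheses (cV : is_component e S V) (AV : A \subset V) (BV : B \subset V).
Let r := rk (A :|: S) (B :|: S).

Let sep_S X : separates e (A :|: S) (B :|: S) X -> S \subset X.
Proof.
move/separates_sub_inter; apply: subset_trans.
by rewrite subsetI !subsetUr.
Qed.

(** Outside [S] a path from [A] stays in [V], so the part of [X] in [S :|: V] separates already, and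
    minimality makes it all of [X]. *)
Lemma min_separator_sub X : separates e (A :|: S) (B :|: S) X -> #|X| = r ->
  X \subset S :|: V.
Proof.
move=> sepX Xr; have SX := sep_S sepX.
have SX' : S \subset X :&: (S :|: V) by rewrite subsetI SX subsetUl.
have : separates e (A :|: S) (B :|: S) (X :&: (S :|: V)).
  apply: (separatesU _ SX'); apply/separatesP => x y xA yB xX'.
  have xV : x \in V by apply: (subsetP AV).
  have inX p : p \in V -> p \notin X :&: (S :|: V) -> p \notin X.
    by move=> pV; rewrite !inE pV orbT andbT.
  move/separatesP: sepX => /(_ x y); rewrite !inE xA yB inX // => /(_ isT isT isT).
  apply: contra; apply: sub_connect_from => p q xp pq.
  have sub := component_reach_sub e_sym cV SX' xV.
  have pV : p \in V by apply: (subsetP sub); rewrite inE.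
  have qV : q \in V.
    by apply: (subsetP sub); rewrite inE; apply: connect_trans xp (connect1 pq).
  case/and3P: pq => pq; rewrite inE => pX; rewrite inE => qX.
  by rewrite /within /= pq !inE !inX.
move/rk_leq; rewrite -/r -Xr => le.
by apply/setIidPl/eqP; rewrite eqEcard subsetIl.
Qed.

(** Adding [C] to both sides restricts the separators to those containing [C], because of
    single-vertex paths. *)
Lemma rk_extends C : (rk (A :|: S :|: C) (B :|: S :|: C) == r) <->
  exists X, [/\ separates e (A :|: S) (B :|: S) X, #|X| = r & S :|: C \subset X].
Proof.
split=> [/eqP rC|[X [sepX Xr SCX]]].
  have [X sepX XC] := rk_ex (A :|: S :|: C) (B :|: S :|: C).
  exists X; split; last 1 first.
  - apply: subset_trans (separates_sub_inter sepX).
    by rewrite subsetI !setSU // subsetUr.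
  - by apply: separatesS sepX; rewrite subsetUl.
  - by rewrite XC.
rewrite eqn_leq; apply/andP; split; last by apply: rk_mono; apply: subsetUl.
rewrite -Xr; apply: rk_leq; apply: separatesU => //.
by apply: subset_trans SCX; apply: subsetUr.
Qed.

Lemma rk_squeeze C C' : C \subset C' -> rk (A :|: S :|: C') (B :|: S :|: C') = r ->
  rk (A :|: S :|: C) (B :|: S :|: C) = r.
Proof.
move=> CC' rC'; apply/eqP; rewrite eqn_leq; apply/andP; split.
  by rewrite -[X in _ <= X]rC'; apply: rk_mono; apply: setUS.
by apply: rk_mono; apply: subsetUl.
Qed.

(** [C] extends to a minimum separator [X]. A vertex of [X] outside [S :|: C] would lie in [V] and
    pass the test both alone and together with [C], against maximality. *)
Lemma greedy_separator C : rk (A :|: S :|: C) (B :|: S :|: C) = r ->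
  (forall u, u \in V -> rk (u |: (A :|: S)) (u |: (B :|: S)) = r -> u \notin C ->
     rk (u |: (A :|: S :|: C)) (u |: (B :|: S :|: C)) <> r) ->
  separates e (A :|: S) (B :|: S) (S :|: C) /\ #|S :|: C| = r.
Proof.
move=> /eqP/rk_extends[X [sepX Xr SCX]] maxC.
suff <- : X = S :|: C by [].
apply/eqP; rewrite eqEsubset SCX andbT; apply/subsetP => u uX.
apply: contraT; rewrite !inE negb_or => /andP[uS uC].
have uV : u \in V.
  by have := subsetP (min_separator_sub sepX Xr) _ uX; rewrite inE (negPf uS).
case: (maxC u uV) => //; apply/eqP.
  rewrite setUC [u |: _]setUC; apply/rk_extends; exists X; split=> //.
  by rewrite subUset sep_S // sub1set.
rewrite setUC [u |: _]setUC -!setUA; rewrite !(setUA _ S); apply/rk_extends; exists X; split=> //.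
by rewrite setUA subUset SCX sub1set.
Qed.

End ABSeparator.

Lemma rk_balanced k S W X A : separates e A (W :\: A) X -> #|X| <= k.+1 ->
  rk (A :|: S) (W :\: A :|: S) <= #|S| + k.+1.
Proof.
move=> sepX Xk; apply: (@leq_trans #|X :|: S|).
  apply: rk_leq; apply: separatesU (subsetUr _ _).
  apply/separatesP => x y xA yB; rewrite inE negb_or => /andP[xX _].
  move/separatesP: sepX => /(_ x y xA yB xX); apply: contra.
  exact: (subsetP (reachS _ _ (subsetUl _ _))).
by apply: leq_trans (leq_card_setU _ _).1 _; rewrite addnC leq_add2l.
Qed.

End RankFunction.

Import Order.TTheory GRing.Theory Num.Theory.
Local Open Scope ring_scope.

(** * Runs of randomised programs *)

Fixpoint all_in (A : Type) (P : A -> Prop) (s : seq A) : Prop :=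
  if s is a :: s' then P a /\ all_in P s' else True.

Lemma all_in_mem (A : eqType) (P : A -> Prop) (s : seq A) :
  (forall a, a \in s -> P a) -> all_in P s.
Proof.
elim: s => //= a s IH h; split; first by apply: h; rewrite inE eqxx.
by apply: IH => b bs; apply: h; rewrite inE bs orbT.
Qed.

Lemma all_in_impl (A : Type) (P Q : A -> Prop) (s : seq A) :
  (forall a, P a -> Q a) -> all_in P s -> all_in Q s.
Proof. by move=> PQ; elim: s => //= a s IH [Pa /IH]; split=> //; apply: PQ. Qed.

Section Logic.
Context (R : realType) (n : nat) (Sigma : 'M[R]_n).
Implicit Types (X Y : Type).

(* Expectation of [Phi] at the result, worst case over the open choices. *)
Fixpoint ev X (Phi : X -> R) (p : prog R n X) : R :=
  match p with
  | Ret x => Phi x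
  | Query i j f => ev Phi (f (Sigma i j))
  | Sample V f => (\sum_(v in V) ev Phi (f v)) / #|V|%:R
  | Choose A s f => if s is [::] then 0 else \big[Num.min/1]_(a <- s) ev Phi (f a)
  | Tick c p' => ev Phi p'
  | Timeout => 0
  end.

(* Every halting run makes at most [Q] queries and [t] operations and ends in
   [Post]; if [safe], then moreover every run halts. *)
Fixpoint runs X (safe : bool) (Post : X -> Prop) (p : prog R n X) (Q t : nat) : Prop :=
  match p with
  | Ret x => Post x
  | Query i j f => [/\ (0 < Q)%N, (0 < t)%N & runs safe Post (f (Sigma i j)) Q.-1 t.-1]
  | Sample V f => [/\ (0 < t)%N, safe -> V != set0 &
                      forall v, v \in V -> runs safe Post (f v) Q t.-1]
  | Choose A s f => (safe -> s <> [::]) /\ all_in (fun a => runs safe Post (f a) Q t) s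
  | Tick c p' => (c <= t)%N /\ runs safe Post p' Q (t - c)
  | Timeout => ~~ safe
  end.

Lemma runs_mono X (b b' : bool) (P P' : X -> Prop) p Q Q' t t' :
  runs b P p Q t -> (b' -> b) -> (forall x, P x -> P' x) -> (Q <= Q')%N -> (t <= t')%N ->
  runs b' P' p Q' t'.
Proof.
move=> + bb' PP'; elim: p Q Q' t t' => [x|i j f IH|V f IH|A s f IH|c p IH|] Q Q' t t' /=.
- by move=> /PP'.
- by case=> Q0 t0 h QQ' tt'; split; [lia | lia | apply: IH h _ _; lia].
- case=> t0 V0 h QQ' tt'; split; first by lia.
    by move=> /bb'.
  by move=> v vV; apply: IH (h v vV) _ _ => //; lia.
- case=> s0 h QQ' tt'; split; first by move=> /bb'.
  by apply: all_in_impl h => a ha; apply: IH ha _ _.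
- by case=> ct h QQ' tt'; split; [lia | apply: IH h _ _ => //; lia].
- by move=> /negP nb _ _; apply/negP => /bb'.
Qed.

Lemma runs_bind X Y b (P : X -> Prop) (P' : Y -> Prop) p g Q1 Q2 t1 t2 :
  runs b P p Q1 t1 -> (forall x, P x -> runs b P' (g x) Q2 t2) ->
  runs b P' (bind p g) (Q1 + Q2) (t1 + t2).
Proof.
move=> + gP; elim: p Q1 t1 => [x|i j f IH|V f IH|A s f IH|c p IH|] Q1 t1 /=.
- by move=> /gP h; apply: runs_mono h _ _ _ _ => //; apply: leq_addl.
- case=> Q0 t0 h; split; [lia | lia |].
  by apply: runs_mono (IH _ _ _ h) _ _ _ _ => //; lia.
- case=> t0 V0 h; split=> //; first by lia.
  by move=> v vV; apply: runs_mono (IH _ _ _ (h v vV)) _ _ _ _ => //; lia.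
- by case=> s0 h; split=> //; apply: all_in_impl h => a; apply: IH.
- case=> ct h; split; first by lia.
  by apply: runs_mono (IH _ _ h) _ _ _ _ => //; lia.
- by [].
Qed.

Lemma runs_le X b (P P' : X -> Prop) p Q Q' t t' : runs b P p Q t ->
  (forall x, P x -> P' x) -> (Q <= Q')%N -> (t <= t')%N -> runs b P' p Q' t'.
Proof. by move=> h PP' QQ' tt'; apply: runs_mono h _ PP' QQ' tt'. Qed.

Lemma runs_tick X b (P : X -> Prop) c p Q t :
  runs b P p Q t -> runs b P (Tick c p) Q (c + t).
Proof. by move=> h; split; rewrite ?leq_addr // addKn. Qed.

Lemma runs_foldM X Y b (I : seq Y -> X -> Prop) (f : X -> Y -> prog R n X) x0 (s : seq Y)
    (Q t : Y -> nat) :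
  I [::] x0 ->
  (forall s1 y s2 x, s = s1 ++ y :: s2 -> I s1 x ->
     runs b (I (rcons s1 y)) (f x y) (Q y) (t y)) ->
  runs b (I s) (foldM f x0 s) (\sum_(y <- s) Q y) (\sum_(y <- s) t y).
Proof.
move=> I0 step.
suff gen s2 : forall s1 x, s = s1 ++ s2 -> I s1 x ->
    runs b (I s) (foldM f x s2) (\sum_(y <- s2) Q y) (\sum_(y <- s2) t y).
  exact: gen I0.
elim: s2 => [|y s2 IH] s1 x sE Ix /=; first by move: sE Ix; rewrite cats0 => <-.
rewrite !big_cons; apply: runs_bind; first exact: step sE Ix.
by move=> x' Ix'; apply: IH Ix'; rewrite cat_rcons.
Qed.

Lemma runs_foldM_const X Y b (I : seq Y -> X -> Prop) (f : X -> Y -> prog R n X) x0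
    (s : seq Y) (Q t : nat) :
  I [::] x0 ->
  (forall s1 y s2 x, s = s1 ++ y :: s2 -> I s1 x -> runs b (I (rcons s1 y)) (f x y) Q t) ->
  runs b (I s) (foldM f x0 s) (size s * Q) (size s * t).
Proof.
move=> I0 step; have := runs_foldM (Q := fun=> Q) (t := fun=> t) I0 step.
by rewrite !big_const_seq !count_predT !iter_addn_0 ![(_ * size s)%N]mulnC.
Qed.

Lemma runs_mapM X Y b (h : Y -> X) (f : Y -> prog R n X) (s : seq Y) (Q t : nat) :
  all_in (fun y => runs b (fun x => x = h y) (f y) Q t) s ->
  runs b (fun xs => xs = map h s) (mapM f s) (size s * Q) (size s * t).
Proof.
elim: s => [|y s IH] //= [fy /IH hs].
rewrite !mulSn; apply: runs_bind fy _ => x ->.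
have := runs_bind (Q2 := 0) (t2 := 0) hs; rewrite !addn0; apply.
by move=> xs ->.
Qed.

Lemma bigmin_ge (A : Type) (s : seq A) (F : A -> R) y :
  y <= 1 -> all_in (fun a => y <= F a) s -> y <= \big[Num.min/1]_(a <- s) F a.
Proof.
move=> y1; elim: s => [|a s IH] /=; first by rewrite big_nil.
by case=> ya /IH h; rewrite big_cons le_min ya.
Qed.

Lemma bigmin_le1 (A : Type) (s : seq A) (F : A -> R) : \big[Num.min/1]_(a <- s) F a <= 1.
Proof. by elim: s => [|a s IH]; rewrite ?big_nil ?big_cons // ge_min IH orbT. Qed.

Lemma bigmin_mono (A : Type) (s : seq A) (F G : A -> R) :
  all_in (fun a => F a <= G a) s ->
  \big[Num.min/1]_(a <- s) F a <= \big[Num.min/1]_(a <- s) G a.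
Proof.
elim: s => [|a s IH] /=; first by rewrite !big_nil.
by case=> FG /IH h; rewrite !big_cons le_min !ge_min FG h orbT.
Qed.

Lemma pr_le1 X E (p : prog R n X) q t : pr Sigma E p q t <= 1.
Proof.
elim: p q t => [x|i j f IH|V f IH|A s f IH|c p IH|] q t //=.
- by rewrite lern1; case: (E q t).
- have [->|V0] := eqVneq V set0; first by rewrite big_set0 mul0r.
  rewrite ler_pdivrMr ?ltr0n ?card_gt0 // mul1r -sumr_const.
  by apply: ler_sum => v _; apply: IH.
- by case: s => // a s; apply: bigmin_le1.
Qed.

(** At the constant 1, [ev] is the worst-case probability of halting; if all halting runs respect
    the budget, it carries over to [E]. This separates the cost analysis from the probabilistic
    one. *)
Lemma ev_pr X b (P : X -> Prop) (E : nat -> nat -> bool) p Q t q0 t0 :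
  runs b P p Q t ->
  (forall q' t', (q' <= q0 + Q)%N -> (t' <= t0 + t)%N -> E q' t') ->
  ev (fun=> 1) p <= pr Sigma E p q0 t0.
Proof.
elim: p Q t q0 t0 => [x|i j f IH|V f IH|A s f IH|c p IH|] Q t q0 t0 //=.
- by move=> _ h; rewrite h ?leq_addr.
- by case=> Q0 tpos h hE; apply: IH h _ => q' t' hq ht; apply: hE; lia.
- case=> tpos _ h hE; rewrite ler_wpM2r ?invr_ge0 ?ler0n //.
  by apply: ler_sum => v vV; apply: IH (h v vV) _ => q' t' hq ht; apply: hE; lia.
- case=> _ h hE; case: s h => // a s h; apply: bigmin_mono.
  by apply: all_in_impl h => a' ha'; apply: IH ha' _.
- by case=> ct h hE; apply: IH h _ => q' t' hq ht; apply: hE; lia.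
Qed.

Lemma ev_bind X Y (Phi : Y -> R) (p : prog R n X) g :
  ev Phi (bind p g) = ev (fun x => ev Phi (g x)) p.
Proof.
elim: p => [x|i j f IH|V f IH|A s f IH|c p IH|] //=.
- by congr (_ / _); apply: eq_bigr.
- by case: s => // a s; apply: eq_bigr => a' _; apply: IH.
Qed.

Lemma ev_mono X b (P : X -> Prop) (Phi Psi : X -> R) p Q t :
  runs b P p Q t -> (forall x, P x -> Phi x <= Psi x) -> ev Phi p <= ev Psi p.
Proof.
move=> + PP; elim: p Q t => [x|i j f IH|V f IH|A s f IH|c p IH|] Q t //=.
- exact: PP.
- by case=> _ _; apply: IH.
- case=> _ _ h; rewrite ler_wpM2r ?invr_ge0 ?ler0n //.
  by apply: ler_sum => v vV; apply: IH (h v vV).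
- case=> _ h; case: s h => // a s h; apply: bigmin_mono.
  by apply: all_in_impl h => a' ha'; apply: IH ha'.
- by case=> _; apply: IH.
Qed.

(** The bound [y <= 1] accounts for the default value 1 of the minima in [ev]. *)
Lemma ev_safe X (P : X -> Prop) (Phi : X -> R) p Q t y : y <= 1 ->
  runs true P p Q t -> (forall x, P x -> y <= Phi x) -> y <= ev Phi p.
Proof.
move=> y1 + PP; elim: p Q t => [x|i j f IH|V f IH|A s f IH|c p IH|] Q t //=.
- exact: PP.
- by case=> _ _; apply: IH.
- case=> _ /(_ isT) V0 h; rewrite ler_pdivlMr ?ltr0n ?card_gt0 // mulr_natr -sumr_const.
  by apply: ler_sum => v vV; apply: IH (h v vV).
- case=> /(_ isT) s0 h; case: s h s0 => // a s h _; apply: bigmin_ge => //.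
  by apply: all_in_impl h => a' ha'; apply: IH ha'.
- by case=> _; apply: IH.
Qed.

(** Subtraction commutes with averages and minima except for the value 0 at [Timeout], empty draws
    and empty choices, and the default 1 of a minimum; for [0 <= y] these exceptions go in the right
    direction. *)
Lemma ev_sub X (Phi : X -> R) p y : 0 <= y -> ev Phi p - y <= ev (fun x => Phi x - y) p.
Proof.
move=> y0; elim: p => [x|i j f IH|V f IH|A s f IH|c p IH|] //=; last by rewrite sub0r oppr_le0.
- have [->|V0] := eqVneq V set0; first by rewrite !big_set0 !mul0r sub0r oppr_le0.
  have N0 : (0 : R) < #|V|%:R by rewrite ltr0n card_gt0.
  rewrite -[X in _ - X](mulfK (lt0r_neq0 N0)) -mulrBl ler_wpM2r ?invr_ge0 ?ler0n //.
  rewrite mulr_natr -sumr_const -sumrB.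
  by apply: ler_sum => v _; apply: IH.
- case: s => [|a s]; first by rewrite sub0r oppr_le0.
  elim: (a :: s) => [|b l IHl]; first by rewrite !big_nil gerBl.
  rewrite !big_cons le_min; apply/andP; split.
    by apply: le_trans (IH b); rewrite lerB // ge_min lexx.
  by apply: le_trans IHl; rewrite lerB // ge_min lexx orbT.
Qed.

(** Failure probabilities of the two stages add up, with no appeal to independence. *)
Lemma ev_bind_ge X Y b (P : X -> Prop) (p : prog R n X) (g : X -> prog R n Y) Q t y :
  0 <= y -> runs b P p Q t -> (forall x, P x -> 1 - y <= ev (fun=> 1) (g x)) ->
  ev (fun=> 1) p - y <= ev (fun=> 1) (bind p g).
Proof.
move=> y0 hp hg; rewrite ev_bind; apply: le_trans (ev_sub _ _ y0) _.
exact: ev_mono hp hg.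
Qed.

Lemma ev_bind_safe X Y (P : X -> Prop) (p : prog R n X) (g : X -> prog R n Y) Q t y :
  y <= 1 -> runs true P p Q t -> (forall x, P x -> y <= ev (fun=> 1) (g x)) ->
  y <= ev (fun=> 1) (bind p g).
Proof. by move=> y1 hp hg; rewrite ev_bind; apply: ev_safe y1 hp hg. Qed.

Lemma ev_runs_true X (P : X -> Prop) (p : prog R n X) Q t :
  runs true P p Q t -> 1 <= ev (fun=> 1) p.
Proof. by move=> hp; apply: ev_safe hp _. Qed.

Lemma ev_foldM_ge X Y b (I : seq Y -> X -> Prop) (f : X -> Y -> prog R n X) x0 (s : seq Y)
    (Q t : Y -> nat) (g : Y -> R) :
  (forall y, 0 <= g y) -> I [::] x0 ->
  (forall s1 y s2 x, s = s1 ++ y :: s2 -> I s1 x ->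
     runs b (I (rcons s1 y)) (f x y) (Q y) (t y) /\ 1 - g y <= ev (fun=> 1) (f x y)) ->
  1 - \sum_(y <- s) g y <= ev (fun=> 1) (foldM f x0 s).
Proof.
move=> g0 I0 step; suff gen s2 : forall s1 x, s = s1 ++ s2 -> I s1 x ->
    1 - \sum_(y <- s2) g y <= ev (fun=> 1) (foldM f x s2).
  exact: gen I0.
elim: s2 => [|y s2 IH] s1 x sE Ix /=; first by rewrite big_nil subr0.
have [hr he] := step _ _ _ _ sE Ix; rewrite big_cons opprD addrA.
apply: (le_trans _ (ev_bind_ge _ hr (y := \sum_(y <- s2) g y) _)).
- by rewrite lerD2r.
- by apply: sumr_ge0 => z _; apply: g0.
- by move=> x' Ix'; apply: IH Ix'; rewrite cat_rcons.
Qed.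

Lemma halting_pr_ge X (E : nat -> nat -> bool) (p : nat -> prog R n X) fuel y :
  y <= pr Sigma E (p fuel) 0 0 -> y <= halting_pr Sigma E p.
Proof.
move=> h; apply: le_trans h _; apply: sup_upper_bound; last by exists fuel.
split; first by exists (pr Sigma E (p 0) 0 0); exists 0.
by exists 1 => _ [f _ <-]; apply: pr_le1.
Qed.

End Logic.

(** * Blocks of the precision matrix *)

Section Selection.
Context (R : realType) (n : nat).
Implicit Types (A B C S V : {set 'I_n}) (M : 'M[R]_n).

(** Rows of the identity matrix: with it, identities between blocks become algebra with matrices
    over the full index set. *)
Definition sel A : 'M[R]_(#|A|, n) := \matrix_(i, j) (enum_val i == j)%:R.

Definition proj A : 'M[R]_n := (sel A)^T *m sel A.

Lemma mul_sel m A (M : 'M[R]_(n, m)) i j : (sel A *m M) i j = M (enum_val i) j.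
Proof.
rewrite mxE (bigD1 (enum_val i)) //= mxE eqxx mul1r big1 ?addr0 // => l.
by rewrite mxE eq_sym => /negPf->; rewrite mul0r.
Qed.

Lemma mul_selT m A (M : 'M[R]_(m, n)) i j : (M *m (sel A)^T) i j = M i (enum_val j).
Proof.
rewrite mxE (bigD1 (enum_val j)) //= !mxE eqxx mulr1 big1 ?addr0 // => l.
by rewrite !mxE eq_sym => /negPf->; rewrite mulr0.
Qed.

Lemma submx_ofE A B M : submx_of A B M = sel A *m M *m (sel B)^T.
Proof. by apply/matrixP => i j; rewrite mul_selT mul_sel mxE. Qed.

Lemma sel_selT A B (i : 'I_#|A|) (j : 'I_#|B|) :
  (sel A *m (sel B)^T) i j = (enum_val i == enum_val j)%:R.
Proof. by rewrite mul_selT mxE. Qed.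

Lemma sel_selT1 A : sel A *m (sel A)^T = 1%:M.
Proof. by apply/matrixP => i j; rewrite sel_selT mxE (inj_eq enum_val_inj). Qed.

Lemma sel_selT0 A B : [disjoint A & B] -> sel A *m (sel B)^T = 0.
Proof.
move=> AB; apply/matrixP => i j; rewrite sel_selT mxE; case: eqP => // ij.
by have := disjointFr AB (enum_valP i); rewrite ij enum_valP.
Qed.

Lemma projE A i j : proj A i j = ((i == j) && (i \in A))%:R.
Proof.
rewrite mxE; have [iA|iA] := boolP (i \in A); last first.
  rewrite andbF big1 // => a _; rewrite !mxE; case: eqP => [ai|]; last by rewrite mul0r.
  by rewrite -ai enum_valP in iA.
rewrite andbT (bigD1 (enum_rank_in iA i)) //= !mxE enum_rankK_in // eqxx mul1r.
rewrite big1 ?addr0 // => a ai; rewrite !mxE; case: eqP => [ea|]; last by rewrite mul0r.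
by case/negP: ai; apply/eqP/enum_val_inj; rewrite enum_rankK_in.
Qed.

Lemma mul_proj m A (M : 'M[R]_(m, n)) i j : (M *m proj A) i j = if j \in A then M i j else 0.
Proof.
rewrite mxE (bigD1 j) //= projE eqxx /= big1 ?addr0.
  by case: ifP => _; rewrite ?mulr1 ?mulr0.
by move=> l /negPf lj; rewrite projE lj mulr0.
Qed.

Lemma sel_proj A B C M N : sel A *m M *m proj C *m N *m (sel B)^T =
  submx_of A C M *m submx_of C B N.
Proof. by rewrite !submx_ofE /proj !mulmxA. Qed.

(** * Schur complements and the inverse *)

Section Conditional.
Context (Sigma : 'M[R]_n).
Hypothesis Sigma_pd : posdef Sigma.
Let Theta := invmx Sigma.

Lemma posdef_congr_unit p (E : 'M[R]_(p, n)) :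
  (forall x : 'rV[R]_p, x *m E = 0 -> x = 0) -> E *m Sigma *m E^T \in unitmx.
Proof.
move=> E0; rewrite -row_free_unit -kermx_eq0; apply/eqP/row_matrixP => i.
rewrite row0; apply: E0; set x := row _ _.
have xK : x *m (E *m Sigma *m E^T) = 0 by apply/sub_kermxP; apply: row_sub.
apply/eqP; apply: contraT => /(Sigma_pd.2).
by rewrite trmx_mul !mulmxA; rewrite !mulmxA in xK; rewrite xK mul0mx mxE ltxx.
Qed.

Lemma submx_unit S : submx_of S S Sigma \in unitmx.
Proof.
rewrite submx_ofE; apply: posdef_congr_unit => x /(congr1 (mulmx^~ (sel S)^T)).
by rewrite -mulmxA sel_selT1 mulmx1 mul0mx.
Qed.

Lemma Sigma_unit : Sigma \in unitmx.
Proof.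
have := @posdef_congr_unit n 1%:M; rewrite trmx1 mul1mx mulmx1; apply.
by move=> x; rewrite mulmx1.
Qed.

Lemma Theta_sym : Theta^T = Theta.
Proof. by rewrite /Theta trmx_inv Sigma_pd.1. Qed.

(** One [n]-by-[n] matrix whose blocks are all the Schur complements given [S]; its rows in [S]
    vanish. *)
Definition cond S : 'M[R]_n :=
  Sigma - Sigma *m (sel S)^T *m (invmx (submx_of S S Sigma) *m (sel S *m Sigma)).

Lemma submx_cond A B S : submx_of A B (cond S) =
  submx_of A B Sigma - submx_of A S Sigma *m (invmx (submx_of S S Sigma) *m submx_of S B Sigma).
Proof. by rewrite /cond !submx_ofE mulmxBr mulmxBl -!mulmxA. Qed.

Lemma sel_cond0 S : sel S *m cond S = 0.
Proof.
rewrite /cond mulmxBr !mulmxA -submx_ofE mulmxV ?submx_unit //.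
by rewrite mul1mx subrr.
Qed.

(** With [G] the regression coefficients of [S'] on [S], the block is the congruence of [Sigma] by
    [sel S' - G *m sel S], whose rows are independent as [S] and [S'] are disjoint. *)
Lemma cond_unit S S' : [disjoint S & S'] -> submx_of S' S' (cond S) \in unitmx.
Proof.
move=> SS'; set G := sel S' *m Sigma *m (sel S)^T *m invmx (submx_of S S Sigma).
have GT : (sel S' - G *m sel S) *m Sigma *m (sel S)^T = 0.
  rewrite !mulmxBl -(mulmxA G) -(mulmxA G) -submx_ofE /G.
  by rewrite -(mulmxA _ (invmx _)) mulVmx ?submx_unit // mulmx1 subrr.
have -> : submx_of S' S' (cond S) =
    (sel S' - G *m sel S) *m Sigma *m (sel S' - G *m sel S)^T.
  rewrite [(_ - G *m _)^T]linearB /= trmx_mul mulmxBr [_ *m ((sel S)^T *m _)]mulmxA GT.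
  rewrite mul0mx subr0 submx_ofE; congr (_ *m _).
  by rewrite /cond mulmxBr mulmxBl /G -!mulmxA.
apply: posdef_congr_unit => x /(congr1 (mulmx^~ (sel S')^T)).
rewrite -mulmxA mulmxBl sel_selT1 -[G *m _ *m _]mulmxA sel_selT0 //.
by rewrite mulmx0 subr0 mulmx1 mul0mx.
Qed.

(** The common source of the three formulas of [Reconstruct]. Since [Theta] inverts [Sigma],
    [Theta *m cond S] is the identity up to a term on the rows in [S], which [A] avoids. The inner
    sum may be restricted to [V]: rows of [cond S] in [S] vanish, and so do the entries of [Theta]
    from [A] to the outside of [V :|: S]. *)
Lemma precision_cond A B S V : [disjoint A & S] ->
  (forall a b, a \in A -> b \notin V -> b \notin S -> Theta a b = 0) ->
  [disjoint S & V] ->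
  sel A *m Theta *m proj V *m cond S *m (sel B)^T = sel A *m (sel B)^T.
Proof.
move=> AS ThA SV.
have -> : sel A *m Theta *m proj V = sel A *m Theta - sel A *m Theta *m proj S.
  apply/matrixP => i j; rewrite mul_proj [in RHS]mxE [X in _ = _ + X]mxE mul_proj !mul_sel.
  have [jV|jV] := boolP (j \in V); first by rewrite (disjointFl SV jV) subr0.
  have [jS|jS] := boolP (j \in S); first by rewrite subrr.
  by rewrite subr0 ThA ?enum_valP.
rewrite mulmxBl -[_ *m proj S *m _]mulmxA -[proj S *m _]mulmxA sel_cond0 !mulmx0 subr0.
rewrite /cond mulmxBr -[_ *m Theta *m Sigma]mulmxA mulVmx ?Sigma_unit // mulmx1.
rewrite !mulmxA -(mulmxA _ Theta) mulVmx ?Sigma_unit // mulmx1.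
by rewrite (sel_selT0 AS) !mul0mx subr0.
Qed.

Lemma projU A B : [disjoint A & B] -> proj (A :|: B) = proj A + proj B.
Proof.
move=> AB; apply/matrixP => i j; rewrite [RHS]mxE !projE inE -natrD; congr _%:R.
by have [iA|] := boolP (i \in A); rewrite ?(disjointFr AB iA) ?andbF //; case: (i == j).
Qed.

Lemma proj_partition (V S' : {set 'I_n}) (Cs : seq {set 'I_n}) : S' \subset V ->
  (forall v, \sum_(C <- Cs) (v \in C) = (v \in V :\: S') :> nat)%N ->
  proj V = proj S' + \sum_(C <- Cs) proj C.
Proof.
move=> S'V part; apply/matrixP => i j; rewrite [RHS]mxE summxE !projE.
under eq_bigr do rewrite projE.
have [->|ij] := eqVneq i j => /=; last by rewrite big1 ?addr0.
rewrite -natr_sum part inE -natrD; congr _%:R.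
by have [/(subsetP S'V)->|] := boolP (j \in S').
Qed.

Lemma precision_block S V : [disjoint V & S] ->
  (forall a b, a \in V -> b \notin V -> b \notin S -> Theta a b = 0) ->
  invmx (submx_of V V (cond S)) = submx_of V V Theta.
Proof.
move=> VS ThV; have := @precision_cond V V S V VS ThV; rewrite disjoint_sym => /(_ VS).
rewrite sel_selT1 sel_proj => h.
have [_ U] := mulmx1_unit h.
by rewrite -[RHS]mulmx1 -(mulmxV U) mulmxA h mul1mx.
Qed.

(** Rows [C], columns [S'] and inner set [C :|: S'], where the identity block is 0. *)
Lemma precision_cross S S' C : [disjoint C & S] -> [disjoint C & S'] -> [disjoint S & S'] ->
  (forall a b, a \in C -> b \notin C -> b \notin S' -> b \notin S -> Theta a b = 0) ->
  submx_of C S' Theta =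
  - (submx_of C C Theta *m submx_of C S' (cond S) *m invmx (submx_of S' S' (cond S))).
Proof.
move=> CS CS' SS' ThC.
have := @precision_cond C S' S (C :|: S') CS.
rewrite sel_selT0 // projU // (mulmxDr (sel C *m Theta)) !mulmxDl !sel_proj.
move=> h; rewrite -mulNmx -[LHS]mulmx1 -(mulmxV (cond_unit SS')) mulmxA; congr (_ *m _).
apply/eqP; rewrite -addr_eq0 addrC; apply/eqP/h.
  by move=> a b aC; rewrite inE negb_or => /andP[bC bS'] bS; apply: ThC.
by rewrite disjoint_sym disjoints_subset subUset -!disjoints_subset CS disjoint_sym.
Qed.

(** Rows and columns [S'], and the inner set [V] split into [S'] and the parts [Cs]. *)
Lemma precision_separator S S' V (Cs : seq {set 'I_n}) : [disjoint V & S] -> S' \subset V ->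
  (forall a b, a \in S' -> b \notin V -> b \notin S -> Theta a b = 0) ->
  (forall v, \sum_(C <- Cs) (v \in C) = (v \in V :\: S') :> nat)%N ->
  submx_of S' S' Theta =
  (1%:M - \sum_(C <- Cs) submx_of S' C Theta *m submx_of C S' (cond S)) *m
  invmx (submx_of S' S' (cond S)).
Proof.
move=> VS S'V ThS part; have S'S : [disjoint S' & S] by apply: disjointWl VS.
have SS' : [disjoint S & S'] by rewrite disjoint_sym.
have := @precision_cond S' S' S V S'S ThS; rewrite disjoint_sym => /(_ VS).
rewrite sel_selT1 (proj_partition S'V part) (mulmxDr (sel S' *m Theta)) !mulmxDl mulmx_sumr !mulmx_suml sel_proj.
under eq_bigr => C _ do rewrite sel_proj.
by move=> <-; rewrite -mulmxDl addrK mulmxK //; apply: cond_unit.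
Qed.

End Conditional.

Lemma set_blockE A B M M' i j : set_block (submx_of A B M) M' i j =
  if (i \in A) && (j \in B) then M i j else M' i j.
Proof.
rewrite mxE; case: pickP => [a /eqP ai|iA].
  case: pickP => [b /eqP bj|jB]; first by rewrite mxE -ai -bj !enum_valP.
  rewrite -ai enum_valP /=; case: ifP => // jB'.
  by have := jB (enum_rank_in jB' j); rewrite enum_rankK_in // eqxx.
case: ifP => // /andP[iA' _].
by have := iA (enum_rank_in iA' i); rewrite enum_rankK_in // eqxx.
Qed.

Lemma trmx_submx_of A B M : (submx_of A B M)^T = submx_of B A M^T.
Proof. by apply/matrixP => i j; rewrite !mxE. Qed.

Lemma leq_nnz p q (M : 'M[R]_(p, q)) : (nnz M <= p * q)%N.
Proof. by apply: leq_trans (max_card _) _; rewrite card_prod !card_ord. Qed.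

Lemma leq_nnz_precision (e : rel 'I_n) d C M : (max_degree e <= d)%N ->
  (forall i j, i != j -> ~~ e i j -> M i j = 0) ->
  (nnz (submx_of C C M) <= #|C| * d.+1)%N.
Proof.
move=> deg M0; rewrite /nnz.
have -> : (#|C| * d.+1 = \sum_(i < #|C|) d.+1)%N by rewrite sum_nat_const card_ord.
rewrite -sum1_card (eq_bigl (fun p => true && (submx_of C C M p.1 p.2 != 0))); last first.
  by move=> p; rewrite inE.
rewrite -(pair_big_dep xpredT (fun i j => submx_of C C M i j != 0) (fun _ _ => 1%N)) /=.
apply: leq_sum => i _; rewrite sum1_card.
rewrite -(card_image (@enum_val_inj _ (mem C))).
apply: (@leq_trans #|enum_val i |: [set y | e (enum_val i) y]|).
  apply/subset_leq_card/subsetP => y /imageP[j jM ->].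
  rewrite !inE eq_sym; move: jM; rewrite unfold_in /= mxE => jM.
  case: (eqVneq (enum_val i) (enum_val j)) => //= ij.
  by apply: contraR jM => nij; rewrite M0.
rewrite cardsU1; apply: (@leq_add _ _ 1 d); first exact: leq_b1.
apply: leq_trans deg.
exact: (leq_bigmax (F := fun x => #|[set y | e x y]|)).
Qed.

End Selection.

(** * Cost of the subroutines *)

Lemma seq_argmin (A : eqType) (f : A -> nat) (s : seq A) : s != [::] ->
  exists2 x, x \in s & all (fun y => f x <= f y)%N s.
Proof.
elim: s => // x [|y s] IH _; first by exists x; rewrite ?inE //= leqnn.
have [//|z zs zmin] := IH; have [xz|zx] := leqP (f x) (f z).
  exists x; rewrite ?inE ?eqxx //; apply/allP => u; rewrite inE => /predU1P[->//|us].
  exact: leq_trans xz (allP zmin _ us).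
exists z; first by rewrite inE zs orbT.
by apply/allP => u; rewrite inE => /predU1P[->|/(allP zmin)] //; apply: ltnW.
Qed.

Section Operations.
Context (R : realType) (n : nat) (Sigma : 'M[R]_n) (kappa : nat).
Local Notation vset := {set 'I_n}.
Local Notation runs := (runs Sigma).
Implicit Types (A B C S V W Z : vset).

Lemma runs_bind_le X Y b (P : X -> Prop) (P' : Y -> Prop) (p : prog R n X) g Q1 Q2 t1 t2 Q t :
  runs b P p Q1 t1 -> (forall x, P x -> runs b P' (g x) Q2 t2) ->
  (Q1 + Q2 <= Q)%N -> (t1 + t2 <= t)%N -> runs b P' (bind p g) Q t.
Proof. by move=> hp hg; apply: runs_le (runs_bind hp hg) _. Qed.

Lemma runs_query_block A B :
  runs true (fun N => N = submx_of A B Sigma) (query_block R A B)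
    (#|A| * #|B|) (#|A| * #|B|).
Proof.
rewrite /query_block; set s := (X in foldM _ _ X).
have szs : size s = (#|A| * #|B|)%N by rewrite size_allpairs -!cardE.
have h := @runs_foldM_const _ _ Sigma _ _ true
  (fun s1 (M : 'M[R]_n) => forall ij : 'I_n * 'I_n, ij \in s1 -> M ij.1 ij.2 = Sigma ij.1 ij.2)
  (fun M (ij : 'I_n * 'I_n) => Query ij.1 ij.2 (fun x => Ret (set_entry M ij.1 ij.2 x))) 0 s 1 1.
apply: (runs_bind_le (Q2 := 0) (t2 := 0) (h _ _)); rewrite ?szs ?muln1.
- by [].
- move=> s1 [i j] s2 M _ IM; split=> //= -[a b]; rewrite mem_rcons inE !mxE /=.
  by case/predU1P=> [[-> ->]|/IM h']; rewrite ?eqxx //; case: andP => [[/eqP-> /eqP->]|].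
- move=> M IM; apply/matrixP => i j; rewrite !mxE; apply: (IM (_, _)).
  by apply/allpairsP; exists (enum_val i, enum_val j); rewrite !mem_enum !enum_valP.
- by rewrite addn0.
- by rewrite addn0.
Qed.

Lemma runs_rank_block A B w : (#|A| <= w)%N -> (#|B| <= w)%N ->
  runs true (fun r => r = \rank (submx_of A B Sigma)) (rank_block R kappa A B)
    (w ^ 2) (w ^ 2 + kappa * w ^ 3).
Proof.
move=> Aw Bw; have ABw : (#|A| * #|B| <= w ^ 2)%N by rewrite -mulnn leq_mul.
apply: runs_bind_le (runs_query_block A B) _ _ _.
- move=> _ ->; apply: (@runs_tick _ _ _ _ true _ (kappa * maxn #|A| #|B| ^ 3) _ 0 0).
  by [].
- by rewrite addn0.
- rewrite addn0 leq_add // leq_mul // leq_exp2r // geq_max Aw Bw //.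
Qed.

Lemma runs_tick_ret X b (P : X -> Prop) c (x : X) :
  P x -> runs b P (Tick c (Ret x : prog R n X)) 0 c.
Proof. by move=> Px; split=> //; rewrite subnn. Qed.

Lemma runs_inv_op p (M : 'M[R]_p) :
  runs true (fun N => N = invmx M) (inv_op n kappa M) 0 (kappa * p ^ 3).
Proof. exact: runs_tick_ret. Qed.

Lemma runs_mul_op p q r (M : 'M[R]_(p, q)) (N : 'M[R]_(q, r)) :
  runs true (fun L => L = M *m N) (mul_op n kappa M N) 0 (kappa * (p * q * r)).
Proof. exact: runs_tick_ret. Qed.

Lemma runs_sparse_mul_op p q r (M : 'M[R]_(p, q)) (N : 'M[R]_(q, r)) c : (nnz M <= c)%N ->
  runs true (fun L => L = M *m N) (sparse_mul_op n kappa M N) 0 (kappa * (c * r)).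
Proof.
move=> Mc; apply: (runs_le (@runs_tick_ret _ true (fun L => L = M *m N) _ _ (erefl _))) => //.
by rewrite !leq_mul.
Qed.

Lemma runs_sub_op p q (M N : 'M[R]_(p, q)) :
  runs true (fun L => L = M - N) (sub_op n kappa M N) 0 (kappa * (p * q)).
Proof. exact: runs_tick_ret. Qed.

Lemma runs_write_op A B (N : 'M[R]_(#|A|, #|B|)) M :
  runs true (fun L => L = set_block N M) (write_op kappa N M) 0 (kappa * (#|A| * #|B|)).
Proof. exact: runs_tick_ret. Qed.

Lemma runs_cond_block A B S :
  runs true (fun N => N = submx_of A B (cond Sigma S)) (cond_block R kappa A B S)
    (#|A| * #|B| + #|A| * #|S| + #|S| * #|S| + #|S| * #|B|)
    (#|A| * #|B| + #|A| * #|S| + #|S| * #|S| + #|S| * #|B| +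
     kappa * (#|S| ^ 3 + #|S| * #|S| * #|B| + #|A| * #|S| * #|B| + #|A| * #|B|)).
Proof.
rewrite /cond_block.
have Q1 := runs_query_block A B; have Q2 := runs_query_block A S.
have Q3 := runs_query_block S S; have Q4 := runs_query_block S B.
apply: runs_bind_le Q1 _ _ _ => [_ ->||].
- apply: (runs_bind Q2) => _ ->; apply: (runs_bind Q3) => _ ->.
  apply: (runs_bind Q4) => _ ->; apply: (runs_bind (runs_inv_op _)) => _ ->.
  apply: (runs_bind (runs_mul_op _ _)) => _ ->; apply: (runs_bind (runs_mul_op _ _)) => _ ->.
  apply: runs_le (runs_sub_op _ _) _ (leqnn _) (leqnn _) => _ ->; by rewrite submx_cond.
- by rewrite !addn0 !addnA.
- by rewrite !mulnDr !addnA.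
Qed.

End Operations.

(** * Separators and components by rank tests *)

Section Calls.
Context (R : realType) (n : nat) (e : rel 'I_n) (Sigma : 'M[R]_n) (kappa k d : nat).
Hypotheses (e_sym : symmetric e) (tw : (treewidth e <= k)%N).
Hypotheses (deg : (max_degree e <= d)%N) (gen : generic e Sigma).
Local Notation vset := {set 'I_n}.
Local Notation runs := (runs Sigma).
Implicit Types (A B C D E S U V W Z : vset).
Local Notation rank_spec := (runs_rank_block Sigma kappa).

Let rk A B : nat := \rank (submx_of A B Sigma).
Let rkP : forall A B, is_min_separator_size e A B (rk A B) := gen.

Definition rank_time w := (w ^ 2 + kappa * w ^ 3)%N.

Definition ABSeparator_queries v w := (w ^ 2 + (v * w ^ 2 + v * w ^ 2))%N.
Definition ABSeparator_time v w :=
  (rank_time w + (v * (rank_time w).+1 + v * (rank_time w).+1))%N.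

(** Matrices keep size at most [w] while [C] grows: as long as the rank equals [r], [S :|: C] is
    part of a minimum separator and has at most [r] vertices. The strict inequalities leave room for
    the vertex under test. *)
Lemma runs_ABSeparator V A B S w :
  is_component e S V -> A \subset V -> B \subset V ->
  (#|A| + rk (A :|: S) (B :|: S) < w)%N -> (#|B| + rk (A :|: S) (B :|: S) < w)%N ->
  runs true (fun S' => [/\ S' \subset V, separates e (A :|: S) (B :|: S) (S :|: S') &
                           #|S :|: S'| = rk (A :|: S) (B :|: S)])
    (ABSeparator R kappa V A B S) (ABSeparator_queries #|V| w) (ABSeparator_time #|V| w).
Proof.
move=> cV AV BV; set r := rk _ _ => Aw Bw.
have cardw D C : D \subset V -> (#|D| + r < w)%N -> (#|S :|: C| <= r)%N ->
    (#|D :|: S :|: C| < w)%N.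
  move=> DV Dw SC; apply: leq_ltn_trans Dw; rewrite -setUA.
  by apply: leq_trans (leq_card_setU _ _).1 _; rewrite leq_add2l.
have extr C : rk (A :|: S :|: C) (B :|: S :|: C) = r -> (#|S :|: C| <= r)%N.
  move=> /eqP/(rk_extends rkP)[X [_ Xr SCX]].
  by have := subset_leq_card SCX; rewrite Xr.
have ext0 : rk (A :|: S :|: set0) (B :|: S :|: set0) = r by rewrite !setU0.
have AS C : rk (A :|: S :|: C) (B :|: S :|: C) = r -> (#|A :|: S :|: C| < w)%N.
  by move/extr; apply: cardw.
have BS C : rk (A :|: S :|: C) (B :|: S :|: C) = r -> (#|B :|: S :|: C| < w)%N.
  by move/extr; apply: cardw.
have ASw := AS _ ext0; have BSw := BS _ ext0; rewrite !setU0 in ASw BSw.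
have addw u D : (#|D| < w)%N -> (#|u |: D| <= w)%N.
  by move=> Dw; apply: leq_trans (leq_card_setU _ _).1 _; rewrite cards1 add1n.
rewrite /ABSeparator /ABSeparator_queries /ABSeparator_time.
apply: runs_bind (rank_spec (ltnW ASw) (ltnW BSw)) _ => _ ->; rewrite -/(rk _ _) -/r.
apply: (@runs_bind _ _ _ _ _ true
  (fun U => U = [set v in V | rk (v |: (A :|: S)) (v |: (B :|: S)) == r])).
  apply: (@runs_le _ _ _ _ true
    (fun U => U = [set v in enum V | rk (v |: (A :|: S)) (v |: (B :|: S)) == r])
    _ _ (size (enum V) * w ^ 2) _ (size (enum V) * (rank_time w).+1)).
  - apply: (@runs_foldM_const _ _ _ _ _ true
      (fun s U => U = [set v in s | rk (v |: (A :|: S)) (v |: (B :|: S)) == r])).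
      by apply/setP => v; rewrite !inE.
    move=> s1 v s2 U _ ->.
    apply: (runs_bind_le (Q2 := 0) (t2 := 1) (rank_spec (addw v _ ASw) (addw v _ BSw))).
    + move=> _ ->; apply: (@runs_tick _ _ _ _ true _ 1 _ 0 0); rewrite /= -/(rk _ _).
      apply/setP => x; rewrite !inE mem_rcons inE; case: ifP => ru; rewrite !inE.
        by have [->|] := eqVneq x v; rewrite ?ru.
      by have [->|] := eqVneq x v; rewrite ?ru ?andbF.
    + by rewrite addn0.
    + by rewrite addn1.
  - by move=> U ->; apply/setP => v; rewrite !inE mem_enum.
  - by rewrite -cardE.
  - by rewrite -cardE.
move=> U UE; have UV : U \subset V by rewrite UE; apply/subsetP => v; rewrite inE => /andP[].
(* If no vertex passes the test alone, [S] itself is a minimum separator and the empty answer is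
   right. *)
case: eqP => [U0|/eqP U0] /=.
  have [|sepC cardC] := greedy_separator e_sym rkP cV AV ext0 _.
    move=> u uV ru; suff : u \in U by rewrite U0 inE.
    by rewrite UE inE uV; apply/eqP.
  by split; rewrite ?sub0set.
split.
  by move=> _ E0; case/set0Pn: U0 => u; rewrite -mem_enum E0.
apply: all_in_mem => v0; rewrite mem_enum => v0U; split.
  move=> _ E0; have := mem_permutations (enum (U :\ v0)) (enum (U :\ v0)).
  by rewrite E0 perm_refl.
apply: all_in_mem => us; rewrite mem_permutations => us_perm.
have usV : (size us <= #|V|)%N.
  by rewrite (perm_size us_perm) -cardE; apply: subset_leq_card; apply: subset_trans (subD1set _ _) UV.
have rv0 : rk (A :|: S :|: [set v0]) (B :|: S :|: [set v0]) = r.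
  by move: v0U; rewrite UE inE ![_ :|: [set v0]]setUC => /andP[_ /eqP].
apply: (@runs_le _ _ _ _ true
   (fun C => [/\ C \subset V, rk (A :|: S :|: C) (B :|: S :|: C) = r, v0 \in C &
     forall u, u \in us -> u \notin C ->
       rk (u |: (A :|: S :|: C)) (u |: (B :|: S :|: C)) <> r])
   _ _ (size us * w ^ 2) _ (size us * (rank_time w).+1)).
- apply: (@runs_foldM_const _ _ _ _ _ true
   (fun s C => [/\ C \subset V, rk (A :|: S :|: C) (B :|: S :|: C) = r, v0 \in C &
     forall u, u \in s -> u \notin C ->
       rk (u |: (A :|: S :|: C)) (u |: (B :|: S :|: C)) <> r])).
    by split; rewrite ?sub1set ?set11 // (subsetP UV).
  move=> s1 u s2 C usE [CV rC v0C maxC].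
  have uV : u \in V.
    have : u \in us by rewrite usE mem_cat inE eqxx orbT.
    by rewrite (perm_mem us_perm) mem_enum => /setD1P[_ /(subsetP UV)].
  apply: (runs_bind_le (Q2 := 0) (t2 := 1)
    (rank_spec (addw u _ (AS _ rC)) (addw u _ (BS _ rC)))); last 2 first.
  + by rewrite addn0.
  + by rewrite addn1.
  move=> _ ->; apply: (@runs_tick _ _ _ _ true _ 1 _ 0 0); rewrite /= -/(rk _ _).
  have swap x D E : D :|: S :|: (x |: E) = x |: (D :|: S :|: E) by rewrite setUCA.
  case: eqP => [ru|nru].
    split.
    * by rewrite subUset sub1set uV.
    * by rewrite !swap.
    * by rewrite inE v0C orbT.
    * move=> u'; rewrite mem_rcons inE !inE negb_or => /predU1P[->|u's] /andP[u'u u'C].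
        by rewrite eqxx in u'u.
      (* A vertex rejected earlier stays rejected: rank [r] for the larger set would force rank [r]
         for the smaller one. *)
      move=> ru'; apply: (maxC u' u's u'C); rewrite -!swap.
      apply: (rk_squeeze rkP (C' := u' |: (u |: C))); last by rewrite !(swap u').
      by apply: setUS; apply: subsetUr.
  split=> // u'; rewrite mem_rcons inE => /predU1P[->|u's] u'C //.
  exact: maxC.
- move=> C [CV rC v0C maxC].
  have [|sepC cardC] := greedy_separator e_sym rkP cV AV rC _; last by split.
  move=> u uV ru uC; apply: maxC => //; rewrite (perm_mem us_perm) mem_enum.
  apply/setD1P; split; first by apply: contraNneq uC => ->.
  by rewrite UE inE uV; apply/eqP.
- by rewrite leq_mul2r usV orbT.
- by rewrite leq_mul2r usV orbT.
Qed.

(** [Separator] without its sampling, so that the random part stands alone. *)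
Definition separator_from V S W : prog R n vset :=
  Tick (2 * size (bipartitions W))%N
  (let* rs := mapM (fun AB : vset * vset =>
      let* r := rank_block R kappa (AB.1 :|: S) (AB.2 :|: S) in
      Tick 1 (Ret (r, AB))) (balanced_bipartitions W) in
   Choose (if balanced_bipartitions W is [::] then bipartitions W
           else [seq x.2 | x <- rs & all (fun y => (x.1 <= y.1)%N) rs])
     (fun AB => ABSeparator R kappa V AB.1 AB.2 S)).

Lemma mem_bipartitions W A B :
  ((A, B) \in bipartitions W) = (A \subset W) && (B == W :\: A).
Proof.
apply/mapP/andP => [[A' + [-> ->]]|[AW /eqP->]].
  by rewrite mem_enum powersetE eqxx.
by exists A; rewrite ?mem_enum ?powersetE.
Qed.

Lemma size_bipartitions W : size (bipartitions W) = (2 ^ #|W|)%N.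
Proof. by rewrite size_map -cardE card_powerset. Qed.

Lemma rk_bipartition S W A : (#|W| <= 1)%N -> A \subset W ->
  (rk (A :|: S) (W :\: A :|: S) <= #|S|)%N.
Proof.
move=> W1 AW; apply: (rk_leq rkP); apply: separatesU (subxx S).
apply/separatesP => x y xA /setDP[yW yA].
have xy : x = y by apply: (card_le1_eqP W1) => //; apply: (subsetP AW).
by rewrite -xy xA in yA.
Qed.

(** The balance clause is conditional because a single point has no balanced partition. *)
Definition separator_spec V S W S' := [/\ S' \subset V, (#|S'| <= k.+1)%N &
  (1 < #|W|)%N -> exists A, [/\ A \subset W, (3 * #|A| <= 2 * #|W|)%N,
     (3 * #|W :\: A| <= 2 * #|W|)%N & separates e A (W :\: A) (S :|: S')]].

Definition separator_queries v j w := (2 ^ j * w ^ 2 + ABSeparator_queries v w)%N.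
Definition separator_time v j w :=
  (2 * 2 ^ j + (2 ^ j * (rank_time w).+1 + ABSeparator_time v w))%N.

(** The exhaustive search does at least as well as [balanced_partition], so the rank is at most
    [#|S| + k.+1], and disjointness from [S] bounds [S']. With at most one sampled point any
    partition has rank at most [#|S|]. *)
Lemma runs_separator_from V S W w : is_component e S V -> W \subset V ->
  (#|W| + (#|S| + k.+1) < w)%N ->
  runs true (separator_spec V S W) (separator_from V S W)
    (separator_queries #|V| #|W| w) (separator_time #|V| #|W| w).
Proof.
move=> cV WV Ww; rewrite /separator_from /separator_queries /separator_time.
set cand := balanced_bipartitions W.
have candP AB : AB \in cand -> [/\ AB.1 \subset W, AB.2 = W :\: AB.1,
    (3 * #|AB.1| <= 2 * #|W|)%N & (3 * #|AB.2| <= 2 * #|W|)%N].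
  case: AB => A B; rewrite mem_filter mem_bipartitions /=.
  by case/andP=> /andP[h1 h2] /andP[AW /eqP BE]; split.
have cand2 : (1 < #|W|)%N -> exists2 AB, AB \in cand &
    (rk (AB.1 :|: S) (AB.2 :|: S) <= #|S| + k.+1)%N.
  move=> W1; have [X [A [Xk AW A3 B3 sepX]]] := balanced_partition e_sym tw W1.
  exists (A, W :\: A); last by apply: (rk_balanced rkP S sepX Xk).
  by rewrite mem_filter mem_bipartitions /= A3 B3 AW eqxx.
rewrite size_bipartitions; apply: runs_tick.
have leW D : D \subset W -> (#|D :|: S| <= w)%N.
  move=> DW; apply: leq_trans (leq_card_setU _ _).1 _; apply: leq_trans (ltnW Ww).
  by rewrite addnA (leq_trans _ (leq_addr _ _)) // leq_add2r subset_leq_card.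
pose h (AB : vset * vset) := (rk (AB.1 :|: S) (AB.2 :|: S), AB).
have sz : (size cand <= 2 ^ #|W|)%N.
  by rewrite -size_bipartitions size_filter count_size.
apply: (@runs_bind _ _ _ _ _ true (fun rs => rs = map h cand)).
  apply: (@runs_le _ _ _ _ true (fun rs => rs = map h cand) _ _
     (size cand * w ^ 2) _ (size cand * (rank_time w).+1)) => //.
  - apply: runs_mapM; apply: all_in_mem => AB /candP[AW BE _ _].
    apply: (runs_bind_le (Q2 := 0) (t2 := 1) (rank_spec (leW _ AW) _)).
    + by rewrite BE leW // subsetDl.
    + by move=> _ ->; apply: runs_tick_ret.
    + by rewrite addn0.
    + by rewrite addn1.
  - by rewrite leq_mul2r sz orbT.
  - by rewrite leq_mul2r sz orbT.
move=> rs rsE.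
have good (AB : vset * vset) : AB.1 \subset W -> AB.2 = W :\: AB.1 ->
    (rk (AB.1 :|: S) (AB.2 :|: S) <= #|S| + k.+1)%N ->
    ((1 < #|W|)%N -> AB \in cand) ->
    runs true (separator_spec V S W) (ABSeparator R kappa V AB.1 AB.2 S)
      (ABSeparator_queries #|V| w) (ABSeparator_time #|V| w).
  move=> AW BE rle inc.
  have lt D : D \subset W -> (#|D| + rk (AB.1 :|: S) (AB.2 :|: S) < w)%N.
    by move=> DW; apply: leq_ltn_trans Ww; apply: leq_add rle; apply: subset_leq_card.
  have BW : AB.2 \subset W by rewrite BE subsetDl.
  apply: runs_le (runs_ABSeparator cV (subset_trans AW WV) (subset_trans BW WV) (lt _ AW) (lt _ BW))
    _ (leqnn _) (leqnn _) => S' [S'V sep card]; split=> //.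
    have dis : [disjoint S & S'] := disjointWr S'V (component_disjoint cV).
    by have := leq_trans (eq_leq card) rle; rewrite cardsU (disjoint_setI0 dis) cards0 subn0 leq_add2l.
  move=> /inc/candP[_ _ A3 B3]; exists AB.1; rewrite -BE; split=> //.
  by apply: separatesS sep; apply: subsetUl.
split=> [_|].
  case cE : cand => [|AB0 c'].
    move=> E0; have := mem_bipartitions W set0 W; rewrite E0 sub0set setD0 eqxx.
    by [].
  have : exists AB, AB \in [seq x.2 | x <- rs & all (fun y => (x.1 <= y.1)%N) rs].
    have rs0 : rs != [::] by rewrite rsE cE.
    have [x xrs xmin] := seq_argmin (fun x : nat * (vset * vset) => x.1) rs0.
    by exists x.2; apply: map_f; rewrite mem_filter xmin.
  by move=> [AB +] E0; rewrite E0.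
apply: all_in_mem => -[A B] AB.
case cE : cand AB => [|AB0 c'] AB.
  have W1 : (#|W| <= 1)%N.
    by rewrite leqNgt; apply/negP => /cand2[AB']; rewrite cE.
  move: AB; rewrite mem_bipartitions => /andP[AW /eqP BE].
  apply: good => //=; last by rewrite ltnNge W1.
  by rewrite BE; apply: leq_trans (rk_bipartition _ W1 AW) (leq_addr _ _).
move: AB; rewrite rsE => /mapP[x]; rewrite mem_filter => /andP[/allP xmin].
case/mapP=> AB' AB'c xE ABE.
have AB'E : (A, B) = AB' by rewrite ABE xE.
have inc : (A, B) \in cand by rewrite AB'E.
have [AW BE _ _] := candP _ inc.
apply: good => //.
have [W1|W1] := leqP #|W| 1.
  by rewrite BE; apply: leq_trans (rk_bipartition _ W1 AW) (leq_addr _ _).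
have [AB2 AB2c rle] := cand2 W1; apply: leq_trans rle.
by have := xmin (h AB2) (map_f _ AB2c); rewrite xE /= -AB'E.
Qed.

Definition components_from V S S' : prog R n (seq vset * vset) :=
  Choose (permutations (enum (V :\: S'))) (fun vs =>
    let* cs := foldM (classify R kappa (S :|: S')) [::] vs in
    Ret ([seq uC.2 | uC <- cs], S')).

Definition components_spec V S S' (r : seq vset * vset) := [/\ r.2 = S',
  (forall C, C \in r.1 -> exists2 v, v \in V :\: S' & C = reach e (S :|: S') v) &
  (forall v, \sum_(C <- r.1) (v \in C) = (v \in V :\: S') :> nat)%N].

Definition components_queries (v D z : nat) := (v * (D * z ^ 2))%N.
Definition components_time (v D z : nat) := (v * (D * (rank_time z).+1))%N.

Definition classified V S' Z (s : seq 'I_n) (cs : seq ('I_n * vset)) :=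
  [/\ forall uC, uC \in cs ->
        [/\ uC.1 \in V :\: S' & uC.2 = [set v in s | v \in reach e Z uC.1]],
      uniq (map fst cs),
      {in map fst cs &, forall u v, v \in reach e Z u -> u = v} &
      forall v, v \in s -> has (fun uC => v \in reach e Z uC.1) cs].

(** Representatives lie in distinct components, so [card_representatives] bounds the number of tests
    for one vertex by [D]. *)
Lemma runs_classify V S S' (D z : nat) s cs v : is_component e S V -> S' \subset V ->
  (maxn 1 (d * #|S'|) <= D)%N -> (#|S :|: S'| < z)%N -> v \in V :\: S' ->
  classified V S' (S :|: S') s cs ->
  runs true (classified V S' (S :|: S') (rcons s v)) (classify R kappa (S :|: S') cs v)
    (D * z ^ 2) (D * (rank_time z).+1).
Proof.
move=> cV S'V dD; set Z := S :|: S' => Zz vV [csP ucs injcs covs].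
have notZ u : u \in V :\: S' -> u \notin Z.
  by case/setDP=> uV uS'; rewrite inE negb_or uS' (component_notin cV).
have szcs : (size cs <= D)%N.
  apply: leq_trans dD; rewrite -(size_map fst) -(card_uniqP ucs) -[X in (X <= _)%N]cardsE.
  apply: (card_representatives e_sym deg cV S'V).
    by apply/subsetP => u; rewrite inE => /mapP[uC /csP[h _] ->].
  move=> u u2 us us2; apply: injcs; [move: us | move: us2]; by rewrite inE.
have addz u : (#|u |: Z| <= z)%N.
  by apply: leq_trans (leq_card_setU _ _).1 _; rewrite cards1 add1n.
have rmap := @runs_mapM _ _ Sigma _ _ true (fun uC => (v \in reach e Z uC.1, uC))
  (fun uC : 'I_n * vset => let* r := rank_block R kappa (uC.1 |: Z) (v |: Z) in
      Tick 1 (Ret (r == #|Z|.+1, uC))) cs (z ^ 2) (rank_time z).+1.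
apply: (runs_bind_le (Q2 := 0) (t2 := 0) (rmap _)); last 2 first.
- by rewrite addn0 leq_mul2r szcs orbT.
- by rewrite addn0 leq_mul2r szcs orbT.
- apply: all_in_mem => uC /csP[uV _].
  apply: (runs_bind_le (Q2 := 0) (t2 := 1) (rank_spec (addz _) (addz _))).
  + move=> _ ->; apply: runs_tick_ret; congr pair.
    exact: (rk_connected rkP (notZ _ uV) (notZ _ vV)).
  + by rewrite addn0.
  + by rewrite addn1.
move=> _ -> /=; rewrite has_map (eq_has (a2 := fun uC => v \in reach e Z uC.1)) //.
have [hv|nv] := boolP (has _ cs).
  pose f (uC : 'I_n * vset) := if v \in reach e Z uC.1 then (uC.1, v |: uC.2) else uC.
  rewrite -map_comp; change (classified V S' Z (rcons s v) (map f cs)).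
  have fst_f : map fst (map f cs) = map fst cs.
    by rewrite -map_comp; apply: eq_map => uC; rewrite /f /=; case: ifP.
  split.
  - move=> _ /mapP[uC /csP[uV CE] ->]; rewrite /f /=.
    case: ifP => vu /=; split=> //; apply/setP => x; rewrite CE !inE mem_rcons inE;
      rewrite inE in vu.
      by have [->|] := eqVneq x v; rewrite ?vu.
    by have [->|] := eqVneq x v; rewrite ?vu ?andbF.
  - by rewrite fst_f.
  - by rewrite fst_f.
  - move=> x; rewrite mem_rcons inE has_map => /predU1P[->|/covs].
      by apply: sub_has hv => uC /=; rewrite /f /=; case: ifP.
    by apply: sub_has => uC; rewrite /f /=; case: ifP.
have nreach u : u \in map fst cs -> v \notin reach e Z u.
  by case/mapP=> uC uCcs ->; apply: contra nv => h; apply/hasP; exists uC.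
split.
- move=> uC; rewrite mem_rcons inE => /predU1P[->|uCcs] /=.
    split=> //; apply/setP => x; rewrite !inE mem_rcons inE.
    have [->|xv] := eqVneq x v; first by rewrite connect0.
    apply/esym/negP => /andP[/covs/hasP[uD uDcs xu] vx].
    case/negP: (nreach _ (map_f fst uDcs)); apply: (reach_trans xu).
    by rewrite reachC // inE.
  have [uV CE] := csP _ uCcs; split=> //; rewrite CE; apply/setP => x.
  rewrite !inE mem_rcons inE; have [->|//] := eqVneq x v => /=.
  have := nreach _ (map_f fst uCcs); rewrite inE => /negPf->.
  by rewrite andbF.
- rewrite map_rcons rcons_uniq ucs andbT /=; apply/negP => /nreach.
  by rewrite reach_refl.
- move=> u u'; rewrite map_rcons /= !mem_rcons !in_cons.
  case/predU1P=> [->|us]; case/predU1P=> [->|us'] // h; last exact: injcs.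
    by case/negP: (nreach _ us'); rewrite reachC.
  by case/negP: (nreach _ us).
- move=> x; rewrite mem_rcons inE has_rcons => /predU1P[->|/covs->]; rewrite ?orbT //.
  by rewrite /= inE connect0.
Qed.

Lemma runs_components_from V S S' (D z : nat) : is_component e S V -> S' \subset V ->
  (maxn 1 (d * #|S'|) <= D)%N -> (#|S :|: S'| < z)%N ->
  runs true (components_spec V S S') (components_from V S S')
    (components_queries #|V| D z) (components_time #|V| D z).
Proof.
move=> cV S'V dD Zz; set Z := S :|: S'; split=> [_ E0|].
  by have := mem_permutations (enum (V :\: S')) (enum (V :\: S')); rewrite E0 perm_refl.
apply: all_in_mem => vs; rewrite mem_permutations => vs_perm.
have memvs v : (v \in vs) = (v \in V :\: S') by rewrite (perm_mem vs_perm) mem_enum.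
have szvs : (size vs <= #|V|)%N.
  by rewrite (perm_size vs_perm) -cardE subset_leq_card // subsetDl.
apply: (runs_bind_le (Q2 := 0) (t2 := 0) (P := classified V S' Z vs)
  (Q1 := (size vs * (D * z ^ 2))%N) (t1 := (size vs * (D * (rank_time z).+1))%N)).
- apply: (runs_foldM_const (I := classified V S' Z)); first by split.
  move=> s1 v s2 cs vsE cl; apply: runs_classify => //.
  by rewrite -memvs vsE mem_cat inE eqxx orbT.
- move=> cs [csP ucs injcs covs].
  have CE uC : uC \in cs -> uC.2 = reach e Z uC.1.
    move=> /csP[uV ->]; apply/setP => x; rewrite inE memvs; apply/andb_idl => ux.
    have uVV : uC.1 \in V by case/setDP: uV.
    have uZ : uC.1 \notin Z.
      by case/setDP: uV => _ uS'; rewrite inE negb_or uS' (component_notin cV).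
    rewrite inE (subsetP (component_reach_sub e_sym cV (subsetUl _ _) uVV) _ ux) andbT.
    by have := reach_notin uZ ux; rewrite inE negb_or => /andP[].
  split=> //= [_ /mapP[uC uCcs ->]|v].
    by exists uC.1; [have [] := csP _ uCcs | apply: CE].
  rewrite big_map; have [vV|vV] := boolP (v \in V :\: S'); last first.
    rewrite big_seq big1 // => uC uCcs; have [_ ->] := csP _ uCcs.
    by rewrite inE memvs (negPf vV).
  have := covs v; rewrite memvs vV => /(_ isT)/hasP[uC uCcs vu].
  transitivity (\sum_(u <- map fst cs) (v \in reach e Z u))%N.
    rewrite big_map big_seq [RHS]big_seq; apply: eq_bigr => uC' h; by rewrite CE.
  rewrite (bigD1_seq uC.1) ?map_f //= vu big_seq_cond big1 // => u /andP[us uu].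
  apply/eqP; rewrite eqb0; apply: contra uu => vu'; apply/eqP; apply: injcs => //.
    exact: map_f.
  by apply: reach_trans vu' _; rewrite reachC.
- by rewrite addn0 leq_mul2r szvs orbT.
- by rewrite addn0 leq_mul2r szvs orbT.
Qed.

End Calls.

(** * Sampling in Components *)

Section Sampling.
Context (R : realType) (n : nat) (Sigma : 'M[R]_n).
Local Notation vset := {set 'I_n}.
Local Notation runs := (runs Sigma).
Implicit Types (V W : vset).

Definition ffun_cons m (v : 'I_n) (w : {ffun 'I_m -> 'I_n}) : {ffun 'I_m.+1 -> 'I_n} :=
  [ffun i => if unlift ord0 i is Some j then w j else v].

Lemma sample_im_cons m v (w : {ffun 'I_m -> 'I_n}) :
  sample_im (ffun_cons v w) = v |: sample_im w.
Proof.
apply/setP => x; apply/imsetP/setU1P => [[i _ ->]|[->|/imsetP[j _ ->]]].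
- rewrite ffunE; case: unliftP => [j _|_]; last by left.
  by right; apply: imset_f.
- by exists ord0; rewrite // ffunE unlift_none.
- by exists (lift ord0 j); rewrite // ffunE liftK.
Qed.

Lemma sum_ffun_cons m V (F : {ffun 'I_m.+1 -> 'I_n} -> R) :
  \sum_(w in ffun_on V) F w = \sum_(v in V) \sum_(w in ffun_on V) F (ffun_cons v w).
Proof.
rewrite pair_big /= (reindex (fun p : 'I_n * {ffun 'I_m -> 'I_n} => ffun_cons p.1 p.2)) /=.
  apply: eq_bigl => -[v w] /=; apply/ffun_onP/andP => [h|[vV /ffun_onP wV] i].
    split; first by have := h ord0; rewrite ffunE unlift_none.
    by apply/ffun_onP => j; have := h (lift ord0 j); rewrite ffunE liftK.
  by rewrite ffunE; case: unliftP.
exists (fun w => (w ord0, [ffun j => w (lift ord0 j)])) => [[v w] _|w _] /=.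
  rewrite ffunE unlift_none; congr pair; apply/ffunP => j.
  by rewrite !ffunE liftK.
by apply/ffunP => i; rewrite ffunE; case: unliftP => [j ->|->]; rewrite ?ffunE.
Qed.

(** Successive draws become one uniform function, the form in which bad samples were counted. *)
Lemma ev_sample_set V m W (Phi : vset -> R) :
  ev Sigma Phi (sample_set R V m W) =
  (\sum_(w : {ffun 'I_m -> 'I_n} | w \in ffun_on V) Phi (W :|: sample_im w)) / #|V|%:R ^+ m.
Proof.
elim: m W => [|m IH] W /=.
  have im0 (w : {ffun 'I_0 -> 'I_n}) : W :|: sample_im w = W.
    by apply/setUidPl/subsetP => x /imsetP[[]].
  under eq_bigr => w _ do rewrite im0.
  by rewrite sumr_const card_ffun_on card_ord expn0 mulr1n expr0 divr1.
rewrite (eq_bigr _ (fun v _ => IH (v |: W))) -mulr_suml sum_ffun_cons.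
rewrite exprS invfM mulrA mulrAC; congr (_ / _ / _).
apply: eq_bigr => v _; apply: eq_bigr => w _.
by rewrite sample_im_cons setUA (setUC W).
Qed.

Lemma runs_sample_set V m W : V != set0 ->
  runs true (fun W' => W' \subset W :|: V /\ (#|W'| <= #|W| + m)%N)
    (sample_set R V m W) 0 m.
Proof.
move=> V0; elim: m W => [|m IH] W /=; first by rewrite addn0 subsetUl.
split=> // v vV; apply: runs_le (IH (v |: W)) _ _ _ => // W' [W'V W'm]; split.
  apply: subset_trans W'V _; rewrite !subUset sub1set inE vV orbT.
  by rewrite subsetUl subsetUr.
apply: leq_trans W'm _; rewrite addnS -addSn leq_add2r cardsU1.
by case: (v \in W); rewrite ?add0n ?add1n.
Qed.

(** At least one sample in six is outside [Bad] and reduces the loss [y] by the fraction [c]. *)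
Lemma ev_sample_set_ge V m (Bad : {set {ffun 'I_m -> 'I_n}}) (Phi : vset -> R) (y c : R) :
  V != set0 -> Bad \subset ffun_on V -> (6 * #|Bad| <= 5 * #|V| ^ m)%N -> 0 <= y -> 0 <= c ->
  (forall w : {ffun 'I_m -> 'I_n}, w \in ffun_on V -> 1 - y <= Phi (sample_im w)) ->
  (forall w : {ffun 'I_m -> 'I_n}, w \in ffun_on V -> w \notin Bad -> 1 - y * (1 - c) <= Phi (sample_im w)) ->
  1 - y * (1 - c / 6) <= ev Sigma Phi (sample_set R V m set0).
Proof.
move=> V0 sBad BadP y0 c0 h1 h2; rewrite ev_sample_set.
have N0 : (0 : R) < #|V|%:R by rewrite ltr0n card_gt0.
rewrite ler_pdivlMr ?exprn_gt0 //.
have cardO : #|ffun_on V : pred {ffun 'I_m -> 'I_n}|%:R = #|V|%:R ^+ m :> R.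
  by rewrite card_ffun_on card_ord natrX.
apply: (@le_trans _ _ (\sum_(w : {ffun 'I_m -> 'I_n} | w \in ffun_on V)
    (1 - y * (1 - c) - (if w \in Bad then y * c else 0)))); last first.
  apply: ler_sum => w wV; rewrite set0U; case: ifPn => wB.
    by apply: le_trans (h1 w wV); lra.
  by rewrite subr0 h2.
rewrite sumrB sumr_const card_ffun_on card_ord -[X in _ <= X - _]mulr_natr natrX -big_mkcondr /=.
rewrite (eq_bigl (fun w => w \in Bad)); last first.
  by move=> w; apply/andb_idl/(subsetP sBad).
rewrite sumr_const -[X in _ <= _ - X]mulr_natr.
have BadR : 6 * #|Bad|%:R <= 5 * #|V|%:R ^+ m :> R.
  by rewrite -natrX -!natrM ler_nat.
have yc : 0 <= y * c by apply: mulr_ge0.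
move: (#|V|%:R ^+ m) (#|Bad|%:R) BadR => X b Xb.
have := ler_wpM2l yc Xb; lra.
Qed.

End Sampling.

(** * Decrease of the sum of squares in one call *)

Section Reconstruct.
Context (R : realType) (n : nat) (e : rel 'I_n) (Sigma : 'M[R]_n) (kappa k d m : nat).
Hypotheses (e_sym : symmetric e) (tw : (treewidth e <= k)%N).
Hypotheses (deg : (max_degree e <= d)%N) (gen : generic e Sigma).
Hypotheses (m1000 : (1000 <= m)%N) (m_big : (2800 * (82 * k.+1) <= m)%N).
Local Notation vset := {set 'I_n}.
Local Notation runs := (runs Sigma).
Local Notation ev := (ev Sigma).
Implicit Types (A B C S V W : vset).

Definition components_ok V S (r : seq vset * vset) :=
  [/\ r.2 \subset V, (#|r.2| <= k.+1)%N & components_spec e V S r.2 r].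

Lemma components_card V S r : components_ok V S r -> (\sum_(C <- r.1) #|C| <= #|V|)%N.
Proof.
case=> S'V _ [_ _ part].
have -> : (\sum_(C <- r.1) #|C| = \sum_(C <- r.1) \sum_v (v \in C))%N.
  by apply: eq_bigr => C _; rewrite -sum1_card big_mkcond.
rewrite exchange_big /= (eq_bigr _ (fun v _ => part v)).
by rewrite -big_mkcond sum1_card subset_leq_card // subsetDl.
Qed.

Lemma component_sub V S r C : is_component e S V -> components_ok V S r -> C \in r.1 ->
  [/\ C \subset V, is_component e (S :|: r.2) C & [disjoint C & r.2]].
Proof.
move=> cV [S'V _ [_ comps _]] /comps[v vV ->].
have vV' : v \in V by case/setDP: vV.
split; first exact (component_reach_sub e_sym cV (subsetUl _ _) vV').
  exact: (sub_component cV vV).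
have := component_disjoint (sub_component cV vV); rewrite disjoint_sym.
by apply: disjointWr; apply: subsetUr.
Qed.

Lemma components_sqr V S r : is_component e S V -> components_ok V S r ->
  (\sum_(C <- r.1) #|C| ^ 2 <= #|V| ^ 2)%N.
Proof.
move=> cV ok; apply: (@leq_trans (\sum_(C <- r.1) #|V| * #|C|)).
  rewrite big_seq [X in (_ <= X)%N]big_seq; apply: leq_sum => C Cr.
  have [CV _ _] := component_sub cV ok Cr.
  by rewrite -mulnn leq_mul2r (subset_leq_card CV) orbT.
by rewrite -big_distrr /= -mulnn leq_mul2l (components_card ok) orbT.
Qed.

Lemma components_sqr_balanced V S r : components_ok V S r ->
  (forall C, C \in r.1 -> 1000 * #|C| <= 999 * #|V|)%N ->
  (1000 * \sum_(C <- r.1) #|C| ^ 2 <= 999 * #|V| ^ 2)%N.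
Proof.
move=> ok small; rewrite big_distrr /=.
apply: (@leq_trans (\sum_(C <- r.1) 999 * #|V| * #|C|)).
  rewrite big_seq [X in (_ <= X)%N]big_seq; apply: leq_sum => C /small h.
  by rewrite -mulnn mulnA leq_mul2r h orbT.
by rewrite -big_distrr /= -mulnn mulnA leq_mul2l (components_card ok) orbT.
Qed.

Lemma ComponentsE V S : Components R m kappa V S =
  bind (bind (sample_set R V m set0) (separator_from R kappa V S))
       (components_from R kappa V S).
Proof. by []. Qed.

Section Call.
Context (V S : vset) (w z D : nat).
Hypotheses (cV : is_component e S V) (Vm : (m < #|V|)%N).
Hypotheses (mw : (m + (#|S| + k.+1) < w)%N) (zS : (#|S| + k.+1 < z)%N).
Hypothesis dD : (maxn 1 (d * k.+1) <= D)%N.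

Let V0 : V != set0.
Proof. by rewrite -card_gt0; apply: component_neq0 cV. Qed.

Lemma runs_from_separator W S' : separator_spec e k V S W S' ->
  runs true (components_ok V S) (components_from R kappa V S S')
    (components_queries #|V| D z) (components_time kappa #|V| D z).
Proof.
case=> S'V S'k _; apply: runs_le (runs_components_from kappa e_sym deg gen cV S'V _ _)
  _ (leqnn _) (leqnn _).
- apply: leq_trans dD; rewrite geq_max leq_maxl /= leq_max.
  by rewrite leq_mul2l S'k !orbT.
- apply: leq_ltn_trans zS; apply: leq_trans (leq_card_setU _ _).1 _.
  by rewrite leq_add2l.
- by move=> r spec; have [E _ _] := spec; rewrite /components_ok E.
Qed.

Definition Components_queries := (separator_queries #|V| m w + components_queries #|V| D z)%N.
Definition Components_time :=
  (m + separator_time kappa #|V| m w + components_time kappa #|V| D z)%N.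

Lemma runs_separator_sample W : W \subset V -> (#|W| <= m)%N ->
  runs true (separator_spec e k V S W) (separator_from R kappa V S W)
    (separator_queries #|V| m w) (separator_time kappa #|V| m w).
Proof.
move=> WV Wm; have Ww : (#|W| + (#|S| + k.+1) < w)%N.
  by apply: leq_ltn_trans mw; rewrite leq_add2r.
apply: runs_le (runs_separator_from kappa e_sym tw gen cV WV Ww) _ _ _ => //.
  by rewrite leq_add2r leq_mul2r leq_exp2l // Wm orbT.
by rewrite leq_add // ?leq_add2r ?leq_mul2l ?leq_mul2r leq_exp2l // Wm ?orbT.
Qed.

Lemma runs_Components :
  runs true (components_ok V S) (Components R m kappa V S) Components_queries Components_time.
Proof.
rewrite ComponentsE; apply: (runs_bind (P := fun S' => exists W, separator_spec e k V S W S')).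
  apply: (runs_bind_le (runs_sample_set _ _ _ V0) (Q2 := separator_queries #|V| m w)
    (t2 := separator_time kappa #|V| m w)) => //.
  move=> W [WV Wm]; rewrite cards0 set0U add0n in WV Wm.
  by apply: runs_le (runs_separator_sample WV Wm) _ _ _ => // S' spec; exists W.
by move=> S' [W]; apply: runs_from_separator.
Qed.

Definition unbalanced : {set {ffun 'I_m -> 'I_n}} :=
  [set w : {ffun 'I_m -> 'I_n} in ffun_on V | (4 * #|sample_im w| < m)%N ||
     [exists C : {set 'I_n}, [&& C \subset V, conn (within e V) C,
        (#|nbhd (within e V) C| <= k.+1)%N, (1000 * #|V :\: C| <= #|V|)%N &
        (3 * #|C :&: sample_im w| <= 2 * #|sample_im w|)%N]]].

(** A component lies on one side of the partition, so it has at most two thirds of the distinct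
    sample points, and its boundary inside [V] lies in [S']. If it were too large, it would witness
    that the sample is in [unbalanced]. *)
Lemma balanced_components w' S' r : w' \in ffun_on V -> w' \notin unbalanced ->
  separator_spec e k V S (sample_im w') S' -> components_ok V S r -> r.2 = S' ->
  forall C, C \in r.1 -> (1000 * #|C| <= 999 * #|V|)%N.
Proof.
move=> wV; rewrite inE wV /= negb_or -leqNgt => /andP[many /existsPn noC].
case=> S'V S'k sepW ok rS' C Cr; have [_ _ [_ comps _]] := ok.
have [CV _ _] := component_sub cV ok Cr; have [v vV CE] := comps C Cr.
rewrite rS' in vV CE.
have W1 : (1 < #|sample_im w'|)%N by have := leq_trans m1000 many; move: #|_| => x; clear; lia.
have [A [AW A3 B3 sepA]] := sepW W1.
have C3 : (3 * #|C :&: sample_im w'| <= 2 * #|sample_im w'|)%N.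
  have sub : (C :&: sample_im w' \subset A) || (C :&: sample_im w' \subset sample_im w' :\: A).
    apply/orP; have [|/subsetPn[x /setIP[xC xW] xA]] := boolP (C :&: sample_im w' \subset A).
      by left.
    right; apply/subsetP => y /setIP[yC yW]; rewrite inE yW andbT; apply/negP => yA.
    have xB : x \in sample_im w' :\: A by rewrite inE xA.
    have vZ : v \notin S :|: S'.
      by case/setDP: vV => vV vS'; rewrite inE negb_or vS' (component_notin cV).
    have yZ : y \notin S :|: S' by move: yC; rewrite CE; apply: reach_notin.
    have /separatesP/(_ y x yA xB yZ)/negP := sepA; apply.
    by rewrite CE in xC yC; apply: reach_trans xC; rewrite reachC.
  case/orP: sub => /subset_leq_card sub.
    by apply: leq_trans A3; rewrite leq_mul2l sub.
  by apply: leq_trans B3; rewrite leq_mul2l sub.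
have cC : conn (within e V) C.
  apply: conn_within => //; rewrite CE; apply: (conn_reach e_sym).
  by case/setDP: vV => vV vS'; rewrite inE negb_or vS' (component_notin cV).
have nk : (#|nbhd (within e V) C| <= k.+1)%N.
  by rewrite CE; apply: leq_trans (subset_leq_card (nbhd_reach cV vV)) S'k.
have := noC C; rewrite CV cC nk C3 andbT /= -ltnNge cardsD (setIidPr CV).
by have := subset_leq_card CV; move: #|C| #|V| => x y; clear; lia.
Qed.

(** The sum of squares never increases and drops to 999/1000 with probability at least 1/6. In the
    recursion, [y] is the decay that the remaining fuel provides. *)
Lemma ev_Components_ge (Phi : seq vset * vset -> R) y : 0 <= y ->
  (forall r, components_ok V S r -> 1 - y * (\sum_(C <- r.1) #|C| ^ 2)%:R <= Phi r) ->
  1 - y * (#|V| ^ 2)%:R * (1 - 1000^-1 / 6) <= ev Phi (Components R m kappa V S).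
Proof.
move=> y0 hPhi; rewrite ComponentsE !ev_bind.
have V2 : 0 <= y * (#|V| ^ 2)%:R by rewrite mulr_ge0.
have Wspec (w' : {ffun 'I_m -> 'I_n}) : w' \in ffun_on V ->
    sample_im w' \subset V /\ (#|sample_im w'| <= m)%N.
  move=> /ffun_onP wV; split; first by apply/subsetP => x /imsetP[i _ ->].
  by apply: leq_trans (leq_imset_card _ _) _; rewrite card_ord.
apply: (@ev_sample_set_ge _ _ _ _ _ unbalanced) => //.
- by apply/subsetP => w'; rewrite inE => /andP[].
- by apply: (card_unbalanced e_sym) => //; rewrite m1000 ltnW.
- by rewrite invr_ge0 ler0n.
- move=> w' wV; have [WV Wm] := Wspec w' wV.
  apply: ev_safe (runs_separator_sample WV Wm) _; first by rewrite gerBl.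
  move=> S' spec; apply: ev_safe (runs_from_separator spec) _; first by rewrite gerBl.
  move=> r ok; apply: le_trans (hPhi r ok); rewrite lerB // ler_wpM2l // ler_nat.
  exact: components_sqr cV ok.
- move=> w' wV wB; have [WV Wm] := Wspec w' wV.
  have y1 : 1 - y * (#|V| ^ 2)%:R * (1 - 1000^-1) <= 1 :> R.
    by rewrite gerBl mulr_ge0 // subr_ge0 invf_le1 // ler1n.
  apply: (ev_safe y1 (runs_separator_sample WV Wm)) => S' spec.
  have S'V : S' \subset V by case: spec.
  have hrun : runs true (fun r => components_ok V S r /\ r.2 = S')
      (components_from R kappa V S S')
      (components_queries #|V| D z) (components_time kappa #|V| D z).
    case: (spec) => _ S'k _; apply: runs_le (runs_components_from kappa e_sym deg gen cV S'V _ _)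
      _ (leqnn _) (leqnn _).
    + apply: leq_trans dD; rewrite geq_max leq_maxl /= leq_max.
      by rewrite leq_mul2l S'k !orbT.
    + apply: leq_ltn_trans zS; apply: leq_trans (leq_card_setU _ _).1 _.
      by rewrite leq_add2l.
    + by move=> r sp; have [E _ _] := sp; rewrite /components_ok E.
  apply: (ev_safe y1 hrun) => r [ok rS']; apply: le_trans (hPhi r ok).
  rewrite lerB // -mulrA ler_wpM2l //.
  have := components_sqr_balanced ok (balanced_components wV wB spec ok rS').
  rewrite -(ler_nat R) !natrM; lra.
Qed.

End Call.
End Reconstruct.

(** * The recursion *)

Section Recursion.
Context (R : realType) (n : nat) (e : rel 'I_n) (Sigma : 'M[R]_n) (kappa k d m : nat).
Hypotheses (e_sym : symmetric e) (tw : (treewidth e <= k)%N).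
Hypotheses (deg : (max_degree e <= d)%N) (d_gt0 : (0 < d)%N) (gen : generic e Sigma).
Hypotheses (pd : posdef Sigma).
Hypothesis Theta0 : forall i j, i != j -> ~~ e i j -> invmx Sigma i j = 0.
Hypotheses (m1000 : (1000 <= m)%N) (m_big : (2800 * (82 * k.+1) <= m)%N).
Local Notation vset := {set 'I_n}.
Local Notation runs := (runs Sigma).
Local Notation ev := (ev Sigma).
Local Notation Theta := (invmx Sigma).
Implicit Types (A B C S V W : vset) (K : 'M[R]_n).

(** States of [Khat] are described by the set of entries that already agree with [Theta]. *)
Definition fill (P : 'I_n -> 'I_n -> bool) K : 'M[R]_n :=
  \matrix_(i, j) if P i j then Theta i j else K i j.

Definition filled V K := fill (fun i j => (i \in V) && (j \in V)) K.

Definition cross C S' i j := (i \in C) && (j \in S') || (i \in S') && (j \in C).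

Lemma Theta_component S C a b : is_component e S C -> a \in C -> b \notin C -> b \notin S ->
  Theta a b = 0.
Proof.
move=> cC aC bC bS; apply: Theta0; first by apply: contraNneq bC => <-.
by apply: contra bC => ab; apply: (component_edge e_sym cC aC).
Qed.

Definition step_rest S S' C (Tinv acc : 'M[R]_#|S'|) K0 : prog R n ('M[R]_n * 'M[R]_#|S'|) :=
  let* F := cond_block R kappa C S' S in
  let* P := sparse_mul_op n kappa (submx_of C C K0) F in
  let* Q := mul_op n kappa P Tinv in
  let* K1 := write_op kappa (- Q) K0 in
  let* K2 := write_op kappa ((- Q)^T) K1 in
  let* H := sparse_mul_op n kappa (submx_of S' C K2) F in
  Tick (kappa * (#|S'| * #|S'|))%N (Ret (K2, acc + H)).

(** * Arithmetic of the step for one component *)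

Section Costs.
Context (z D c s s' : nat).
Hypotheses (D0 : (0 < D)%N) (c0 : (0 < c)%N) (sz : (s <= z)%N) (s'z : (s' <= z)%N).
Hypotheses (z0 : (0 < z)%N) (dD : (d.+1 <= 2 * D)%N).

Lemma cond_cost : (c * s' + c * s + s * s + s * s' <= c * (4 * z ^ 2))%N.
Proof.
have zz : (z <= z ^ 2)%N by rewrite -mulnn leq_pmulr.
have h1 : (c * s' <= c * z ^ 2)%N by rewrite leq_mul2l (leq_trans s'z zz) orbT.
have h2 : (c * s <= c * z ^ 2)%N by rewrite leq_mul2l (leq_trans sz zz) orbT.
have h3 : (s * s <= c * z ^ 2)%N.
  by apply: leq_trans (leq_pmull _ c0); rewrite -mulnn leq_mul.
have h4 : (s * s' <= c * z ^ 2)%N.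
  by apply: leq_trans (leq_pmull _ c0); rewrite -mulnn leq_mul.
by move: h1 h2 h3 h4; rewrite mulnCA; move: (c * z ^ 2)%N; clear; lia.
Qed.

Lemma cond_time : (s ^ 3 + s * s * s' + c * s * s' + c * s' <= c * (4 * z ^ 3))%N.
Proof.
have z3 : (z ^ 3 = z * z * z)%N by rewrite !expnS expn0 muln1 mulnA.
have zzz : (z <= z ^ 3)%N by rewrite z3 leq_pmull // muln_gt0 z0.
have h1 : (s ^ 3 <= c * z ^ 3)%N.
  by apply: leq_trans (leq_pmull _ c0); rewrite leq_exp2r.
have h2 : (s * s * s' <= c * z ^ 3)%N.
  by apply: leq_trans (leq_pmull _ c0); rewrite z3 !leq_mul.
have h3 : (c * s * s' <= c * z ^ 3)%N.
  rewrite -mulnA leq_mul2l; apply/orP; right; apply: (@leq_trans (z * z)%N).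
    exact: leq_mul.
  by rewrite z3 leq_pmulr.
have h4 : (c * s' <= c * z ^ 3)%N by rewrite leq_mul2l (leq_trans s'z zzz) orbT.
by move: h1 h2 h3 h4; rewrite mulnCA; move: (c * z ^ 3)%N; clear; lia.
Qed.

(** In units of [c * (D * z ^ 3)] the charged operations are 4 for the conditional block, 2 for the
    first sparse product because [d.+1 <= 2 * D], and 5 for the remaining ones; hence 11. The factor
    [c] makes the costs summable over components. *)
Lemma step_time_le :
  (c * s' + c * s + s * s + s * s' +
     kappa * (s ^ 3 + s * s * s' + c * s * s' + c * s') +
   (kappa * (c * d.+1 * s') + (kappa * (c * s' * s') + (kappa * (c * s') +
   (kappa * (s' * c) + (kappa * (s' * c * s') + kappa * (s' * s')))))) <=
   c * (kappa.+1 * (11 * (D * z ^ 3))))%N.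
Proof.
have z3 : (z ^ 3 = z * z * z)%N by rewrite !expnS expn0 muln1 mulnA.
have zzz : (z <= z ^ 3)%N by rewrite z3 leq_pmull // muln_gt0 z0.
have zz3 : (z ^ 2 <= z ^ 3)%N by rewrite leq_pexp2l.
have z2 : (z ^ 2 = z * z)%N by rewrite -mulnn.
set X := (c * (D * z ^ 3))%N.
have cX : (c * z ^ 3 <= X)%N by rewrite leq_mul2l leq_pmull ?orbT.
have h1 := cond_cost; have h2 := cond_time.
have g1 : (c * (4 * z ^ 2) <= 4 * X)%N.
  by rewrite mulnCA leq_mul2l /=; apply: leq_trans cX; rewrite leq_mul2l zz3 orbT.
have g2 : (c * (4 * z ^ 3) <= 4 * X)%N by rewrite mulnCA leq_mul2l.
have g3 : (c * d.+1 * s' <= 2 * X)%N.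
  rewrite -mulnA /X [(2 * _)%N]mulnCA leq_mul2l; apply/orP; right; rewrite mulnA.
  by apply: leq_mul dD (leq_trans s'z zzz).
have g4 : (c * s' * s' <= X)%N.
  apply: leq_trans cX; rewrite -mulnA leq_mul2l; apply/orP; right.
  by apply: leq_trans zz3; rewrite z2 leq_mul.
have g5 : (c * s' <= X)%N.
  by apply: leq_trans cX; rewrite leq_mul2l (leq_trans s'z zzz) orbT.
have g6 : (s' * c * s' <= X)%N by rewrite (mulnC s').
have g7 : (s' * s' <= X)%N.
  by apply: leq_trans g4; rewrite -mulnA leq_pmull.
have g5' : (s' * c <= X)%N by rewrite mulnC.
have -> : (c * (kappa.+1 * (11 * (D * z ^ 3))) = 11 * X + kappa * (11 * X))%N.
  by rewrite /X; clear; lia.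
clear cX; clearbody X; move: h1 h2 g1 g2 g3 g4 g5 g5' g6 g7; move: X (c * (4 * z ^ 2))%N (c * (4 * z ^ 3))%N.
move: (c * s' + c * s + s * s + s * s')%N (s ^ 3 + s * s * s' + c * s * s' + c * s')%N.
move: (s' * c)%N (c * s')%N (s' * s')%N (s' * c * s')%N (c * s' * s')%N (c * d.+1 * s')%N.
clear=> a1 a2 a3 a4 a5 a6 q t X u v *; rewrite -addnA -!mulnDr; apply: leq_add; first lia.
by rewrite leq_mul2l; apply/orP; right; lia.
Qed.

End Costs.

(** The recursive call has returned the exact block of [Theta], so its nonzero entries follow the
    graph: here correctness of the output enters the time bound. *)
Lemma runs_step_rest S S' C (acc : 'M[R]_#|S'|) K0 z D : is_component e (S :|: S') C ->
  [disjoint C & S] -> [disjoint C & S'] -> [disjoint S & S'] ->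
  submx_of C C K0 = submx_of C C Theta ->
  (#|S :|: S'| <= z)%N -> (0 < z)%N -> (0 < D)%N -> (d.+1 <= 2 * D)%N ->
  runs true (fun st => st = (fill (cross C S') K0,
      acc + submx_of S' C Theta *m submx_of C S' (cond Sigma S)))
    (step_rest S C (invmx (submx_of S' S' (cond Sigma S))) acc K0)
    (#|C| * (4 * z ^ 2)) (#|C| * (kappa.+1 * (11 * (D * z ^ 3)))).
Proof.
move=> cC CS CS' SS' KC Zz z0 D0 dD; set Tinv := invmx (submx_of S' S' _).
have sz : (#|S| <= z)%N by apply: leq_trans Zz; rewrite subset_leq_card // subsetUl.
have s'z : (#|S'| <= z)%N by apply: leq_trans Zz; rewrite subset_leq_card // subsetUr.
have c0 := component_neq0 cC.
have QE : - (submx_of C C K0 *m submx_of C S' (cond Sigma S) *m Tinv) = submx_of C S' Theta.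
  rewrite KC (precision_cross pd CS CS' SS') // => a b aC bC bS' bS.
  by apply: (Theta_component cC) => //; rewrite inE negb_or bS.
have K2E K1 : K1 = set_block (submx_of C S' Theta) K0 ->
    set_block (submx_of C S' Theta)^T K1 = fill (cross C S') K0.
  move=> ->; rewrite trmx_submx_of (Theta_sym pd); apply/matrixP => i j.
  by rewrite !set_blockE mxE /cross orbC; case: (_ && _).
rewrite /step_rest.
apply: (runs_bind_le (runs_cond_block _ _ _ _ _) (Q2 := 0)
  (t2 := kappa * (#|C| * d.+1 * #|S'|) + (kappa * (#|C| * #|S'| * #|S'|) +
   (kappa * (#|C| * #|S'|) + (kappa * (#|S'| * #|C|) +
   (kappa * (#|S'| * #|C| * #|S'|) + kappa * (#|S'| * #|S'|))))))); last first.
- exact: step_time_le.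
- by rewrite addn0; apply: cond_cost.
move=> _ ->.
apply: (@runs_bind _ _ _ _ _ _ _ _ _ _ 0 0 _ _ (runs_sparse_mul_op _ _ _ _)).
  by rewrite KC; apply: leq_nnz_precision deg Theta0.
move=> _ ->; apply: (@runs_bind _ _ _ _ _ _ _ _ _ _ 0 0 _ _ (runs_mul_op _ _ _ _)) => _ ->.
apply: (@runs_bind _ _ _ _ _ _ _ _ _ _ 0 0 _ _ (runs_write_op _ _ _ _)) => _ ->.
apply: (@runs_bind _ _ _ _ _ _ _ _ _ _ 0 0 _ _ (runs_write_op _ _ _ _)) => _ ->.
apply: (@runs_bind _ _ _ _ _ _ _ _ _ _ 0 0 _ _ (runs_sparse_mul_op _ _ _ (leq_nnz _))).
move=> _ ->; apply: runs_tick_ret; rewrite QE K2E //; congr (_, _ + _ *m _).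
by apply/matrixP => i j; rewrite !mxE /cross !enum_valP orbT.
Qed.

Definition region S' (s : seq vset) i j :=
  has (fun C => (i \in C) && (j \in C) || cross C S' i j) s.

Definition finish_call S' (Tinv : 'M[R]_#|S'|) (st : 'M[R]_n * 'M[R]_#|S'|) : prog R n 'M[R]_n :=
  let* D := sub_op n kappa 1%:M st.2 in
  let* KS := mul_op n kappa D Tinv in
  write_op kappa KS st.1.

Definition call_rest f S K (r : seq vset * vset) : prog R n 'M[R]_n :=
  let* T := cond_block R kappa r.2 r.2 S in
  let* Tinv := inv_op n kappa T in
  let* st := foldM (fun (st : 'M[R]_n * 'M[R]_#|r.2|) C =>
      let* K0 := Reconstruct m kappa f C (S :|: r.2) st.1 in
      step_rest S C Tinv st.2 K0) (K, 0) r.1 in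
  finish_call Tinv st.

Definition base_call V S K : prog R n 'M[R]_n :=
  let* T := cond_block R kappa V V S in
  let* Tinv := inv_op n kappa T in
  write_op kappa Tinv K.

Lemma ReconstructE f V S K : Reconstruct m kappa f.+1 V S K =
  Tick 1 (if (m < #|V|)%N then bind (Components R m kappa V S) (call_rest f S K)
          else base_call V S K).
Proof.
apply: (congr1 (Tick 1)); case: ifP => // _.
apply: (congr1 (bind (Components R m kappa V S))); apply: funext => -[Cs S'].
apply: (congr1 (bind _)); apply: funext => T; apply: (congr1 (bind _)); apply: funext => Tinv.
by apply: (congr1 (bind _)); apply: funext => -[K1 acc].
Qed.

(** * Entries written by one call *)

Section Level.
Context (V S : vset) (K : 'M[R]_n).
Hypotheses (cV : is_component e S V) (KV : forall i j, i \in V -> j \in V -> K i j = 0).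

Lemma part_count r : components_ok e k V S r ->
  forall v, count (fun C : vset => v \in C) r.1 = (v \in V :\: r.2).
Proof.
move=> [_ _ [_ _ part]] v; rewrite -part -sum1_count big_mkcond.
by apply: eq_bigr => C _; case: (v \in C).
Qed.

Lemma part_disjoint r s1 C s2 : components_ok e k V S r -> r.1 = s1 ++ C :: s2 ->
  forall v C', v \in C -> C' \in s1 -> v \notin C'.
Proof.
move=> ok rE v C' vC C's1; apply/negP => vC'.
have := part_count ok v; rewrite rE count_cat /= vC.
have : (0 < count (fun C : vset => v \in C) s1)%N by rewrite -has_count; apply/hasP; exists C'.
by case: (v \in _ :\: _); move: (count _ _) (count _ _) => a b; clear; lia.
Qed.

Lemma fill_region r s1 C s2 K1 : components_ok e k V S r -> r.1 = s1 ++ C :: s2 ->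
  K1 = fill (region r.2 s1) K ->
  (forall i j, i \in C -> j \in C -> K1 i j = 0) /\
  fill (cross C r.2) (filled C K1) = fill (region r.2 (rcons s1 C)) K.
Proof.
move=> ok rE ->; have Cr : C \in r.1 by rewrite rE mem_cat inE eqxx orbT.
have [CV _ Cr2] := component_sub e_sym cV ok Cr.
split=> [i j iC jC|].
  rewrite mxE ifN ?KV ?(subsetP CV) //; apply/hasPn => C' C's1.
  have iC' := part_disjoint ok rE iC C's1; have jC' := part_disjoint ok rE jC C's1.
  by rewrite /cross (negPf iC') (negPf jC') !andbF.
apply/matrixP => i j; rewrite !mxE /region has_rcons -/(region _ _ _ _).
by case: (cross _ _ _ _); case: (_ && _); rewrite /= ?orbT ?orbF.
Qed.

(** Entries between different components are never written; they keep the initial value 0, which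
    [Theta] has there as well. *)
Lemma fill_final r : components_ok e k V S r ->
  set_block (submx_of r.2 r.2 Theta) (fill (region r.2 r.1) K) = filled V K.
Proof.
move=> ok; have [S'V _ [_ comps _]] := ok; apply/matrixP => i j.
rewrite set_blockE [RHS]mxE mxE.
have inC v : v \in V -> v \notin r.2 -> exists2 C, C \in r.1 & v \in C.
  move=> vV vS'; apply/hasP; rewrite has_count part_count //.
  by rewrite inE vS' vV.
have [/andP[iS jS]|nS] := boolP ((i \in r.2) && (j \in r.2)).
  by rewrite !(subsetP S'V).
have [/hasP[C Cr ij]|/hasPn nR] := boolP (region _ _ _ _).
  have [/subsetP CV _ _] := component_sub e_sym cV ok Cr.
  have VS' := subsetP S'V; suff -> : (i \in V) && (j \in V) by [].
  by case/or3P: ij => /andP[h1 h2]; rewrite ?(CV _ h1) ?(CV _ h2) ?(VS' _ h1) ?(VS' _ h2).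
case: ifP => // /andP[iV jV]; rewrite KV //.
have [iS|iS] := boolP (i \in r.2).
  move: nS; rewrite iS /= => jS; have [C Cr jC] := inC _ jV jS.
  by have := nR C Cr; rewrite /cross iS jC !orbT.
have [C Cr iC] := inC _ iV iS; have := nR C Cr; rewrite /cross iC (negPf iS) /= orbF negb_or.
case/andP=> jC jS; have [_ cC _] := component_sub e_sym cV ok Cr.
by rewrite (Theta_component cC iC jC) // inE negb_or (component_notin cV jV).
Qed.

Lemma runs_finish_call r : components_ok e k V S r ->
  runs true (fun K' => K' = filled V K)
    (finish_call (invmx (submx_of r.2 r.2 (cond Sigma S)))
       (fill (region r.2 r.1) K,
        \sum_(C <- r.1) submx_of r.2 C Theta *m submx_of C r.2 (cond Sigma S)))
    0 (kappa * (#|r.2| * #|r.2|) + (kappa * (#|r.2| * #|r.2| * #|r.2|) +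
       kappa * (#|r.2| * #|r.2|))).
Proof.
move=> ok; have [S'V _ [_ _ part]] := ok.
apply: (@runs_bind _ _ _ _ _ _ _ _ _ _ 0 0 _ _ (runs_sub_op _ _ _ _)) => _ ->.
apply: (@runs_bind _ _ _ _ _ _ _ _ _ _ 0 0 _ _ (runs_mul_op _ _ _ _)) => _ ->.
apply: runs_le (runs_write_op _ _ _ _) _ (leqnn _) (leqnn _) => _ ->.
rewrite -(precision_separator pd (V := V)) ?fill_final //.
- by rewrite disjoint_sym (component_disjoint cV).
- move=> a b aS bV bS; apply: (Theta_component cV) => //; exact: (subsetP S'V).
Qed.

End Level.
Lemma block_cost a b c z : (a <= z -> b <= z -> c <= z ->
  a * b + a * c + c * c + c * b <= 4 * z ^ 2)%N.
Proof.
move=> az bz cz; have h x y : (x <= z -> y <= z -> x * y <= z ^ 2)%N.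
  by move=> xz yz; rewrite -mulnn leq_mul.
have := h _ _ az bz; have := h _ _ az cz; have := h _ _ cz cz; have := h _ _ cz bz.
by move: (z ^ 2)%N; clear; lia.
Qed.

Lemma block_time a b c z : (a <= z -> b <= z -> c <= z -> 0 < z ->
  c ^ 3 + c * c * b + a * c * b + a * b <= 4 * z ^ 3)%N.
Proof.
move=> az bz cz z0; have z3 : (z ^ 3 = z * z * z)%N by rewrite !expnS expn0 muln1 mulnA.
have h x y t : (x <= z -> y <= z -> t <= z -> x * y * t <= z ^ 3)%N.
  by move=> *; rewrite z3 !leq_mul.
have h3 : (c ^ 3 <= z ^ 3)%N by rewrite leq_exp2r.
have ab : (a * b <= z ^ 3)%N.
  by apply: (@leq_trans (z * z)%N); [apply: leq_mul | rewrite z3 leq_pmulr].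
have := h _ _ _ cz cz bz; have := h _ _ _ az cz bz; move: h3 ab.
by move: (z ^ 3)%N; clear; lia.
Qed.

Definition balance_rate : R := 1 - 1000^-1 / 6.

(** * Induction on the fuel *)

Section Budget.
Context (sb : nat).
Let w := (m + sb).+1.
Let z := sb.+1.
Let D := (d * k.+1)%N.

(** Allowance per vertex and level: a call pays [#|V|] times it, so the disjoint sets of a level pay
    at most as much as their union. Matrices of the separator search have size at most [w], those of
    the other steps of a splitting call at most [z]. *)
Definition query_budget := ((2 ^ m + 3) * w ^ 2 + 9 * (D * z ^ 2))%N.
Definition time_budget := (kappa.+1 * (12 * (2 ^ m * w ^ 3) + 25 * (D * z ^ 3)))%N.

Let D0 : (0 < D)%N. Proof. by rewrite muln_gt0 d_gt0. Qed.
Let dD : (d.+1 <= 2 * D)%N.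
Proof.
rewrite mul2n -addnn -addn1; apply: leq_add; rewrite /D; first by rewrite leq_pmulr.
by rewrite muln_gt0 d_gt0.
Qed.

(** The flag is [false] since fuel may run out; the potential bounds the probability of that. *)
Definition Reconstruct_ok f V S K :=
  runs false (fun K' => K' = filled V K) (Reconstruct m kappa f V S K)
    (f * (#|V| * query_budget)) (f * (#|V| * time_budget)) /\
  1 - (#|V| ^ 2)%:R * balance_rate ^+ f <= ev (fun=> 1) (Reconstruct m kappa f V S K).

Lemma balance_rate_bounds : 0 <= balance_rate <= 1.
Proof. by rewrite /balance_rate; apply/andP; split; lra. Qed.

Section Rest.
Context (f : nat) (V S : vset) (K : 'M[R]_n) (r : seq vset * vset).
Hypotheses (cV : is_component e S V) (KV : forall i j, i \in V -> j \in V -> K i j = 0).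
Hypothesis Ssb : (#|S| + f.+1 * k.+1 <= sb)%N.
Hypothesis IH : forall V' S' K', is_component e S' V' ->
  (forall i j, i \in V' -> j \in V' -> K' i j = 0) -> (#|S'| + f * k.+1 <= sb)%N ->
  Reconstruct_ok f V' S' K'.
Hypothesis ok : components_ok e k V S r.

Let S'k : (#|r.2| <= k.+1)%N. Proof. by case: ok. Qed.
Let SS'sb : (#|S :|: r.2| + f * k.+1 <= sb)%N.
Proof.
apply: leq_trans Ssb; rewrite mulSn addnA leq_add2r.
by apply: leq_trans (leq_card_setU _ _).1 _; rewrite leq_add2l.
Qed.

Let Zz : (#|S :|: r.2| <= z)%N.
Proof. by apply: leqW; apply: leq_trans SS'sb; apply: leq_addr. Qed.

Let sz : (#|S| <= z)%N.
Proof. by apply: leq_trans Zz; rewrite subset_leq_card // subsetUl. Qed.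

Let s'z : (#|r.2| <= z)%N.
Proof. by apply: leq_trans Zz; rewrite subset_leq_card // subsetUr. Qed.

Let Tinv := invmx (submx_of r.2 r.2 (cond Sigma S)).

Let step (st : 'M[R]_n * 'M[R]_#|r.2|) C :=
  let* K0 := Reconstruct m kappa f C (S :|: r.2) st.1 in step_rest S C Tinv st.2 K0.

Let inv (s1 : seq vset) (st : 'M[R]_n * 'M[R]_#|r.2|) :=
  st = (fill (region r.2 s1) K,
        \sum_(C <- s1) submx_of r.2 C Theta *m submx_of C r.2 (cond Sigma S)).

Lemma step_ok s1 C s2 st : r.1 = s1 ++ C :: s2 -> inv s1 st ->
  runs false (inv (rcons s1 C)) (step st C)
    (f * (#|C| * query_budget) + #|C| * (4 * z ^ 2))
    (f * (#|C| * time_budget) + #|C| * (kappa.+1 * (11 * (D * z ^ 3)))) /\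
  1 - (#|C| ^ 2)%:R * balance_rate ^+ f <= ev (fun=> 1) (step st C).
Proof.
move=> rE ->; have Cr : C \in r.1 by rewrite rE mem_cat inE eqxx orbT.
have [CV cC CS'] := component_sub e_sym cV ok Cr.
have [K0 KE] := fill_region cV KV ok rE (erefl _).
have SV : [disjoint S & V] := component_disjoint cV.
have [S'V _ _] := ok.
have [hr he] := IH cC K0 SS'sb.
have hrest K1 : K1 = filled C (fill (region r.2 s1) K) ->
    runs true (inv (rcons s1 C))
      (step_rest S C Tinv (\sum_(C <- s1) submx_of r.2 C Theta *m submx_of C r.2 (cond Sigma S)) K1)
      (#|C| * (4 * z ^ 2)) (#|C| * (kappa.+1 * (11 * (D * z ^ 3)))).
  move=> K1E; apply: runs_le (runs_step_rest _ cC _ CS' _ _ Zz _ D0 dD) _ (leqnn _) (leqnn _) => //.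
  - by rewrite disjoint_sym; apply: disjointWr SV.
  - by apply: disjointWr SV.
  - by apply/matrixP => i j; rewrite K1E !mxE !enum_valP.
  - by move=> st' ->; rewrite /inv -KE K1E -cats1 big_cat big_seq1.
split.
  apply: runs_bind hr _ => K1 K1E.
  by apply: runs_mono (hrest K1 K1E) _ _ _ _.
have := @ev_bind_ge _ _ Sigma _ _ _ _ _ (step_rest S C Tinv
  (\sum_(C <- s1) submx_of r.2 C Theta *m submx_of C r.2 (cond Sigma S))) _ _ 0 (lexx 0) hr.
rewrite subr0 => h; apply: le_trans he _; rewrite -[X in X <= _]subr0; apply: h => K1 K1E.
exact: ev_runs_true (hrest K1 K1E).
Qed.

Let inv0 : inv [::] (K, 0).
Proof. by rewrite /inv big_nil; congr pair; apply/matrixP => i j; rewrite mxE. Qed.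

Let rest_cond := runs_cond_block Sigma kappa r.2 r.2 S.

(** The constant 8 is 4 + 4 queries for the separator block and the components; 23 is 11 for the
    components, 4 + 4 for queries and arithmetic of the separator block, 1 for its inverse and 3 for
    the last block. *)
Lemma runs_call_rest : (0 < #|V|)%N ->
  runs false (fun K' => K' = filled V K) (call_rest f S K r)
    (f * (#|V| * query_budget) + #|V| * (8 * z ^ 2))
    (f * (#|V| * time_budget) + #|V| * (kappa.+1 * (23 * (D * z ^ 3)))).
Proof.
move=> V0; have sumC := components_card ok.
have z0 : (0 < z)%N by [].
apply: (runs_bind_le (runs_mono rest_cond _ _ (leqnn _) (leqnn _)) (P := fun T => T = submx_of r.2 r.2 (cond Sigma S))
  (Q2 := f * (#|V| * query_budget) + #|V| * (4 * z ^ 2))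
  (t2 := kappa * #|r.2| ^ 3 + (f * (#|V| * time_budget) + #|V| * (kappa.+1 * (11 * (D * z ^ 3))) +
         (kappa * (#|r.2| * #|r.2|) + (kappa * (#|r.2| * #|r.2| * #|r.2|) +
          kappa * (#|r.2| * #|r.2|)))))) => //.
- move=> _ ->.
  apply: (runs_bind_le (runs_mono (runs_inv_op _ _ _) _ _ (leqnn _) (leqnn _)) (P := fun T => T = Tinv)
    (Q2 := f * (#|V| * query_budget) + #|V| * (4 * z ^ 2))
    (t2 := f * (#|V| * time_budget) + #|V| * (kappa.+1 * (11 * (D * z ^ 3))) +
         (kappa * (#|r.2| * #|r.2|) + (kappa * (#|r.2| * #|r.2| * #|r.2|) +
          kappa * (#|r.2| * #|r.2|))))) => //.
  move=> _ ->.
  apply: (runs_bind_le (P := inv r.1) (Q2 := 0)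
    (Q1 := f * (#|V| * query_budget) + #|V| * (4 * z ^ 2))
    (t1 := f * (#|V| * time_budget) + #|V| * (kappa.+1 * (11 * (D * z ^ 3))))
    (t2 := kappa * (#|r.2| * #|r.2|) + (kappa * (#|r.2| * #|r.2| * #|r.2|) +
          kappa * (#|r.2| * #|r.2|)))) => //.
  + have := @runs_foldM _ _ Sigma _ _ false inv step (K, 0) r.1 _ _ inv0
       (fun s1 C s2 st h1 h2 => (step_ok h1 h2).1).
    move/runs_le; apply=> //; rewrite big_split /=.
      rewrite -big_distrr -!big_distrl /=.
      by apply: leq_add; rewrite ?leq_mul2l ?leq_mul2r sumC ?orbT.
    rewrite -big_distrr -!big_distrl /=.
    by apply: leq_add; rewrite ?leq_mul2l ?leq_mul2r sumC ?orbT.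
  + move=> st ->; apply: runs_mono (runs_finish_call cV KV ok) _ _ _ _ => //.
  + by rewrite addn0.
- apply: leq_trans (leq_add (block_cost s'z s'z sz) (leqnn _)) _.
  rewrite addnCA leq_add2l; have := leq_pmull (4 * z ^ 2) V0.
  by move: (z ^ 2)%N (#|V|) => x v; clear; lia.
- have hb := block_cost s'z s'z sz; have ht := block_time s'z s'z sz z0.
  have zz : (z ^ 2 <= z ^ 3)%N by rewrite leq_pexp2l.
  have r3 : (#|r.2| ^ 3 <= z ^ 3)%N by rewrite leq_exp2r.
  have r2 : (#|r.2| * #|r.2| <= z ^ 3)%N by apply: leq_trans zz; rewrite -mulnn leq_mul.
  have r33 : (#|r.2| * #|r.2| * #|r.2| <= z ^ 3)%N.
    by rewrite !expnS expn0 muln1 mulnA !leq_mul.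
  have X0 : (z ^ 3 <= #|V| * (D * z ^ 3))%N.
    by rewrite mulnA leq_pmull // muln_gt0 V0.
  move: hb ht zz r3 r2 r33 X0.
  rewrite !(mulnCA #|V|); move: (#|V| * (D * z ^ 3))%N (f * (#|V| * time_budget))%N => X F.
  move: (_ + _ + _ + _)%N (_ + _ + _ + _)%N => c1 c2.
  move: (_ * _ * _)%N (_ * _)%N (_ ^ 3)%N (_ ^ 3)%N (_ ^ 2)%N => a1 a2 a3 a4 a5.
  clear; nia.
Qed.

Lemma ev_call_rest :
  1 - balance_rate ^+ f * (\sum_(C <- r.1) #|C| ^ 2)%:R <= ev (fun=> 1) (call_rest f S K r).
Proof.
have [b0 b1] := andP balance_rate_bounds.
have bf : 0 <= balance_rate ^+ f by apply: exprn_ge0.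
have y1 : 1 - balance_rate ^+ f * (\sum_(C <- r.1) #|C| ^ 2)%:R <= 1.
  by rewrite gerBl mulr_ge0.
apply: (ev_bind_safe y1 rest_cond) => _ ->.
apply: (ev_bind_safe y1 (runs_inv_op _ _ _)) => _ ->.
have hf : 1 - balance_rate ^+ f * (\sum_(C <- r.1) #|C| ^ 2)%:R <=
    ev (fun=> 1) (foldM step (K, 0) r.1).
  have := @ev_foldM_ge _ _ Sigma _ _ false inv step (K, 0) r.1 _ _
    (fun C => (#|C| ^ 2)%:R * balance_rate ^+ f) _ inv0 (fun s1 C s2 st h1 h2 => step_ok h1 h2).
  rewrite -big_distrl /= -natr_sum mulrC; apply=> C.
  by rewrite mulr_ge0.
have hr := @runs_foldM _ _ Sigma _ _ false inv step (K, 0) r.1 _ _ inv0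
       (fun s1 C s2 st h1 h2 => (step_ok h1 h2).1).
have := @ev_bind_ge _ _ Sigma _ _ _ _ _ (finish_call Tinv) _ _ 0 (lexx 0) hr.
rewrite subr0 => h; apply: le_trans hf _; rewrite -[X in X <= _]subr0; apply: h => st ->.
exact: ev_runs_true (runs_finish_call cV KV ok).
Qed.

End Rest.

Lemma call_queries_le V : (0 < #|V|)%N ->
  (Components_queries m V w z D + #|V| * (8 * z ^ 2) <= #|V| * query_budget)%N.
Proof.
move=> V0; rewrite /Components_queries /separator_queries /ABSeparator_queries.
rewrite /components_queries /query_budget.
have Dz : (#|V| * z ^ 2 <= #|V| * (D * z ^ 2))%N.
  by rewrite leq_mul2l leq_pmull ?orbT.
have h1 : (2 ^ m * w ^ 2 <= #|V| * (2 ^ m * w ^ 2))%N by rewrite leq_pmull.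
have h2 : (w ^ 2 <= #|V| * w ^ 2)%N by rewrite leq_pmull.
rewrite mulnDr mulnDl mulnDr !(mulnCA #|V|) in h1 *.
move: Dz h1 h2; rewrite !(mulnCA #|V|).
move: (2 ^ m * (#|V| * w ^ 2))%N (D * (#|V| * z ^ 2))%N (#|V| * w ^ 2)%N (#|V| * z ^ 2)%N.
move: (2 ^ m * w ^ 2)%N (w ^ 2)%N => a b c1 c2 c3 c4; clear; lia.
Qed.

Lemma rank_time_le x : (0 < x)%N -> ((rank_time kappa x).+1 <= 2 * (kappa.+1 * x ^ 3))%N.
Proof.
move=> x0; have h : (x ^ 2 <= x ^ 3)%N by rewrite leq_pexp2l.
have h1 : (0 < x ^ 3)%N by rewrite expn_gt0 x0.
rewrite /rank_time; move: (x ^ 2)%N (x ^ 3)%N h h1 => a b; clear; nia.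
Qed.

(** Six terms of at most [2 * X] each ([e1] to [e4], and [e5] twice) account for 12; 25 is 2 for the
    component tests plus 23. *)
Lemma call_time_le V : (0 < #|V|)%N ->
  (1 + (Components_time kappa m V w z D + #|V| * (kappa.+1 * (23 * (D * z ^ 3)))) <=
   #|V| * time_budget)%N.
Proof.
move=> V0; rewrite /Components_time /separator_time /ABSeparator_time /components_time.
rewrite /time_budget.
have w0 : (0 < w)%N by []. have z0 : (0 < z)%N by [].
have := rank_time_le w0; have := rank_time_le z0.
have mw3 : (m <= w ^ 3)%N.
  have : (m <= w)%N by apply: leqW; apply: leq_addr.
  by move/leq_trans; apply; rewrite -{1}(expn1 w) leq_pexp2l.
have p0 : (0 < 2 ^ m)%N by rewrite expn_gt0.
have w3 : (0 < w ^ 3)%N by rewrite expn_gt0.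
move: (rank_time kappa w) (rank_time kappa z) mw3 p0 w3 => a b.
move: (2 ^ m)%N (w ^ 3)%N (z ^ 3)%N (#|V|) V0 => p x y v v0 mx p0 x0 hb ha.
set X := (v * (kappa.+1 * (p * x)))%N.
have A1 : (v * (p * (kappa.+1 * x)) = X)%N by rewrite /X; clear; lia.
have kx : (kappa.+1 * x <= X)%N.
  by rewrite /X [(v * _)%N]mulnCA leq_mul2l mulnA leq_pmull ?orbT // muln_gt0 v0.
have e1 : (1 + m <= 2 * X)%N.
  have xk : (x <= kappa.+1 * x)%N by rewrite leq_pmull.
  have ar q y' : (q <= y' -> x <= q -> m <= x -> 0 < x -> 1 + m <= 2 * y')%N by clear; lia.
  exact: ar kx xk mx x0.
have pX : (p * (kappa.+1 * x) <= X)%N by rewrite -A1 leq_pmull.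
have e2 : (2 * p <= 2 * X)%N.
  rewrite leq_mul2l /=; apply: leq_trans pX; rewrite leq_pmulr // muln_gt0 x0 //.
have e3 : (p * a.+1 <= 2 * X)%N.
  apply: (@leq_trans (p * (2 * (kappa.+1 * x)))); first by rewrite leq_mul2l ha orbT.
  by rewrite mulnCA leq_mul2l.
have e4 : (a.+1 <= 2 * X)%N by apply: leq_trans ha _; rewrite leq_mul2l.
have e5 : (v * a.+1 <= 2 * X)%N.
  apply: (@leq_trans (v * (2 * (kappa.+1 * x)))); first by rewrite leq_mul2l ha orbT.
  rewrite mulnCA leq_mul2l /= leq_mul2l; apply/orP; right.
  by rewrite leq_mul2l leq_pmull ?orbT.
have e6 : (v * (D * b.+1) <= 2 * (v * (kappa.+1 * (D * y))))%N.
  apply: (@leq_trans (v * (D * (2 * (kappa.+1 * y))))).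
    by rewrite leq_mul2l leq_mul2l hb !orbT.
  by clear; lia.
have -> : (v * (kappa.+1 * (12 * (p * x) + 25 * (D * y))) =
    12 * X + 25 * (v * (kappa.+1 * (D * y))))%N by rewrite /X; clear; lia.
have -> : (v * (kappa.+1 * (23 * (D * y))) = 23 * (v * (kappa.+1 * (D * y))))%N.
  by clear; lia.
clear A1 kx pX; clearbody X; move: e1 e2 e3 e4 e5 e6; move: (p * a.+1)%N (v * a.+1)%N (v * (D * b.+1))%N.
by move: (v * (kappa.+1 * (D * y)))%N; clear; lia.
Qed.

(** [S] gains at most [k.+1] vertices per level, so [sb] bounds it at all remaining levels and one
    budget serves them all. Without fuel the probability bound is vacuous because [#|V|] is
    positive, and a call with at most [m] vertices always halts. *)
Lemma Reconstruct_correct f V S K : is_component e S V ->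
  (forall i j, i \in V -> j \in V -> K i j = 0) -> (#|S| + f * k.+1 <= sb)%N ->
  Reconstruct_ok f V S K.
Proof.
elim: f V S K => [|f IH] V S K cV KV Ssb.
  have V0 := component_neq0 cV; split=> //=.
  by rewrite expr0 mulr1 subr_le0 ler1n expn_gt0 V0.
have V0 := component_neq0 cV; have [b0 b1] := andP balance_rate_bounds.
have Sk : (#|S| + k.+1 <= sb)%N.
  by apply: leq_trans Ssb; rewrite leq_add2l mulSn leq_addr.
rewrite /Reconstruct_ok ReconstructE; case: ifP => Vm.
  have mw : (m + (#|S| + k.+1) < w)%N by rewrite ltnS leq_add2l.
  have zS : (#|S| + k.+1 < z)%N by rewrite ltnS.
  have D1 : (maxn 1 (d * k.+1) <= D)%N by rewrite geq_max D0 leqnn.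
  have rC := runs_Components kappa e_sym tw deg gen cV mw zS D1.
  split.
    have hr r : components_ok e k V S r -> runs false (fun K' => K' = filled V K)
        (call_rest f S K r) (f * (#|V| * query_budget) + #|V| * (8 * z ^ 2))
        (f * (#|V| * time_budget) + #|V| * (kappa.+1 * (23 * (D * z ^ 3)))).
      by move=> ok; apply: runs_call_rest.
    have rC' := runs_mono (b' := false) rC (fun=> isT) (fun x h => h) (leqnn _) (leqnn _).
    apply: runs_le (runs_tick 1 (runs_bind rC' hr)) _ _ _ => //.
      by rewrite addnCA mulSn [X in (_ <= X)%N]addnC leq_add2l call_queries_le.
    rewrite [X in (1 + X)%N]addnCA addnCA mulSn [X in (_ <= X)%N]addnC leq_add2l.
    exact: call_time_le.
  rewrite exprSr mulrA [X in 1 - X * _]mulrC.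
  change (1 - balance_rate ^+ f * (#|V| ^ 2)%:R * balance_rate <=
    ev (fun=> 1) (bind (Components R m kappa V S) (call_rest f S K))); rewrite ev_bind.
  apply: (ev_Components_ge kappa e_sym tw deg gen m1000 m_big cV Vm mw zS D1); first exact: exprn_ge0.
  by move=> r ok; apply: (ev_call_rest cV KV Ssb IH ok).
have {}Vm : (#|V| <= m)%N by rewrite leqNgt Vm.
have VS : [disjoint V & S] by rewrite disjoint_sym (component_disjoint cV).
have Vw : (#|V| <= w)%N by apply: leqW; apply: leq_trans Vm (leq_addr _ _).
have Sw : (#|S| <= w)%N.
  apply: leqW; apply: leq_trans (leq_addl _ _); apply: leq_trans Sk; apply: leq_addr.
have w0 : (0 < w)%N by [].
have rB : runs true (fun K' => K' = filled V K) (base_call V S K)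
    (4 * w ^ 2) (4 * w ^ 2 + kappa * (6 * w ^ 3)).
  apply: (runs_bind_le (runs_cond_block _ _ _ _ _) (Q2 := 0)
     (t2 := kappa * #|V| ^ 3 + kappa * (#|V| * #|V|))); last first.
  - have hb := block_cost Vw Vw Sw; have ht := block_time Vw Vw Sw w0.
    have v3 : (#|V| ^ 3 <= w ^ 3)%N by rewrite leq_exp2r.
    have v2 : (#|V| * #|V| <= w ^ 3)%N.
      by apply: (@leq_trans (w ^ 2)); [rewrite -mulnn leq_mul | rewrite leq_pexp2l].
    rewrite -[X in (X <= _)%N]addnA -!(mulnDr kappa); apply: leq_add hb _.
    rewrite leq_mul2l; apply/orP; right.
    by move: ht v3 v2; move: (w ^ 3)%N; clear; lia.
  - by rewrite addn0 block_cost.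
  move=> _ ->; apply: (@runs_bind _ _ _ _ _ _ _ _ _ _ 0 0 _ _ (runs_inv_op _ _ _)) => _ ->.
  apply: runs_le (runs_write_op _ _ _ _) _ (leqnn _) (leqnn _) => _ ->.
  rewrite precision_block //; last by move=> a b aV bV bS; apply: (Theta_component cV).
  by apply/matrixP => i j; rewrite set_blockE !mxE.
have w2 : (w ^ 2 <= w ^ 3)%N by rewrite leq_pexp2l.
have p0 : (0 < 2 ^ m)%N by rewrite expn_gt0.
have w3 : (0 < w ^ 3)%N by rewrite expn_gt0.
split.
  apply: runs_le (runs_tick 1 (runs_mono (b' := false) rB (fun=> isT) (fun x h => h) (leqnn _) (leqnn _))) _ _ _ => //.
    apply: leq_trans (leq_pmull _ (ltn0Sn f)); apply: leq_trans (leq_pmull _ V0).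
    rewrite /query_budget; apply: leq_trans (leq_addr _ _).
    by rewrite leq_mul2r -(leq_add2r 3) in p0 *; rewrite p0 orbT.
  apply: leq_trans (leq_pmull _ (ltn0Sn f)); apply: leq_trans (leq_pmull _ V0).
  rewrite /time_budget mulnDr; apply: leq_trans (leq_addr _ _).
  have : (w ^ 3 <= 2 ^ m * w ^ 3)%N by rewrite leq_pmull.
  move: w2 w3; move: (2 ^ m * w ^ 3)%N (w ^ 3)%N (w ^ 2)%N => a b c; clear; nia.
apply: le_trans (ev_runs_true rB).
by rewrite gerBl mulr_ge0 // exprn_ge0.
Qed.

End Budget.
End Recursion.

(** * Asymptotic bounds *)

Section Graph.
Context (T : finType) (e : rel T).

Lemma connected_edge : connected_graph e -> (1 < #|T|)%N -> exists u v, u != v /\ e u v.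
Proof.
move=> ce /card_gt1P[x [y [_ _ xy]]].
have := ce x y; case/connectP => p; elim: p x xy => [|z p IH] x xy /=.
  by move=> _ yx; rewrite yx eqxx in xy.
case/andP=> xz zp yz; have [zx|] := eqVneq x z; last by move=> nz; exists x, z.
by apply: IH zp yz; rewrite -zx.
Qed.

Lemma treewidth_gt0 k : connected_graph e -> (1 < #|T|)%N -> (treewidth e <= k)%N ->
  (0 < k)%N.
Proof.
move=> ce T1 /small_bags[D bk]; have [u [v [uv euv]]] := connected_edge ce T1.
have [x /andP[ux vx]] := td_cover D euv.
have : (1 < #|td_bag (t:=D) x|)%N by apply/card_gt1P; exists u, v.
by move/leq_trans/(_ (bk x)).
Qed.

Lemma max_degree_gt0 : connected_graph e -> (1 < #|T|)%N -> (0 < max_degree e)%N.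
Proof.
move=> ce T1; have [u [v [_ euv]]] := connected_edge ce T1.
apply: leq_trans (leq_bigmax (F := fun x => #|[set y | e x y]|%N) u).
by apply/card_gt0P; exists v; rewrite inE.
Qed.

Lemma connected_component : connected_graph e -> (0 < #|T|)%N ->
  is_component e set0 [set: T].
Proof.
move=> ce /card_gt0P[v _]; exists v; first by rewrite inE.
apply/setP => y; rewrite !inE; apply/esym; apply: sub_connect_from (ce v y) => a b _ ab.
by rewrite /within /= ab !inE.
Qed.

End Graph.

(** * Numerical estimates *)

Section Reals.
Context (R : realType).
Implicit Types (delta tau rho mu r x : R).

Lemma ln2_ge : 2^-1 <= ln 2 :> R.
Proof.
have h : 2^-1 <= expR (- 2^-1) :> R by apply: le_trans (expR_ge1Dx _); lra.
have : ln (2^-1) <= ln (expR (- 2^-1)) :> R by rewrite ler_ln ?posrE ?expR_gt0 // invr_gt0.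
by rewrite expRK lnV ?posrE //; lra.
Qed.

Lemma ln_nat_ge n : (1 < n)%N -> 2^-1 <= ln n%:R :> R.
Proof.
move=> n1; apply: le_trans ln2_ge _; rewrite ler_ln ?posrE ?ltr0n ?ler_nat //.
exact: ltnW.
Qed.

(** From 1/delta^2 >= 576 follows 8r/delta^2 >= 2^15, whose logarithm is at least 15/2; so m >=
    475200 k, while 229600 (k + 1) <= 459200 k. *)
Lemma sample_size_ge k m delta tau r : (0 < k)%N -> 0 < delta -> delta <= 24^-1 ->
  11 * k%:R <= r -> sample_bound r delta tau <= m%:R ->
  (1000 <= m)%N /\ (2800 * (82 * k.+1) <= m)%N.
Proof.
move=> k0 d0 d24 kr sm.
have k1 : 1 <= k%:R :> R by rewrite ler1n.
have d2 : 576 <= (delta ^+ 2)^-1.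
  rewrite -[576]invrK lef_pV2 ?posrE ?exprn_gt0 ?invr_gt0 //.
  have -> : 576^-1 = 24^-1 ^+ 2 :> R by rewrite exprVn; congr (_^-1); ring.
  by rewrite ler_pXn2r ?nnegrE // ltW // invr_gt0.
have : 10 * r / delta ^+ 2 * ln (8 * r / delta ^+ 2) <= m%:R.
  by apply: le_trans sm; rewrite le_max lexx.
have r0 : 0 <= r by apply: le_trans kr; rewrite mulr_ge0 ?ler0n.
have lx : 15 / 2 <= ln (8 * r / delta ^+ 2).
  have h : 2 ^+ 15 <= 8 * r / delta ^+ 2.
    have -> : 2 ^+ 15 = 8 * 8 * 512 :> R by ring.
    by apply: ler_pM => //; lra.
  apply: (@le_trans _ _ (ln (2 ^+ 15))).
    by rewrite lnXn // -mulr_natl; have := ln2_ge; lra.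
  by rewrite ler_ln ?posrE ?exprn_gt0 //; apply: lt_le_trans h; rewrite exprn_gt0.
have hk : 10 * (11 * k%:R) * 576 * (15 / 2) <= 10 * r / delta ^+ 2 * ln (8 * r / delta ^+ 2).
  apply: ler_pM lx => //; [by rewrite !mulr_ge0 | by rewrite divr_ge0 |].
  by apply: ler_pM => //; [rewrite !mulr_ge0 | rewrite ler_pM2l].
move=> /(le_trans hk) hm; have kk : (11 * 576 * (75 * k) <= m)%N.
  rewrite -(ler_nat R) !natrM; apply: le_trans hm.
  by rewrite le_eqVlt; apply/orP; left; apply/eqP; field.
by move: kk k0; clear; lia.
Qed.

Lemma klnk_ge k : (0 < k)%N -> k%:R <= 1 + 2 * (k%:R * ln k%:R) :> R.
Proof.
case: k => [|[|k]] // _; first by rewrite ln1 mulr0 mulr0 addr0.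
have h := @ln_nat_ge k.+2 isT; set x := k.+2%:R in h *.
have x0 : 0 <= x by rewrite ler0n.
by nra.
Qed.

Lemma klnk_ge0 k : 0 <= k%:R * ln k%:R :> R.
Proof.
case: k => [|k]; first by rewrite mul0r.
by rewrite mulr_ge0 // ln_ge0 // ler1n.
Qed.

(** The sample bound is at most A k (B + ln k) + T, and the linear term is absorbed by k <= 1 + 2 k
    ln k. The constant [g] remains as k ln k vanishes at k = 1; absolute values keep the constants
    nonnegative for every [mu]. *)
Lemma sample_size_le delta tau rho mu : 0 < delta -> delta <= 24^-1 ->
    0 < tau -> tau <= 3^-1 ->
  exists c g : R, [/\ 0 <= c, 0 <= g & forall k m r, (0 < k)%N ->
    11 * k%:R <= r -> r <= rho * k%:R ->
    m%:R <= mu * sample_bound r delta tau -> m%:R <= c * (k%:R * ln k%:R) + g].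
Proof.
move=> d0 d24 tau0 tau3.
set A := 10 * rho / delta ^+ 2; set B := ln (8 * rho / delta ^+ 2).
set T := 2 / delta ^+ 2 * ln (2 / tau).
exists `|mu * (A + 2 * (A * B))|, `|mu * (A * B + T)|; split=> // k m r k0 kr rk.
have k1 : 1 <= k%:R :> R by rewrite ler1n.
have d2 : 0 < (delta ^+ 2)^-1 by rewrite invr_gt0 exprn_gt0.
have d21 : 1 <= (delta ^+ 2)^-1.
  by rewrite invf_ge1 ?exprn_gt0 // expr_le1 // ?ltW //; lra.
have rho11 : 11 <= rho.
  by rewrite -(ler_pM2r (lt_le_trans ltr01 k1)) (le_trans kr).
have A0 : 0 <= A by rewrite /A !mulr_ge0 ?ltW //; lra.
have B0 : 0 <= B.
  rewrite /B ln_ge0 // -[1]mulr1; apply: ler_pM => //; lra.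
have T0 : 0 <= T.
  apply: mulr_ge0; first by rewrite mulr_ge0 // ltW.
  by rewrite ltW // ln_gt0 // ltr_pdivlMr //; lra.
have r0 : 0 < r by lra.
have le1 : 10 * r / delta ^+ 2 <= A * k%:R.
  rewrite /A; have -> : 10 * rho / delta ^+ 2 * k%:R = 10 * (rho * k%:R) / delta ^+ 2 by ring.
  by rewrite ler_pM2r // ler_pM2l.
have le2 : ln (8 * r / delta ^+ 2) <= B + ln k%:R.
  rewrite /B -lnM ?posrE ?ltr0n //; last by rewrite !mulr_gt0 //; lra.
  have -> : 8 * rho / delta ^+ 2 * k%:R = 8 * (rho * k%:R) / delta ^+ 2 by ring.
  rewrite ler_ln ?posrE ?mulr_gt0 //; [by rewrite ler_pM2r // ler_pM2l | lra | lra].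
have ln0 : 0 <= ln (8 * r / delta ^+ 2).
  rewrite ln_ge0 // -[1]mulr1; apply: ler_pM => //; lra.
have sb : sample_bound r delta tau <= A * k%:R * (B + ln k%:R) + T.
  rewrite /sample_bound ge_max; apply/andP; split; last first.
    rewrite lerDr; apply: mulr_ge0; first exact: mulr_ge0.
    by rewrite addr_ge0 // ln_ge0.
  apply: (@le_trans _ _ (A * k%:R * (B + ln k%:R))); last by rewrite lerDl.
  by apply: ler_pM => //; rewrite !mulr_ge0 ?ltW //.
have s0 : 0 <= sample_bound r delta tau.
  by rewrite /sample_bound le_max mulr_ge0 // !mulr_ge0 // ltW.
move=> hm; have [mu0|mu0] := ltP mu 0.
  apply: (@le_trans _ _ 0); first by apply: le_trans hm _; rewrite nmulr_rle0.
  by rewrite addr_ge0 // mulr_ge0 // klnk_ge0.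
have AB : 0 <= A * B by rewrite mulr_ge0.
rewrite !ger0_norm; [|by rewrite mulr_ge0 // addr_ge0|by rewrite mulr_ge0 // addr_ge0 // mulr_ge0].
clearbody A B T; apply: le_trans hm _; rewrite -mulrA -mulrDr ler_wpM2l //.
apply: le_trans sb _; have := klnk_ge k0; have := klnk_ge0 k.
set x := k%:R * ln k%:R => x0 kx.
have -> : A * k%:R * (B + ln k%:R) = A * B * k%:R + A * x by rewrite /x; ring.
have := ler_wpM2l AB kx; lra.
Qed.

(** About 60000 ln n levels: (1 - 1/6000)^f <= exp(-f/6000) <= n^-10. The [+ 2] in [a] absorbs
    rounding up, as ln n >= 1/2. *)
Lemma fuel_exists : exists2 a : R, 1 <= a & forall n, (1 < n)%N -> exists f : nat,
  [/\ (0 < f)%N, f%:R <= a * ln n%:R &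
      (n ^ 2)%:R * balance_rate R ^+ f <= (n%:R ^+ 8)^-1].
Proof.
set N : R := 1000 * 6; have N1 : 1 <= N by rewrite /N; lra.
have rateE : balance_rate R = 1 - N^-1 by rewrite /balance_rate /N invfM.
clearbody N; have N0 : 0 < N by lra.
have Ni : 0 <= N^-1 <= 1 by rewrite invr_ge0 ltW // invf_le1.
exists (10 * N + 2) => [|n n1]; first by lra.
have L := ln_nat_ge n1; set l := ln n%:R in L *.
have n0 : 0 < n%:R :> R by rewrite ltr0n ltnW.
have l0 : 0 <= 10 * N * l by rewrite !mulr_ge0 //; lra.
exists (Num.trunc (10 * N * l)).+1; split => //.
  have : (Num.trunc (10 * N * l))%:R <= 10 * N * l by rewrite truncn_le.
  by move: (Num.trunc _) => t; rewrite -[t.+1]addn1 natrD; lra.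
have fl : 10 * N * l <= (Num.trunc (10 * N * l)).+1%:R by rewrite ltW // truncnS_gt.
set f := (Num.trunc _).+1 in fl *.
have th : balance_rate R ^+ f <= expR (- (N^-1 * f%:R)).
  have -> : - (N^-1 * f%:R) = f%:R * (- N^-1) :> R by ring.
  rewrite expRM_natl ler_pXn2r ?nnegrE ?expR_ge0 // rateE; last by lra.
  exact: expR_ge1Dx.
have t10 : balance_rate R ^+ f <= (n%:R ^+ 10)^-1.
  apply: le_trans th _; have -> : (n%:R ^+ 10)^-1 = expR (- (10 * l)) :> R.
    by rewrite expRN expRM_natl /l lnK.
  rewrite ler_expR lerN2 -(ler_pM2l N0) mulVKf ?lt0r_neq0 //.
  by apply: le_trans fl; rewrite mulrCA mulrA.
rewrite natrX; apply: (@le_trans _ _ (n%:R ^+ 2 * (n%:R ^+ 10)^-1)).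
  by rewrite ler_pM2l ?exprn_gt0.
by rewrite (exprD _ 2 8) invfM mulrA mulfV ?mul1r // lt0r_neq0 ?exprn_gt0.
Qed.

Section Budget.
Context (kappa m f k d : nat).
Hypotheses (f0 : (0 < f)%N) (k0 : (0 < k)%N) (m0 : (0 < m)%N).

Lemma depth_le : ((f * k.+1).+1 <= 3 * (f * k))%N.
Proof. by move: f0 k0; clear; nia. Qed.

Lemma width_le : ((m + f * k.+1).+1 <= 4 * (m * (f * k)))%N.
Proof.
have h : (f * k <= m * (f * k))%N by rewrite leq_pmull.
have h2 : (m <= m * (f * k))%N by rewrite leq_pmulr // muln_gt0 f0.
by have := depth_le; move: h h2; move: (m * (f * k))%N; clear; lia.
Qed.

(** Polynomial factors in [m] move into the exponent, where [m] is O(k log k). *)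
Lemma cube_pow_le : (m ^ 3 * 2 ^ m <= 2 ^ (4 * m))%N.
Proof.
have mp : (m <= 2 ^ m)%N := ltnW (ltn_expl m (leqnn 2)).
rewrite (_ : 4 * m = m * 3 + m)%N; last by clear; lia.
by rewrite expnD expnM leq_mul // leq_exp2r.
Qed.

Lemma sq_pow_le : (m ^ 2 * 2 ^ m <= 2 ^ (4 * m))%N.
Proof. by apply: leq_trans cube_pow_le; rewrite leq_mul2r leq_pexp2l ?orbT. Qed.

(** One factor [f] counts levels and two come from the squared width of the matrices, which is O(m f
    k); cubic costs give one more factor [f] and [k] in the time bound. *)
Lemma query_budget_le : (f * query_budget k d m (f * k.+1) <=
  f ^ 3 * k ^ 2 * (64 * 2 ^ (4 * m) + 162 * (d * k)))%N.
Proof.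
have hz : ((f * k.+1).+1 ^ 2 <= (3 * (f * k)) ^ 2)%N by rewrite leq_exp2r // depth_le.
have hw : ((m + f * k.+1).+1 ^ 2 <= (4 * (m * (f * k))) ^ 2)%N.
  by rewrite leq_exp2r // width_le.
have hD : (d * k.+1 <= 2 * (d * k))%N by rewrite mulnCA leq_mul2l orbC; move: k0; clear; lia.
have hp : (2 ^ m + 3 <= 4 * 2 ^ m)%N by have := expn_gt0 2 m; move: (2 ^ m)%N; clear; lia.
have := sq_pow_le; rewrite /query_budget; move: hp hw hz hD.
move: (2 ^ m)%N (2 ^ (4 * m))%N => p q hp hw hz hD pq.
apply: (@leq_trans (f * (4 * p * (4 * (m * (f * k))) ^ 2 +
    9 * (2 * (d * k) * (3 * (f * k)) ^ 2)))).
  rewrite leq_mul2l; apply/orP; right; apply: leq_add; first exact: leq_mul.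
  by rewrite leq_mul2l /= leq_mul.
have -> : (f * (4 * p * (4 * (m * (f * k))) ^ 2 + 9 * (2 * (d * k) * (3 * (f * k)) ^ 2)) =
    f ^ 3 * k ^ 2 * (64 * (m ^ 2 * p) + 162 * (d * k)))%N by ring.
by rewrite leq_mul2l leq_add2r leq_mul2l pq !orbT.
Qed.

Lemma time_budget_le : (f * time_budget kappa k d m (f * k.+1) <=
  f ^ 4 * k ^ 3 * (kappa.+1 * (768 * 2 ^ (4 * m) + 1350 * (d * k))))%N.
Proof.
have hz : ((f * k.+1).+1 ^ 3 <= (3 * (f * k)) ^ 3)%N by rewrite leq_exp2r // depth_le.
have hw : ((m + f * k.+1).+1 ^ 3 <= (4 * (m * (f * k))) ^ 3)%N.
  by rewrite leq_exp2r // width_le.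
have hD : (d * k.+1 <= 2 * (d * k))%N by rewrite mulnCA leq_mul2l orbC; move: k0; clear; lia.
have := cube_pow_le; rewrite /time_budget; move: hw hz hD.
move: (2 ^ m)%N (2 ^ (4 * m))%N => p q hw hz hD pq.
apply: (@leq_trans (f * (kappa.+1 * (12 * (p * (4 * (m * (f * k))) ^ 3) +
    25 * (2 * (d * k) * (3 * (f * k)) ^ 3))))).
  rewrite !leq_mul2l; apply/orP; right; rewrite /=; apply: leq_add.
    by rewrite !leq_mul2l hw !orbT.
  by rewrite leq_mul2l /= leq_mul.
have -> : (f * (kappa.+1 * (12 * (p * (4 * (m * (f * k))) ^ 3) +
    25 * (2 * (d * k) * (3 * (f * k)) ^ 3))) =
    f ^ 4 * k ^ 3 * (kappa.+1 * (768 * (m ^ 3 * p) + 1350 * (d * k))))%N.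
  by move: kappa.+1 => K; ring.
by rewrite !leq_mul2l leq_add2r leq_mul2l pq !orbT.
Qed.

End Budget.

(** [a ^+ 4] serves both exponents [j], as [1 <= a]; [2^-1 <= l] charges [Y] to [2 * (Y * l)], which
    explains [2 * v]. *)
Lemma scaled_budget_le (a l f n k Q Y P M K L u v : R) (i j : nat) :
  1 <= a -> 2^-1 <= l -> 0 <= n -> 0 <= k -> 0 <= Y -> 0 <= P -> 0 <= M ->
  0 <= f <= a * l -> 0 <= Q <= M * P -> 0 <= K <= L -> (j <= 4)%N -> 0 <= u -> 0 <= v ->
  n * (f ^+ j * k ^+ i * (K * (u * Q + v * Y))) <=
  a ^+ 4 * (L * (u * M + 2 * v)) * (P + Y * l) * k ^+ i * n * l ^+ j.
Proof.
move=> a1 l2 n0 k0 Y0 P0 M0 /andP[f0 fa] /andP[Q0 QM] /andP[K0 KL] j4 u0 v0.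
have a0 : 0 <= a by apply: le_trans a1.
have l0 : 0 <= l by apply: le_trans l2; rewrite invr_ge0.
have fj : f ^+ j <= a ^+ 4 * l ^+ j.
  apply: (@le_trans _ _ (a ^+ j * l ^+ j)).
    by rewrite -exprMn; apply: lerXn2r; rewrite // nnegrE mulr_ge0.
  by rewrite ler_wpM2r ?exprn_ge0 // ler_weXn2l.
have Yl : Y <= 2 * (Y * l).
  by rewrite mulrCA ler_peMr // -ler_pdivrMl // mulr1.
have main : u * Q + v * Y <= (u * M + 2 * v) * (P + Y * l).
  apply: (@le_trans _ _ (u * (M * P) + v * (2 * (Y * l)))).
    by rewrite lerD // ler_wpM2l.
  have -> : (u * M + 2 * v) * (P + Y * l) =
      u * (M * P) + v * (2 * (Y * l)) + (u * M * (Y * l) + 2 * v * P) by ring.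
  by rewrite lerDl addr_ge0 // !mulr_ge0.
have -> : a ^+ 4 * (L * (u * M + 2 * v)) * (P + Y * l) * k ^+ i * n * l ^+ j =
    n * (a ^+ 4 * l ^+ j * k ^+ i * (L * ((u * M + 2 * v) * (P + Y * l)))) by ring.
apply: ler_wpM2l => //; apply: ler_pM.
- by rewrite mulr_ge0 // exprn_ge0.
- by rewrite mulr_ge0 // addr_ge0 // mulr_ge0.
- by rewrite ler_wpM2r // exprn_ge0.
- by rewrite ler_pM // addr_ge0 // mulr_ge0.
Qed.

End Reals.

(* The implied constants c and C depend on delta, tau, on the implied constants
   rho and mu in r = O(k) and m = O(sample_bound r delta tau), and on the constant
   kappa of the cost model only. *)
Theorem theorem32 (R : realType) (kappa : nat) (delta tau rho mu : R)
    (delta_gt0 : 0 < delta) (delta_le : delta <= 24^-1)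
    (tau_gt0 : 0 < tau) (tau_le : tau <= 3^-1) :
  exists c C : R, [/\ 0 < c, 0 < C &
    forall (n : nat) (e : rel 'I_n) (k d : nat) (Sigma : 'M[R]_n) (r : R) (m : nat),
      (1 < n)%N ->
      symmetric e -> irreflexive e ->
      connected_graph e ->
      (treewidth e <= k)%N ->
      (max_degree e <= d)%N ->
      in_model e Sigma -> generic e Sigma ->
      11 * k%:R <= r -> r <= rho * k%:R ->
      sample_bound r delta tau <= m%:R ->
      m%:R <= mu * sample_bound r delta tau ->
      1 - (n%:R ^+ 8)^-1 <=
        halting_pr Sigma
          (fun q t => (q%:R <= query_bound c C n k d) &&
                      (t%:R <= time_bound c C n k d))
          (fun fuel => Reconstruct m kappa fuel [set: 'I_n] set0 0)].
Proof.
have [c [g [c0 g0 m_le]]] := sample_size_le rho mu delta_gt0 delta_le tau_gt0 tau_le.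
have [a a1 fuel] := fuel_exists R.
set M : R := 2 `^ (4 * g).
have M1 : 1 <= M.
  have g4 : 0 <= 4 * g by rewrite mulr_ge0.
  by have := ler_powR (ler1n R 2) g4; rewrite powRr0.
have a0 : 0 < a by lra.
(* 768 and 1350 are the coefficients of the time bound; those of the query bound are smaller, so one
   [C] serves both. *)
pose C := a ^+ 4 * (kappa.+1%:R * (768 * M + 2 * 1350)).
have C0 : 0 < C by rewrite /C !mulr_gt0 ?exprn_gt0 //; lra.
(* The exponent is [4 * m] with m <= c k ln k + g: the part [4 * g] goes into [M], and the 1 makes
   the constant positive. *)
exists (4 * c + 1), C; split=> //; first by lra.
move=> n e k d Sigma r m n1 e_sym e_irr ce tw deg [pd Theta0] gen kr rk sm ms.
have T1 : (1 < #|'I_n|)%N by rewrite card_ord.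
have k0 := treewidth_gt0 ce T1 tw.
have d0 : (0 < d)%N := leq_trans (max_degree_gt0 ce T1) deg.
have [m1000 m_big] := sample_size_ge k0 delta_gt0 delta_le kr sm.
have [f [f0 fa fn]] := fuel n n1.
have [|//|] := @Reconstruct_correct _ _ _ _ kappa _ _ _ e_sym tw deg d0 gen pd Theta0
  m1000 m_big (f * k.+1) f [set: 'I_n] set0 0 (connected_component ce (ltnW T1)).
- by move=> i j _ _; rewrite mxE.
- by rewrite cards0.
rewrite cardsT card_ord => hr he; apply: (@halting_pr_ge _ _ _ _ _ _ f).
apply: le_trans (lerB (lexx 1) fn) _; apply: le_trans he _; apply: ev_pr hr _ => q t.
rewrite !add0n => hq ht.
set l : R := ln n%:R in fa *; have l2 : 2^-1 <= l := ln_nat_ge R n1.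
have l0 : 0 < l by apply: lt_le_trans l2; rewrite invr_gt0.
set x : R := k%:R * ln k%:R; have x0 : 0 <= x := klnk_ge0 R k.
set P : R := 2 `^ ((4 * c + 1) * x); have P0 : 0 <= P := powR_ge0 _ _.
have mP : 2 ^+ (4 * m) <= M * P.
  rewrite -powR_mulrn // /M /P -powRD; last by rewrite pnatr_eq0 implybT.
  rewrite ler_powR ?ler1n // natrM; apply: (@le_trans _ _ (4 * (c * x + g))).
    by rewrite ler_pM2l // (m_le k m r).
  have -> : 4 * (c * x + g) = 4 * g + 4 * c * x by ring.
  by rewrite lerD2l ler_wpM2r // lerDl.
pose L : R := kappa.+1%:R; have L1 : 1 <= L by rewrite ler1n.
have bounds i j K u v :
    0 <= K <= L -> (j <= 4)%N -> 0 <= u <= 768 -> 0 <= v <= 1350 ->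
    n%:R * (f%:R ^+ j * k%:R ^+ i * (K * (u * 2 ^+ (4 * m) + v * (d%:R * k%:R)))) <=
    call_bound (4 * c + 1) C n k d * k%:R ^+ i * n%:R * l ^+ j.
  move=> KL j4 /andP[u0 u768] /andP[v0 v1350].
  have M0 : 0 <= M by apply: le_trans M1.
  have f_le : 0 <= (f%:R : R) <= a * l by rewrite ler0n.
  have Q_le : 0 <= (2 : R) ^+ (4 * m) <= M * P by rewrite exprn_ge0.
  have Y0 : 0 <= d%:R * k%:R :> R by rewrite mulr_ge0.
  apply: le_trans (scaled_budget_le i a1 l2 (ler0n _ n) (ler0n _ k) Y0 P0 M0 f_le Q_le KL j4 u0 v0) _.
  rewrite /call_bound -/x -/l -/P -/L /C; apply: ler_wpM2r; first by rewrite exprn_ge0 // ltW.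
  apply: ler_wpM2r => //; apply: ler_wpM2r; first by rewrite exprn_ge0.
  apply: ler_wpM2r; first by rewrite addr_ge0 // mulr_ge0 // ltW.
  apply: ler_wpM2l; first by rewrite exprn_ge0 // ltW.
  apply: ler_wpM2l => //; apply: lerD; first exact: ler_wpM2r.
  by rewrite ler_pM2l.
apply/andP; split.
  have h : (q <= n * (f ^ 3 * k ^ 2 * (1 * (64 * 2 ^ (4 * m) + 162 * (d * k)))))%N.
    apply: leq_trans hq _; rewrite mulnCA leq_mul2l mul1n.
    by rewrite query_budget_le ?orbT // (leq_trans _ m1000).
  apply: le_trans (_ : (n * _)%:R <= _); first by rewrite ler_nat; exact: h.
  rewrite !(natrM, natrD, natrX) /query_bound.
  by apply: bounds; rewrite ?ler01 ?ler0n ?ler_nat.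
have h : (t <= n * (f ^ 4 * k ^ 3 * (kappa.+1 * (768 * 2 ^ (4 * m) + 1350 * (d * k)))))%N.
  apply: leq_trans ht _; rewrite mulnCA leq_mul2l.
  by rewrite time_budget_le ?orbT // (leq_trans _ m1000).
apply: le_trans (_ : (n * _)%:R <= _); first by rewrite ler_nat; exact: h.
rewrite !(natrM, natrD, natrX) /time_bound.
by apply: bounds; rewrite ?ler0n ?lexx ?ler_nat.
Qed.
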